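(* Let $d\ge 1$ be an integer, $b$ a prime and $v\ge 0$ an integer. Let $1\leq p<\infty$ and $0<r<1/\max(p,2)$. There exists a constant $C_{p,r,d,b,v}>0$ such that for every positive integer $n$ and every order $1$ digital $(v,n,d)$-net $\mathcal{P}_n^b$ over $\mathbb{F}_b$ we have \[ \left\|D_{\mathcal{P}_n^b}\,|\,S_p^rH([0,1)^d)\right\|\leq C_{p,r,d,b,v}\,b^{n(r-1)}\,n^{(d-1)/2}. \]
   Context: Discrepancy function: for a finite family $\mathcal{P}$ of $N$ points in $[0,1)^d$ (points counted with multiplicity), $D_{\mathcal{P}}(x)=\frac1N\sum_{z\in\mathcal{P}}\chi_{[0,x)}(z)-x_1\cdots x_d$ for $x=(x_1,\ldots,x_d)\in[0,1)^d$, where $\chi_{[0,x)}$ is the characteristic function of $[0,x)=[0,x_1)\times\cdots\times[0,x_d)$. Digital nets: let $b$ be prime and let $\mathbb{F}_b$ be the field with $b$ elements, identified with $\{0,1,\ldots,b-1\}$ with arithmetic modulo $b$. For $s,n\in\mathbb{N}$ with $s\ge n$ let $C_1,\ldots,C_d$ be $s\times n$ matrices over $\mathbb{F}_b$. For $\nu\in\{0,\ldots,b^n-1\}$ with $b$-adic expansion $\nu=\nu_0+\nu_1b+\cdots+\nu_{n-1}b^{n-1}$ put $\bar\nu=(\nu_0,\ldots,\nu_{n-1})^\top\in\mathbb{F}_b^n$, $C_i\bar\nu=(x_{i,\nu,1},\ldots,x_{i,\nu,s})^\top\in\mathbb{F}_b^s$, $x_{i,\nu}=x_{i,\nu,1}b^{-1}+\cdots+x_{i,\nu,s}b^{-s}\in[0,1)$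 and $x_\nu=(x_{1,\nu},\ldots,x_{d,\nu})$. The family $\mathcal{P}_n^b=\{x_0,\ldots,x_{b^n-1}\}$ of $N=b^n$ points (with multiplicity) is called a digital net over $\mathbb{F}_b$. Order $\sigma$ digital $(v,n,d)$-net: let $\sigma\in\mathbb{N}$, $s\ge\sigma n$, and let $0\le v\le\sigma n$ be an integer. Let $c_{i,1},\ldots,c_{i,s}\in\mathbb{F}_b^n$ be the rows of $C_i$. If for all choices of $0\le\eta_i\le s$ and indices $1\le\lambda_{i,\eta_i}<\cdots<\lambda_{i,1}\le s$ ($1\le i\le d$) with \[\sum_{i=1}^d\left(\lambda_{i,1}+\cdots+\lambda_{i,\min(\eta_i,\sigma)}\right)\le\sigma n-v\] the vectors $c_{1,\lambda_{1,1}},\ldots,c_{1,\lambda_{1,\eta_1}},\ldots,c_{d,\lambda_{d,1}},\ldots,c_{d,\lambda_{d,\eta_d}}$ are linearly independent over $\mathbb{F}_b$, then $\mathcal{P}_n^b$ is called an order $\sigma$ digital $(v,n,d)$-net over $\mathbb{F}_b$. Sobolev spaces with dominating mixed smoothness: $S_p^rH([0,1)^d)=S_{p,2}^rF([0,1)^d)$, with the norm of the latter, where the Triebel-Lizorkin space $S_{p,q}^rF$ is defined as follows. Let $\mathcal{F}$ be the Fourier transform on tempered distributions $\mathcal{S}'(\mathbb{R}^d)$. Fix $\varphi_0\in\mathcal{S}(\mathbb{R})$ with $\varphi_0(x)=1$ for $|x|\le1$ and $\varphi_0(x)=0$ for $|x|>\frac32$; put $\varphi_k(x)=\varphi_0(2^{-k}x)-\varphi_0(2^{-k+1}x)$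 for $k\in\mathbb{N}$ and $\varphi_{\bar k}(x)=\varphi_{k_1}(x_1)\cdots\varphi_{k_d}(x_d)$ for $\bar k=(k_1,\ldots,k_d)\in\mathbb{N}_0^d$. For $0<p,q<\infty$, $r\in\mathbb{R}$, $S_{p,q}^rF(\mathbb{R}^d)$ consists of all $f\in\mathcal{S}'(\mathbb{R}^d)$ with finite quasi-norm \[\|f|S_{p,q}^rF(\mathbb{R}^d)\|=\Big\|\Big(\sum_{\bar k\in\mathbb{N}_0^d}2^{r(k_1+\cdots+k_d)q}\,|\mathcal{F}^{-1}(\varphi_{\bar k}\mathcal{F}f)(\cdot)|^q\Big)^{1/q}\Big|\,L_p(\mathbb{R}^d)\Big\|.\] Let $\mathcal{D}'([0,1)^d)$ be the space of distributions dual to the smooth complex-valued functions on $\mathbb{R}^d$ with compact support in the interior of $[0,1)^d$. $S_{p,q}^rF([0,1)^d)$ consists of all $f\in\mathcal{D}'([0,1)^d)$ with finite quasi-norm $\|f|S_{p,q}^rF([0,1)^d)\|=\inf\{\|g|S_{p,q}^rF(\mathbb{R}^d)\|:\ g\in S_{p,q}^rF(\mathbb{R}^d),\ g|_{[0,1)^d}=f\}$. *)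

(* Defs.v *)
(* MathComp / MathComp-Analysis; complex numbers are [R[i]] from real-closed. *)
From HB Require Import structures.
From mathcomp Require Import all_boot all_order all_algebra.
From mathcomp Require Import complex.
From mathcomp Require Import all_classical all_reals all_analysis.
Set Implicit Arguments.
Unset Strict Implicit.
Unset Printing Implicit Defensive.
Import Order.TTheory GRing.Theory Num.Theory.
Import numFieldNormedType.Exports.
Local Open Scope classical_set_scope.
Local Open Scope ring_scope.
Local Open Scope complex_scope.

(* Powers of a sigma-finite measure, on tuples. *)

Section tuple_measure_cons.
Context {dT : measure_display} {T : measurableType dT} {R : realType} (d : nat).
Variables (m1 : {sigma_finite_measure set T -> \bar R})
  (m : {sigma_finite_measure set (d.-tuple T) -> \bar R}).

Definition tuple_cons (x : T * d.-tuple T) : d.+1.-tuple T :=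
  [the d.+1.-tuple T of x.1 :: x.2].

Lemma measurable_tuple_cons : measurable_fun [set: T * d.-tuple T] tuple_cons.
Proof.
exact: (@measurable_cons _ _ _ _ fst d snd measurable_fst measurable_snd).
Qed.

Definition tuple_measure_cons : set (d.+1.-tuple T) -> \bar R :=
  pushforward (m1 \x m)%E tuple_cons.

Let mu0 : tuple_measure_cons set0 = 0%E.
Proof. by rewrite /tuple_measure_cons /pushforward preimage_set0 measure0. Qed.

Let mu_ge0 A : (0 <= tuple_measure_cons A)%E.
Proof. by rewrite /tuple_measure_cons /pushforward measure_ge0. Qed.

Let mu_sigma_additive : semi_sigma_additive tuple_measure_cons.
Proof.
move=> F mF tF mUF; rewrite /tuple_measure_cons /pushforward preimage_bigcup.
apply: measure_semi_sigma_additive.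
- by move=> n; rewrite -[X in measurable X]setTI; exact: measurable_tuple_cons.
- apply/trivIsetP => /= i j _ _ ij; rewrite -preimage_setI.
  by move/trivIsetP : tF => /(_ _ _ _ _ ij) ->//; rewrite preimage_set0.
- rewrite -preimage_bigcup -[X in measurable X]setTI.
  exact: measurable_tuple_cons.
Qed.

HB.instance Definition _ := isMeasure.Build _ _ _ tuple_measure_cons
  mu0 mu_ge0 mu_sigma_additive.

Let mu_sigma_finite : sigma_finite setT tuple_measure_cons.
Proof.
have /sigma_finiteP[F [TF ndF Foo]] := sigma_finiteT m1.
have /sigma_finiteP[G [TG ndG Goo]] := sigma_finiteT m.
pose u (t : d.+1.-tuple T) : T * d.-tuple T := (thead t, [tuple of behead t]).
have uK : u \o tuple_cons = id.
  by apply/funext => -[a t]; congr (_, _); apply: val_inj.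
have mu_u : measurable_fun [set: d.+1.-tuple T] u.
  apply: measurable_fun_pair; first exact: (@measurable_tnth _ T d.+1 ord0).
  exact: measurable_behead.
have FG n : measurable (F n `*` G n).
  by have [? _] := Foo n; have [? _] := Goo n; exact: measurableX.
exists (fun n => u @^-1` (F n `*` G n)).
  rewrite -preimage_bigcup [X in u @^-1` X](_ : _ = setT) ?preimage_setT//.
  apply/seteqP; split=> // -[x y] _.
  have [n _ Fnx] : (\bigcup_n F n) x by rewrite -TF.
  have [k _ Gky] : (\bigcup_n G n) y by rewrite -TG.
  exists (maxn n k) => //; split => /=.
  - by move: x Fnx; exact/subsetPset/ndF/leq_maxl.
  - by move: y Gky; exact/subsetPset/ndG/leq_maxr.
move=> n; split; first by rewrite -[X in measurable X]setTI; exact: mu_u.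
rewrite /tuple_measure_cons /pushforward.
have -> : tuple_cons @^-1` (u @^-1` (F n `*` G n)) = F n `*` G n.
  by rewrite -comp_preimage uK preimage_id.
have [? ?] := Foo n; have [? ?] := Goo n.
by rewrite product_measure1E// lte_mul_pinfty// ge0_fin_numE.
Qed.

HB.instance Definition _ := Measure_isSigmaFinite.Build _ _ _
  tuple_measure_cons mu_sigma_finite.

End tuple_measure_cons.

Fixpoint tuple_measure {dT : measure_display} {T : measurableType dT}
    {R : realType} (m1 : {sigma_finite_measure set T -> \bar R}) (d : nat) :
    {sigma_finite_measure set (d.-tuple T) -> \bar R} :=
  match d with
  | 0 => dirac ([tuple] : 0.-tuple T)
  | d'.+1 => tuple_measure_cons m1 (tuple_measure m1 d')
  end.

Definition lebesgue_tuple (R : realType) (d : nat) :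
    {sigma_finite_measure set (d.-tuple (measurableTypeR R)) -> \bar R} :=
  tuple_measure (@lebesgue_measure R) d.

Local Notation Re := (@complex.Re _).
Local Notation Im := (@complex.Im _).
Local Notation normc := ComplexField.Normc.normc.

(* R^d is ['rV[R]_d] for analysis; the library equips tuples, not matrices,   *)
(* with product sigma-algebras, so integration goes through [vec_of].         *)

Section analysis_on_Rd.
Context {R : realType} {d : nat}.
Local Notation Rd := 'rV[R]_d.
Local Notation mu := (lebesgue_tuple R d).

Definition vec_of (t : d.-tuple (measurableTypeR R)) : Rd :=
  \row_i tnth t i.

Definition Cintegrable (f : Rd -> R[i]) : Prop :=
  mu.-integrable setT (fun t => (Re (f (vec_of t)))%:E) /\
  mu.-integrable setT (fun t => (Im (f (vec_of t)))%:E).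

Definition Cintegral (D : set Rd) (f : Rd -> R[i]) : R[i] :=
  (Rintegral mu (vec_of @^-1` D) (fun t => Re (f (vec_of t)))) +i*
  (Rintegral mu (vec_of @^-1` D) (fun t => Im (f (vec_of t)))).

Definition dot (x y : Rd) : R := \sum_i x 0 i * y 0 i.

Definition partials (s : seq 'I_d) (f : Rd -> R) : Rd -> R :=
  foldr (fun i g x => 'D_(delta_mx 0 i) g x) f s.

Definition smooth (f : Rd -> R) : Prop := forall s : seq 'I_d,
  continuous (partials s f) /\
  forall (i : 'I_d) (x : Rd), derivable (partials s f) x (delta_mx 0 i).

Definition Csmooth (f : Rd -> R[i]) : Prop :=
  smooth (Re \o f) /\ smooth (Im \o f).

Definition Cpartials (s : seq 'I_d) (f : Rd -> R[i]) (x : Rd) : R[i] :=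
  partials s (Re \o f) x +i* partials s (Im \o f) x.

Definition schwartz_seminorm (m : nat) (f : Rd -> R[i]) : \bar R :=
  ereal_sup [set y | exists (s : seq 'I_d) (x : Rd), (size s <= m)%N /\
    y = ((1 + `|x|) ^+ m * normc (Cpartials s f x))%:E].

Definition schwartz (f : Rd -> R[i]) : Prop :=
  Csmooth f /\ forall m, (schwartz_seminorm m f < +oo)%E.

(* A functional is carried by a total function; only its values on Schwartz   *)
(* functions (on test functions, for elements of D') are relevant.            *)
Definition functional : Type := (Rd -> R[i]) -> R[i].

Definition tempered (T : functional) : Prop :=
  (forall (a : R[i]) (f g : Rd -> R[i]), schwartz f -> schwartz g ->
     T (fun x => a * f x + g x) = a * T f + T g) /\
  exists (C : R) (m : nat), forall f, schwartz f ->
    ((normc (T f))%:E <= C%:E * schwartz_seminorm m f)%E.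

Definition cis (t : R) : R[i] := cos t +i* sin t.

Definition fourier (f : Rd -> R[i]) (xi : Rd) : R[i] :=
  ((2 * pi) `^ (- (d%:R / 2)))%:C *
  Cintegral setT (fun x => f x * cis (- dot x xi)).

Definition inv_fourier (f : Rd -> R[i]) (x : Rd) : R[i] :=
  ((2 * pi) `^ (- (d%:R / 2)))%:C *
  Cintegral setT (fun xi => f xi * cis (dot x xi)).

Definition dist_fourier (T : functional) : functional :=
  fun psi => T (fourier psi).

Definition dist_inv_fourier (T : functional) : functional :=
  fun psi => T (inv_fourier psi).

Definition dist_mul (m : Rd -> R[i]) (T : functional) : functional :=
  fun psi => T (fun x => m x * psi x).

Definition represents (g : Rd -> R[i]) (T : functional) : Prop :=
  forall psi, schwartz psi ->
    Cintegrable (fun x => g x * psi x) /\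
    T psi = Cintegral setT (fun x => g x * psi x).

Definition Ccontinuous (g : Rd -> R[i]) : Prop :=
  continuous (Re \o g) /\ continuous (Im \o g).

(* The function with which a regular tempered distribution is identified,     *)
(* normalized as its (unique) continuous representative. It exists for        *)
(* F^-1 (m (F T)) with m smooth and compactly supported: Paley-Wiener-Schwartz *)
Definition dist_fun (T : functional) : Rd -> R[i] :=
  xget (fun=> 0) [set g | Ccontinuous g /\ represents g T].

End analysis_on_Rd.

Section triebel_lizorkin.
Context {R : realType}.

(* The line R is identified with ['rV[R]_1]. *)
Definition resolution_seed (phi0 : R -> R[i]) : Prop :=
  [/\ schwartz (fun x : 'rV[R]_1 => phi0 (x 0 0)),
      forall x : R, `|x| <= 1 -> phi0 x = 1
    & forall x : R, 3 / 2 < `|x| -> phi0 x = 0].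

Definition dyadic (phi0 : R -> R[i]) (k : nat) (x : R) : R[i] :=
  if k is k'.+1 then phi0 (x / 2 ^+ k) - phi0 (x / 2 ^+ k') else phi0 x.

Context {d : nat}.
Local Notation Rd := 'rV[R]_d.

Definition dyadic_prod (phi0 : R -> R[i]) (k : {ffun 'I_d -> nat}) (x : Rd) :
    R[i] :=
  \prod_i dyadic phi0 (k i) (x 0 i).

Definition block (phi0 : R -> R[i]) (T : @functional R d)
    (k : {ffun 'I_d -> nat}) : Rd -> R[i] :=
  dist_fun (dist_inv_fourier (dist_mul (dyadic_prod phi0 k) (dist_fourier T))).

Definition SF_norm (phi0 : R -> R[i]) (p q r : R) (T : @functional R d) :
    \bar R :=
  Lnorm (lebesgue_tuple R d) p%:E (fun t =>
    (\esum_(k in [set: {ffun 'I_d -> nat}])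
       (2 `^ (r * (\sum_i k i)%N%:R * q) *
        normc (block phi0 T k (vec_of t)) `^ q)%:E)
    `^ q^-1)%E.

Definition SF (phi0 : R -> R[i]) (p q r : R) : set (@functional R d) :=
  [set T | tempered T /\ (SF_norm phi0 p q r T < +oo)%E].

Definition cube : set Rd := [set x | forall i, 0 <= x 0 i < 1].

Definition test_function (psi : Rd -> R[i]) : Prop :=
  Csmooth psi /\ exists K : set Rd,
    [/\ compact K, K `<=` [set x | forall i, 0 < x 0 i < 1]
      & forall x, ~ K x -> psi x = 0].

(* If no such extension [g] exists (in particular if [f] is not in D'), this  *)
(* is the infimum of the empty set, +oo.                                      *)
Definition SF_cube_norm (phi0 : R -> R[i]) (p q r : R) (f : @functional R d) :
    \bar R :=
  ereal_inf [set SF_norm phi0 p q r g | g in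
    [set g | SF phi0 p q r g /\ forall psi, test_function psi -> g psi = f psi]].

Definition SH_cube_norm (phi0 : R -> R[i]) (p r : R) (f : @functional R d) :
    \bar R :=
  SF_cube_norm phi0 p 2 r f.

Definition cube_distribution (f : Rd -> R) : @functional R d :=
  fun psi => Cintegral cube (fun x => (f x)%:C * psi x).

End triebel_lizorkin.

Section discrepancy.
Context {R : realType} {d : nat}.

Definition discrepancy (N : nat) (P : 'I_N -> 'rV[R]_d) (x : 'rV[R]_d) : R :=
  N%:R^-1 * (\sum_(nu < N) [forall i, 0 <= P nu 0 i < x 0 i]%:R)
  - \prod_i x 0 i.

Variables (b s n : nat).

Definition digit_vector (nu : 'I_(b ^ n)%N) : 'cV['F_b]_n :=
  \col_(j < n) ((nu %/ b ^ j) %% b)%N%:R.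

(* Row [k] of [C i] is row [k + 1] in 1-based numbering, whence [b ^- k.+1]. *)
Definition digital_net (C : 'I_d -> 'M['F_b]_(s, n)) (nu : 'I_(b ^ n)%N) :
    'rV[R]_d :=
  \row_i \sum_(k < s) ((C i *m digit_vector nu) k 0 : nat)%:R / b%:R ^+ k.+1.

End discrepancy.

(* [lambda i] lists lambda_(i,1) > ... > lambda_(i,eta_i), shifted by one.    *)
Definition order_digital_net (sigma v b s n d : nat)
    (C : 'I_d -> 'M['F_b]_(s, n)) : Prop :=
  [/\ (0 < sigma)%N, (sigma * n <= s)%N, (v <= sigma * n)%N
    & forall lambda : 'I_d -> seq 'I_s,
        (forall i, sorted (fun k l : 'I_s => (l < k)%N) (lambda i)) ->
        (\sum_i \sum_(k <- take sigma (lambda i)) k.+1 <= sigma * n - v)%N ->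
        free [seq row k (C i) | i <- enum 'I_d, k <- lambda i]].

(* Main.v *)
Require Import Defs.
From mathcomp Require Import all_boot all_order all_algebra.
From mathcomp Require Import complex.
From mathcomp Require Import all_classical all_reals all_analysis.
From mathcomp Require Import measurable_realfun.
From mathcomp Require Import ring lra zify.
Import Order.TTheory GRing.Theory Num.Theory.
Import numFieldNormedType.Exports.
Set Implicit Arguments.
Unset Strict Implicit.
Unset Printing Implicit Defensive.
Local Open Scope classical_set_scope.
Local Open Scope ring_scope.
Local Open Scope complex_scope.
Local Notation Re := (@complex.Re _).
Local Notation Im := (@complex.Im _).
Local Notation normc := ComplexField.Normc.normc.

(* The discrepancy function is the restriction to the cube of
     g y = 1/N sum_z prod_i 1_(]z_i, z_i + 1]) (y_i) - prod_i tri (y_i),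
   where [tri y = y] on ]0, 1[, so the norm of [g] bounds the quotient norm.
   The dyadic blocks of this tensor sum are explicit:
     f_k x = 1/N sum_z prod_i alpha_(k_i) (x_i - z_i) - prod_i beta_(k_i) (x_i),
   the error of the net as a quadrature rule for a product of kernels, where
   [beta_k x] is the mean of [alpha_k (x - w)] over w in ]0, 1[ and, with
   [om u = 1 / (1 + u^2)], [alpha_k (x - w)] and its increments in [w] at scale
   2^-k decay like om x ^ 2 (om (2^k (x - w)) + om (2^k (x - w - 1))).
   Telescoping each factor along the b-adic grids, the net integrates exactly
   all terms whose levels sum to at most n - v. The other terms give
     |f_k x| <= C min (1, (2^|k| / b^n)^(1 - eps)) W^2 (S_k + 2^-|k|),
   W = prod_i om x_i, where the local counting function S_k of the net satisfies
   S_k <= C max (2^-|k|, b^-n) and int S_k <= C 2^-|k|. Hence the P-th moment of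
   2^(r|k|) f_k / W, P = max (p, 2), is at most C b^(n(r-1)P) tau_k^(P/2), where
   tau_k decays geometrically in the distance of 2^|k| to b^n because r P < 1,
   so that sum_k tau_k <= C n^(d-1). Jensen's inequality with the weights tau_k
   then bounds the L_p norm of the square function. *)

(** * Integrals of complex-valued functions *)

(** The extension is chosen so that a block becomes a quadrature error. Intervals of the fixed
    length 1 make all point terms translates of one kernel, and [tri], the convolution of the unit
    interval with itself, has as its block the mean of these translates, so that net average and
    volume term are the two sides of one integration rule. About [n ^ (d - 1)] level vectors have
    [2 ^ |k|] comparable to [b ^ n], and the square root of this number is the whole power of [n] in
    the result; no other step may lose one. For that reason the level sums give up [eps] in the
    exponent instead of counting levels, and the square function is treated with weights. Jensen's
    inequality needs [P >= 2]; the passage from [P] to [p] uses one factor of [W ^ 2], since against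
    the finite measure [W dx] moments of order [P] control those of order [p]. Below the critical
    level the growth [2 ^ (r |k|)] must beat the loss, whence [eps < r]. Above it, one power of
    [S_k] is integrated, which yields [2 ^ -|k|], while the other [P - 1] are bounded by [b ^ -n],
    so that [r P < 1] gives decay. *)

Section complex_facts.
Context {R : realType}.
Implicit Types x y z : R[i].

Lemma ReD x y : Re (x + y) = Re x + Re y. Proof. by case: x y => [? ?] []. Qed.
Lemma ImD x y : Im (x + y) = Im x + Im y. Proof. by case: x y => [? ?] []. Qed.
Lemma ReM x y : Re (x * y) = Re x * Re y - Im x * Im y.
Proof. by case: x y => [? ?] []. Qed.
Lemma ImM x y : Im (x * y) = Re x * Im y + Im x * Re y.
Proof. by case: x y => [? ?] []. Qed.

Lemma normc_ge0 z : 0 <= normc z.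
Proof. by case: z => a b; rewrite sqrtr_ge0. Qed.

Lemma normr_Re_le z : `|Re z| <= normc z.
Proof.
case: z => a b /=; rewrite -sqrtr_sqr; apply: ler_wsqrtr.
by rewrite lerDl sqr_ge0.
Qed.

Lemma normr_Im_le z : `|Im z| <= normc z.
Proof.
case: z => a b /=; rewrite -sqrtr_sqr; apply: ler_wsqrtr.
by rewrite lerDr sqr_ge0.
Qed.

Lemma normc_le_ReIm z : normc z <= `|Re z| + `|Im z|.
Proof.
case: z => a b /=; rewrite -[leRHS]ger0_norm ?addr_ge0// -sqrtr_sqr.
apply: ler_wsqrtr; rewrite sqrrD !real_normK ?num_real// lerD2r lerDl.
by rewrite pmulrn_lge0// mulr_ge0.
Qed.

Lemma normc_real (a : R) : normc a%:C = `|a|.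
Proof. by rewrite /= expr0n/= addr0 sqrtr_sqr. Qed.

Lemma normcM x y : normc (x * y) = normc x * normc y.
Proof. exact: ComplexField.Normc.normcM. Qed.

Lemma normcN x : normc (- x) = normc x.
Proof. by case: x => a b /=; rewrite !sqrrN. Qed.

Lemma normcD x y : normc (x + y) <= normc x + normc y.
Proof. exact: le_normcD. Qed.

Lemma normcB x y : normc (x - y) <= normc x + normc y.
Proof. by rewrite (le_trans (normcD _ _))// normcN. Qed.

Lemma normcBC x y : normc (x - y) = normc (y - x).
Proof. by rewrite -normcN opprB. Qed.

Lemma normc1 : normc (1 : R[i]) = 1.
Proof. exact: ComplexField.Normc.normc1. Qed.

Lemma normc0 : normc (0 : R[i]) = 0.
Proof. exact: ComplexField.Normc.normc0. Qed.

Lemma normc_prod (I : Type) (s : seq I) (P : pred I) (F : I -> R[i]) :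
  normc (\prod_(i <- s | P i) F i) = \prod_(i <- s | P i) normc (F i).
Proof. exact: (big_morph _ normcM normc1). Qed.

Lemma normc_sum (I : Type) (s : seq I) (P : pred I) (F : I -> R[i]) :
  normc (\sum_(i <- s | P i) F i) <= \sum_(i <- s | P i) normc (F i).
Proof.
elim/big_ind2 : _ => [|x1 x2 y1 y2 h1 h2|//]; first by rewrite normc0.
by rewrite (le_trans (normcD _ _))// lerD.
Qed.

Lemma complex_eq x y : Re x = Re y -> Im x = Im y -> x = y.
Proof. by case: x y => [a b] [c e] /= -> ->. Qed.

End complex_facts.

Section cint.
Context {d} {T : measurableType d} {R : realType}.
Implicit Types (mu : {measure set T -> \bar R}) (f g : T -> R[i]).

Definition cmeas f :=
  measurable_fun setT (fun x => Re (f x)) /\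
  measurable_fun setT (fun x => Im (f x)).

Definition cintble mu f :=
  mu.-integrable setT (fun x => (Re (f x))%:E) /\
  mu.-integrable setT (fun x => (Im (f x))%:E).

Definition cint mu f : R[i] :=
  Rintegral mu setT (fun x => Re (f x)) +i*
  Rintegral mu setT (fun x => Im (f x)).

Lemma cintble_meas mu f : cintble mu f -> cmeas f.
Proof. by move=> [/measurable_int/measurable_EFinP ? /measurable_int/measurable_EFinP]. Qed.

Lemma cmeasD f g : cmeas f -> cmeas g -> cmeas (fun x => f x + g x).
Proof.
move=> [f1 f2] [g1 g2]; split.
  by under eq_fun do rewrite ReD; exact: measurable_funD.
by under eq_fun do rewrite ImD; exact: measurable_funD.
Qed.

Lemma cmeasM f g : cmeas f -> cmeas g -> cmeas (fun x => f x * g x).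
Proof.
move=> [f1 f2] [g1 g2]; split.
  under eq_fun do rewrite ReM.
  by apply: measurable_funB; exact: measurable_funM.
under eq_fun do rewrite ImM.
by apply: measurable_funD; exact: measurable_funM.
Qed.

Lemma cmeas_cst c : cmeas (fun=> c).
Proof. by split; exact: measurable_cst. Qed.

Lemma cmeas_real (f : T -> R) :
  measurable_fun setT f -> cmeas (fun x => (f x)%:C).
Proof. by move=> mf; split => //; exact: measurable_cst. Qed.

Lemma cmeas_prod (I : Type) (s : seq I) (P : pred I) (F : I -> T -> R[i]) :
  (forall i, cmeas (F i)) -> cmeas (fun x => \prod_(i <- s | P i) F i x).
Proof.
move=> mF; elim: s => [|i s ih].
  by under eq_fun do rewrite big_nil; exact: cmeas_cst.
under eq_fun do rewrite big_cons.
by case: (P i) => //; apply: cmeasM.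
Qed.

Lemma cintble_le mu f (g : T -> R) : cmeas f ->
  mu.-integrable setT (EFin \o g) -> (forall x, normc (f x) <= g x) ->
  cintble mu f.
Proof.
move=> [f1 f2] ig fg.
have g0 x : 0 <= g x by rewrite (le_trans (normc_ge0 _) (fg x)).
split; apply: le_integrable ig => //.
- exact/measurable_EFinP.
- move=> x _ /=; rewrite lee_fin (ger0_norm (g0 x)).
  exact: le_trans (normr_Re_le _) (fg x).
- exact/measurable_EFinP.
- move=> x _ /=; rewrite lee_fin (ger0_norm (g0 x)).
  exact: le_trans (normr_Im_le _) (fg x).
Qed.

Lemma cintbleD mu f g : cintble mu f -> cintble mu g ->
  cintble mu (fun x => f x + g x).
Proof.
move=> [f1 f2] [g1 g2]; split.
  by under eq_fun do rewrite ReD EFinD; exact: integrableD.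
by under eq_fun do rewrite ImD EFinD; exact: integrableD.
Qed.

Lemma cintbleZ mu c f : cintble mu f -> cintble mu (fun x => c * f x).
Proof.
move=> [f1 f2]; split.
  under eq_fun do rewrite ReM EFinB !EFinM.
  by apply: integrableB => //; exact: integrableZl.
under eq_fun do rewrite ImM EFinD !EFinM.
by apply: integrableD => //; exact: integrableZl.
Qed.

Lemma cintble0 mu : cintble mu (fun=> 0).
Proof. by split; exact: integrable0. Qed.

Lemma cintble_sum mu (I : Type) (s : seq I) (F : I -> T -> R[i]) :
  (forall i, cintble mu (F i)) -> cintble mu (fun x => \sum_(i <- s) F i x).
Proof.
move=> iF; elim: s => [|i s ih].
  by under eq_fun do rewrite big_nil; exact: cintble0.
by under eq_fun do rewrite big_cons; exact: cintbleD.
Qed.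

Lemma cint_eq mu f g : f =1 g -> cint mu f = cint mu g.
Proof. by move=> /funext ->. Qed.

Lemma cint0 mu : cint mu (fun=> 0) = 0.
Proof. by rewrite /cint /Rintegral !integral0. Qed.

Lemma cintD mu f g : cintble mu f -> cintble mu g ->
  cint mu (fun x => f x + g x) = cint mu f + cint mu g.
Proof.
move=> [f1 f2] [g1 g2]; rewrite /cint.
under eq_Rintegral do rewrite ReD.
under [X in _ +i* X]eq_Rintegral do rewrite ImD.
by rewrite !RintegralD.
Qed.

Lemma cintZ mu c f : cintble mu f ->
  cint mu (fun x => c * f x) = c * cint mu f.
Proof.
move=> [f1 f2]; rewrite /cint.
under eq_Rintegral do rewrite ReM.
under [X in _ +i* X]eq_Rintegral do rewrite ImM.
have iz a (g : T -> R) : mu.-integrable setT (fun x => (g x)%:E) ->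
    mu.-integrable setT (EFin \o (fun x => a * g x)).
  by move=> ig; exact: (integrableZl measurableT a ig).
rewrite (RintegralB measurableT (iz _ _ f1) (iz _ _ f2)).
rewrite (RintegralD measurableT (iz _ _ f2) (iz _ _ f1)).
by rewrite !(RintegralZl _ measurableT f1) !(RintegralZl _ measurableT f2); case: c.
Qed.

Lemma cintZr mu c f : cintble mu f ->
  cint mu (fun x => f x * c) = cint mu f * c.
Proof.
by move=> ?; rewrite mulrC -cintZ//; apply: cint_eq => x; rewrite mulrC.
Qed.

Lemma cintB mu f g : cintble mu f -> cintble mu g ->
  cint mu (fun x => f x - g x) = cint mu f - cint mu g.
Proof.
move=> mf mg; rewrite -mulN1r -cintZ// -cintD//; last exact: cintbleZ.
by apply: cint_eq => x; rewrite mulN1r.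
Qed.

Lemma cint_sum mu (I : Type) (s : seq I) (F : I -> T -> R[i]) :
  (forall i, cintble mu (F i)) ->
  cint mu (fun x => \sum_(i <- s) F i x) = \sum_(i <- s) cint mu (F i).
Proof.
move=> iF; elim: s => [|i s ih].
  by rewrite big_nil; under cint_eq do rewrite big_nil; exact: cint0.
rewrite big_cons -ih -cintD//; last exact: cintble_sum.
by apply: cint_eq => x; rewrite big_cons.
Qed.

Lemma cint_real mu (f : T -> R) : cint mu (fun x => (f x)%:C) = (Rintegral mu setT f)%:C.
Proof. by rewrite /cint /= {2}/Rintegral integral0. Qed.

Lemma cintble_real mu (f : T -> R) :
  mu.-integrable setT (EFin \o f) -> cintble mu (fun x => (f x)%:C).
Proof. by move=> h; split => //; exact: integrable0. Qed.

(** Real and imaginary parts are bounded separately, whence the factor 2. *)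
Lemma normc_cint_le mu f (g : T -> R) : cintble mu f ->
  mu.-integrable setT (EFin \o g) -> (forall x, normc (f x) <= g x) ->
  normc (cint mu f) <= 2 * Rintegral mu setT g.
Proof.
move=> [f1 f2] ig fg; apply: le_trans (normc_le_ReIm _) _ => /=.
rewrite mulr_natl mulr2n lerD//.
- apply: le_trans (le_normr_Rintegral _ _) _ => //.
  apply: le_Rintegral => //; first exact: integrable_norm.
  by move=> x _; exact: le_trans (normr_Re_le _) (fg x).
- apply: le_trans (le_normr_Rintegral _ _) _ => //.
  apply: le_Rintegral => //; first exact: integrable_norm.
  by move=> x _; exact: le_trans (normr_Im_le _) (fg x).
Qed.

End cint.

(** * Fubini's theorem for complex-valued functions *)

Section cfubini.
Context d1 d2 (T1 : measurableType d1) (T2 : measurableType d2) (R : realType).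
Variable m1 : {sigma_finite_measure set T1 -> \bar R}.
Variable m2 : {sigma_finite_measure set T2 -> \bar R}.

Lemma integrable_prod (A : T1 -> R) (B : T2 -> R) :
  m1.-integrable setT (EFin \o A) -> m2.-integrable setT (EFin \o B) ->
  (m1 \x m2)%E.-integrable setT (fun z => (A z.1 * B z.2)%:E).
Proof.
move=> /integrableP[mA iA] /integrableP[mB iB].
have mA' : measurable_fun setT A by exact/measurable_EFinP.
have mB' : measurable_fun setT B by exact/measurable_EFinP.
apply/integrable12ltyP.
  apply/measurable_EFinP; apply: measurable_funM.
    exact: measurableT_comp mA' measurable_fst.
  exact: measurableT_comp mB' measurable_snd.
have mB2 : measurable_fun setT (fun y => (`|B y|)%:E).
  by apply/measurable_EFinP; exact: measurableT_comp.
have mA2 : measurable_fun setT (fun y => (`|A y|)%:E).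
  by apply/measurable_EFinP; exact: measurableT_comp.
have E x : (\int[m2]_y `|(A x * B y)%:E| =
    (`|A x|)%:E * \int[m2]_y (`|B y|)%:E)%E.
  rewrite -ge0_integralZl_EFin//.
  by apply: eq_integral => y _; rewrite /= normrM.
rewrite (eq_integral _ _ (fun x _ => E x)).
have B0 : (0 <= \int[m2]_y (`|B y|)%:E)%E.
  by apply: integral_ge0 => y _; rewrite lee_fin.
rewrite ge0_integralZr//.
by apply: lte_mul_pinfty => //;
  rewrite ?ge0_fin_numE//; apply: integral_ge0 => y _; rewrite lee_fin.
Qed.

(** Integrability of every section, not merely of almost every one, identifies the finite-valued
    inner integral with the extended one at each point. The pointwise domination by [A x * B y]
    assumed below provides it. *)
Let fub_real (f : T1 * T2 -> R) :
  (m1 \x m2)%E.-integrable setT (fun z => (f z)%:E) ->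
  (forall x, m2.-integrable setT (fun y => (f (x, y))%:E)) ->
  m1.-integrable setT (fun x => (Rintegral m2 setT (fun y => f (x, y)))%:E) /\
  Rintegral m1 setT (fun x => Rintegral m2 setT (fun y => f (x, y))) =
  Rintegral (m1 \x m2)%E setT f.
Proof.
move=> i12 i2.
have E x : (Rintegral m2 setT (fun y => f (x, y)))%:E =
    (\int[m2]_y (f (x, y))%:E)%E.
  by rewrite /Rintegral fineK//; exact: integrable_fin_num.
split; first by under eq_fun do rewrite E; exact: (integrable_fubini_F i12).
by rewrite {1}/Rintegral (eq_integral _ _ (fun x _ => E x)) (integral12_prod_meas1 i12).
Qed.

Let fub_real2 (f : T1 * T2 -> R) :
  (m1 \x m2)%E.-integrable setT (fun z => (f z)%:E) ->
  (forall y, m1.-integrable setT (fun x => (f (x, y))%:E)) ->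
  measurable_fun setT (fun y => Rintegral m1 setT (fun x => f (x, y))) /\
  Rintegral m2 setT (fun y => Rintegral m1 setT (fun x => f (x, y))) =
  Rintegral (m1 \x m2)%E setT f.
Proof.
move=> i12 i2.
have E x : (Rintegral m1 setT (fun y => f (y, x)))%:E =
    (\int[m1]_y (f (y, x))%:E)%E.
  by rewrite /Rintegral fineK//; exact: integrable_fin_num.
split.
  apply/measurable_EFinP; rewrite (_ : _ \o _ = fubini_G m1 (EFin \o f)).
    exact: (measurable_fubini_G i12).
  by apply/funext => y; exact: E.
by rewrite {1}/Rintegral (eq_integral _ _ (fun x _ => E x)) (integral21_prod_meas1 i12).
Qed.

Variables (G : T1 * T2 -> R[i]) (A : T1 -> R) (B : T2 -> R).
Hypothesis mG : cmeas G.
Hypothesis iA : m1.-integrable setT (EFin \o A).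
Hypothesis iB : m2.-integrable setT (EFin \o B).
Hypothesis GAB : forall x y, normc (G (x, y)) <= A x * B y.

Lemma cintble_prod : cintble (m1 \x m2)%E G.
Proof.
apply: (@cintble_le _ _ _ _ _ (fun z => A z.1 * B z.2)) => //.
- exact: integrable_prod.
- by case=> x y; exact: GAB.
Qed.

Lemma cintble_section1 x : cintble m2 (fun y => G (x, y)).
Proof.
apply: (@cintble_le _ _ _ _ _ (fun y => A x * B y)) => //.
  split; first by exact: (measurable_fun_pair2 _ mG.1).
  by exact: (measurable_fun_pair2 _ mG.2).
exact: (integrableZl measurableT _ iB).
Qed.

Lemma cintble_section2 y : cintble m1 (fun x => G (x, y)).
Proof.
apply: (@cintble_le _ _ _ _ _ (fun x => B y * A x)) => //.
  split; first by exact: (measurable_fun_pair1 _ mG.1).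
  by exact: (measurable_fun_pair1 _ mG.2).
- exact: (integrableZl measurableT _ iA).
- by move=> x; rewrite mulrC.
Qed.

Lemma cintble_fubini1 : cintble m1 (fun x => cint m2 (fun y => G (x, y))).
Proof.
split.
  exact: (fub_real (cintble_prod.1) (fun x => (cintble_section1 x).1)).1.
exact: (fub_real (cintble_prod.2) (fun x => (cintble_section1 x).2)).1.
Qed.

Lemma cintble_fubini2 : cintble m2 (fun y => cint m1 (fun x => G (x, y))).
Proof.
apply: (@cintble_le _ _ _ _ _ (fun y => 2 * Rintegral m1 setT A * B y)).
- split.
    exact: (fub_real2 (cintble_prod.1) (fun x => (cintble_section2 x).1)).1.
  exact: (fub_real2 (cintble_prod.2) (fun x => (cintble_section2 x).2)).1.
- exact: (integrableZl measurableT _ iB).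
- move=> y; rewrite -mulrA -RintegralZr//.
  apply: normc_cint_le => //; first exact: cintble_section2.
  exact: (integrableZr measurableT _ iA).
Qed.

Lemma cint_prod12 :
  cint m1 (fun x => cint m2 (fun y => G (x, y))) = cint (m1 \x m2)%E G.
Proof.
rewrite /cint /=.
have [_ ->] := fub_real (cintble_prod.1) (fun x => (cintble_section1 x).1).
by have [_ ->] := fub_real (cintble_prod.2) (fun x => (cintble_section1 x).2).
Qed.

Lemma cint_prod21 :
  cint m2 (fun y => cint m1 (fun x => G (x, y))) = cint (m1 \x m2)%E G.
Proof.
rewrite /cint /=.
have [_ ->] := fub_real2 (cintble_prod.1) (fun x => (cintble_section2 x).1).
by have [_ ->] := fub_real2 (cintble_prod.2) (fun x => (cintble_section2 x).2).
Qed.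

Lemma cfubini : cint m1 (fun x => cint m2 (fun y => G (x, y))) =
  cint m2 (fun y => cint m1 (fun x => G (x, y))).
Proof. by rewrite cint_prod12 cint_prod21. Qed.

End cfubini.

(** * Integrals of tensor products over tuples *)

Section tuple_integral.
Context {dT : measure_display} {T : measurableType dT} {R : realType}.
Variable m1 : {sigma_finite_measure set T -> \bar R}.

Lemma tuple_integralS d (f : d.+1.-tuple T -> \bar R) :
  measurable_fun setT f ->
  (m1 \x tuple_measure m1 d)%E.-integrable setT (f \o @tuple_cons _ T d) ->
  (tuple_measure m1 d.+1).-integrable setT f /\
  (\int[tuple_measure m1 d.+1]_x f x =
   \int[(m1 \x tuple_measure m1 d)%E]_z f (tuple_cons z))%E.
Proof.
move=> mf intf; split.
  exact: (integrable_pushforward (@measurable_tuple_cons _ T d) mf intf measurableT).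
exact: (integral_pushforward (@measurable_tuple_cons _ T d) mf intf measurableT).
Qed.

Lemma tuple_integral0 (f : 0.-tuple T -> \bar R) :
  measurable_fun setT f ->
  (\int[tuple_measure m1 0]_x f x = f [tuple])%E.
Proof.
by move=> mf; rewrite /= integral_dirac// diracE in_setT mul1e.
Qed.

Lemma cint_tupleS d (f : d.+1.-tuple T -> R[i]) : cmeas f ->
  cintble (m1 \x tuple_measure m1 d)%E (f \o @tuple_cons _ T d) ->
  cintble (tuple_measure m1 d.+1) f /\
  cint (tuple_measure m1 d.+1) f =
  cint (m1 \x tuple_measure m1 d)%E (f \o @tuple_cons _ T d).
Proof.
move=> [m_re m_im] [i_re i_im].
have [r1 r2] := tuple_integralS ((measurable_EFinP _ _).2 m_re) i_re.
have [j1 j2] := tuple_integralS ((measurable_EFinP _ _).2 m_im) i_im.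
by split => //; rewrite /cint /Rintegral r2 j2.
Qed.

Lemma cintble_norm (dX : measure_display) (X : measurableType dX)
    (mu : {measure set X -> \bar R}) (f : X -> R[i]) : cintble mu f ->
  exists2 A : X -> R, mu.-integrable setT (EFin \o A) &
    forall x, normc (f x) <= A x.
Proof.
move=> [f1 f2]; exists (fun x => `|Re (f x)| + `|Im (f x)|).
  exact: (integrableD measurableT (integrable_norm f1) (integrable_norm f2)).
by move=> x; exact: normc_le_ReIm.
Qed.

Lemma cintble_mul_prod dX dY (X : measurableType dX) (Y : measurableType dY)
    (mx : {sigma_finite_measure set X -> \bar R})
    (my : {sigma_finite_measure set Y -> \bar R}) (f : X -> R[i])
    (g : Y -> R[i]) : cintble mx f -> cintble my g ->
  cintble (mx \x my)%E (fun z => f z.1 * g z.2) /\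
  cint (mx \x my)%E (fun z => f z.1 * g z.2) = cint mx f * cint my g.
Proof.
move=> If Ig; have [A iA fA] := cintble_norm If.
have [B iB gB] := cintble_norm Ig.
have [[mf1 mf2] [mg1 mg2]] := (cintble_meas If, cintble_meas Ig).
have mG : cmeas (fun z : X * Y => f z.1 * g z.2).
  apply: (@cmeasM _ _ _ (fun z => f z.1) (fun z => g z.2)); split.
  - exact: (measurableT_comp mf1 measurable_fst).
  - exact: (measurableT_comp mf2 measurable_fst).
  - exact: (measurableT_comp mg1 measurable_snd).
  - exact: (measurableT_comp mg2 measurable_snd).
have GAB x y : normc (f (x, y).1 * g (x, y).2) <= A x * B y.
  by rewrite normcM ler_pM// ?normc_ge0.
split; first exact: cintble_prod mG iA iB GAB.
rewrite -(cint_prod12 mG iA iB GAB) /=.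
under cint_eq do rewrite (cintZ _ Ig).
by rewrite cintZr.
Qed.

(** The kernel [e] of modulus at most 1 is a character [cis] when Fourier integrals are exchanged,
    and the indicator of a difference when a convolution is unfolded; this form serves both. *)
Lemma cfubini_kernel dX dY (X : measurableType dX) (Y : measurableType dY)
    (mx : {sigma_finite_measure set X -> \bar R})
    (my : {sigma_finite_measure set Y -> \bar R}) (a : X -> R[i])
    (b : Y -> R[i]) (e : X * Y -> R[i]) :
  cintble mx a -> cintble my b -> cmeas e -> (forall z, normc (e z) <= 1) ->
  [/\ cint mx (fun x => a x * cint my (fun y => b y * e (x, y))) =
      cint my (fun y => b y * cint mx (fun x => a x * e (x, y))),
      cintble mx (fun x => a x * cint my (fun y => b y * e (x, y))) &
      cintble my (fun y => b y * cint mx (fun x => a x * e (x, y)))].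
Proof.
move=> ia ib me e1.
have [A iA aA] := cintble_norm ia; have [B iB bB] := cintble_norm ib.
have [[ma1 ma2] [mb1 mb2]] := (cintble_meas ia, cintble_meas ib).
pose G (z : X * Y) := a z.1 * b z.2 * e z.
have mG : cmeas G.
  apply: cmeasM => //; apply: (@cmeasM _ _ _ (fun z => a z.1) (fun z => b z.2)); split.
  - exact: (measurableT_comp ma1 measurable_fst).
  - exact: (measurableT_comp ma2 measurable_fst).
  - exact: (measurableT_comp mb1 measurable_snd).
  - exact: (measurableT_comp mb2 measurable_snd).
have GAB x y : normc (G (x, y)) <= A x * B y.
  rewrite !normcM -[leRHS]mulr1 ler_pM ?mulr_ge0 ?normc_ge0//.
  by rewrite ler_pM ?normc_ge0.
have Eb x : cintble my (fun y => b y * e (x, y)).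
  apply: cintble_le iB _; last first.
    by move=> y; rewrite normcM -[leRHS]mulr1 ler_pM ?normc_ge0.
  apply: (cmeasM (cintble_meas ib)); split.
    exact: (measurable_fun_pair2 _ me.1).
  exact: (measurable_fun_pair2 _ me.2).
have Ea y : cintble mx (fun x => a x * e (x, y)).
  apply: cintble_le iA _; last first.
    by move=> x; rewrite normcM -[leRHS]mulr1 ler_pM ?normc_ge0.
  apply: (cmeasM (cintble_meas ia)); split.
    exact: (measurable_fun_pair1 _ me.1).
  exact: (measurable_fun_pair1 _ me.2).
have E1 : (fun x => a x * cint my (fun y => b y * e (x, y))) =
    (fun x => cint my (fun y => G (x, y))).
  apply/funext => x; rewrite -cintZ//; apply: cint_eq => y.
  by rewrite /G mulrA.
have E2 : (fun y => b y * cint mx (fun x => a x * e (x, y))) =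
    (fun y => cint mx (fun x => G (x, y))).
  apply/funext => y; rewrite -cintZ//; apply: cint_eq => x.
  by rewrite /G mulrA [b y * _]mulrC.
rewrite E1 E2; split.
- exact: cfubini mG iA iB GAB.
- exact: cintble_fubini1 mG iA iB GAB.
- exact: cintble_fubini2 mG iA iB GAB.
Qed.

Lemma cmeas_tnth d (i : 'I_d) (f : T -> R[i]) : cmeas f ->
  cmeas (fun t : d.-tuple T => f (tnth t i)).
Proof.
move=> [f1 f2]; split.
  exact: (measurableT_comp f1 (measurable_tnth i)).
exact: (measurableT_comp f2 (measurable_tnth i)).
Qed.

(** The first coordinate is split off: the measure on [d.+1]-tuples is the image of a product
    measure under [tuple_cons], and there Fubini separates the factors. *)
Lemma tensor_cint d (f : 'I_d -> T -> R[i]) : (forall i, cintble m1 (f i)) ->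
  cintble (tuple_measure m1 d) (fun t => \prod_i f i (tnth t i)) /\
  cint (tuple_measure m1 d) (fun t => \prod_i f i (tnth t i)) =
  \prod_i cint m1 (f i).
Proof.
elim: d f => [|d ih] f If.
  rewrite big_ord0; under [X in cintble _ X]eq_fun do rewrite big_ord0.
  under cint_eq do rewrite big_ord0.
  have h (r : R) : (tuple_measure m1 0).-integrable setT (fun=> r%:E).
    apply/integrableP; split; first exact: measurable_cst.
    by rewrite tuple_integral0 ?ltry//; exact: measurable_cst.
  split; first by split; exact: h.
  by apply: complex_eq; rewrite /= /Rintegral integral_dirac ?diracE ?in_setT ?mul1e.
have [ih1 ih2] := ih (fun i => f (lift ord0 i)) (fun i => If _).
have [p1 p2] := cintble_mul_prod (If ord0) ih1.
have E : (fun t => \prod_i f i (tnth t i)) \o @tuple_cons _ T d =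
    (fun z => f ord0 z.1 * \prod_(i < d) f (lift ord0 i) (tnth z.2 i)).
  apply/funext => -[x t] /=; rewrite big_ord_recl tnth0; congr (_ * _).
  by apply: eq_bigr => i _; rewrite tnthS.
have mf : cmeas (fun t : d.+1.-tuple T => \prod_i f i (tnth t i)).
  by apply: cmeas_prod => i; exact: cmeas_tnth (cintble_meas (If i)).
have := @cint_tupleS d (fun t => \prod_i f i (tnth t i)) mf.
rewrite E => /(_ p1)[c1 c2]; split=> //.
by rewrite c2 p2 ih2 big_ord_recl.
Qed.

Lemma tensor_Rintegral d (f : 'I_d -> T -> R) :
  (forall i, m1.-integrable setT (EFin \o f i)) ->
  (tuple_measure m1 d).-integrable setT (fun t => (\prod_i f i (tnth t i))%:E) /\
  Rintegral (tuple_measure m1 d) setT (fun t => \prod_i f i (tnth t i)) =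
  \prod_i Rintegral m1 setT (f i).
Proof.
move=> If.
have [[+ _] +] := @tensor_cint d (fun i x => (f i x)%:C) (fun i => cintble_real (If i)).
under eq_fun do rewrite -rmorph_prod/=.
under cint_eq do rewrite -rmorph_prod/=.
rewrite cint_real; under eq_bigr do rewrite cint_real.
by rewrite -rmorph_prod => h [].
Qed.

End tuple_integral.

(** * Measurability of continuous functions of row vectors *)

Section measurable_on_tuples.
Context {R : realType} {d : nat}.
Local Notation T := (d.-tuple (measurableTypeR R)).

Lemma vec_ofE (t : T) i : vec_of t 0 i = tnth t i.
Proof. by rewrite mxE. Qed.

Definition grid_index (m : nat) (t : T) : {ffun 'I_d -> int} :=
  [ffun i => Num.floor (2 ^+ m * tnth t i)].

Lemma measurable_grid_fiber m a : measurable [set t : T | grid_index m t = a].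
Proof.
rewrite (_ : mkset _ = \bigcap_(i in [set: 'I_d])
    ((fun t : T => tnth t i) @^-1`
      `[(a i)%:~R / 2 ^+ m, (a i + 1)%:~R / 2 ^+ m[%classic)); last first.
  have p2 : (0 : R) < 2 ^+ m by rewrite exprn_gt0.
  apply/seteqP; split => [t /= <- i _|t /= h].
    rewrite /= in_itv/= ffunE ler_pdivrMr// ltr_pdivlMr// mulrC.
    by rewrite Num.Theory.floor_le_tmp floorD1_gt.
  apply/ffunP => i; rewrite ffunE.
  have := h i I; rewrite /= in_itv/= ler_pdivrMr// ltr_pdivlMr// mulrC.
  by move=> h'; exact: floor_def.
apply: fin_bigcap_measurable => // i _.
rewrite -[X in measurable X]setTI; apply: measurable_tnth => //.
Qed.

(** The sigma-algebra lives on tuples and the topology on row vectors, so the two are linked by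
    hand: [f] is the pointwise limit of its values at the lower corners of the dyadic cells of side
    [2 ^- m], and each of these step functions takes countably many values, on measurable cells. *)
Lemma measurable_continuous_vec (f : 'rV[R]_d -> R) :
  continuous f -> measurable_fun setT (fun t : T => f (vec_of t)).
Proof.
move=> cf.
pose q (a : {ffun 'I_d -> int}) m : 'rV[R]_d := \row_i ((a i)%:~R / 2 ^+ m).
pose h m (t : T) := f (q (grid_index m t) m).
apply: (@measurable_fun_cvg _ _ _ _ h) => [m|t _].
  move=> _ Y mY; rewrite setTI.
  rewrite (_ : _ @^-1` _ = \bigcup_(a : {ffun 'I_d -> int})
      (if `[< Y (f (q a m)) >] then [set t : T | grid_index m t = a] else set0)).
    apply: countable_bigcupT_measurable; first exact: countableP.
    by move=> a; case: ifP => // _; exact: measurable_grid_fiber.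
  apply/seteqP; split => [t /= Yt|t [a _]].
    by exists (grid_index m t) => //; rewrite asboolT.
  by case: ifP => //= /asboolP Ya E; rewrite /h E.
apply/cvgrPdist_lt => e e0.
have /cvgrPdist_lt/(_ e e0) := cf (vec_of t).
case/nbhs_ballP => dl /= dl0 hdl.
have /cvgrPdist_lt/(_ dl dl0) : (2 ^- m : R) @[m --> \oo] --> (0 : R).
  by under eq_fun do rewrite -exprVn; apply: cvg_expr; rewrite ger0_norm; lra.
apply: filterS => m; rewrite sub0r normrN ger0_norm ?invr_ge0 ?exprn_ge0// => hm.
apply: hdl; split=> // i j; rewrite ord1 vec_ofE /q mxE ffunE.
rewrite /ball/= (le_lt_trans _ hm)//.
have p2 : (0 : R) < 2 ^+ m by rewrite exprn_gt0.
have h1 := floor_le_tmp (2 ^+ m * tnth t j); have := floorD1_gt (2 ^+ m * tnth t j).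
set F := Num.floor _ in h1 *.
rewrite intrD => h2.
have : F%:~R / 2 ^+ m <= tnth t j by rewrite ler_pdivrMr// mulrC.
have : tnth t j < (F%:~R + 1) / 2 ^+ m by rewrite ltr_pdivlMr// mulrC.
by rewrite mulrDl mul1r ler_norml; lra.
Qed.

End measurable_on_tuples.

(** * The weight [1 / (1 + u ^ 2)] *)

Section om.
Context {R : realType}.
Implicit Types u w x y : R.

Definition om u : R := (1 + u ^+ 2)^-1.

Let den_gt0 u : 0 < 1 + u ^+ 2. Proof. by rewrite ltr_wpDr// sqr_ge0. Qed.

Lemma om_gt0 u : 0 < om u. Proof. by rewrite invr_gt0. Qed.

Lemma om_ge0 u : 0 <= om u. Proof. exact/ltW/om_gt0. Qed.

Lemma om_le1 u : om u <= 1. Proof. by rewrite invf_le1// lerDl sqr_ge0. Qed.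

Lemma om_le c u w : 0 < c -> 1 + w ^+ 2 <= c * (1 + u ^+ 2) -> om u <= c * om w.
Proof.
by move=> c0 h; rewrite /om -div1r ler_pdivrMr// mulrAC ler_pdivlMr// mul1r.
Qed.

Lemma om_near u w : `|u - w| <= 1 -> om u <= 3 * om w.
Proof.
rewrite ler_norml => /andP[h1 h2]; apply: om_le => //.
have := sqr_ge0 (2 * u - w).
have : 0 <= (1 - (u - w)) * (1 + (u - w)) by apply: mulr_ge0; lra.
by have := sqr_ge0 u; nra.
Qed.

Lemma om_shift x w : `|w| <= 2 -> om (x - w) <= 9 * om x.
Proof.
rewrite ler_norml => /andP[h1 h2]; apply: om_le => //.
have := sqr_ge0 (x - 2 * w).
have : 0 <= (2 - w) * (2 + w) by apply: mulr_ge0; lra.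
by have := sqr_ge0 (x - w); nra.
Qed.

Lemma om_mono u w : `|w| <= `|u| -> om u <= om w.
Proof.
move=> h; rewrite -[om w]mul1r; apply: om_le => //; rewrite mul1r lerD2l.
by rewrite -(real_normK (num_real w)) -(real_normK (num_real u)) lerXn2r ?nnegrE.
Qed.

Lemma om_div c u : 1 <= c -> om (u / c) <= c ^+ 2 * om u.
Proof.
move=> c1; have c0 : 0 < c by lra.
apply: om_le; first by rewrite exprn_gt0.
rewrite mulrDr mulr1 expr_div_n mulrCA divff ?mulr1 ?expf_neq0 ?gt_eqF//.
by rewrite lerD2r exprn_ege1.
Qed.

Lemma om_atan u h : 0 <= h <= 1 -> h * om u <= 3 * (atan (u + h) - atan u).
Proof.
move=> /andP[]; rewrite le_eqVlt => /predU1P[<- _|h0 h1].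
  by rewrite addr0 subrr mul0r mulr0.
have [||c] := @MVT R atan (fun x => (1 + x ^+ 2)^-1) u (u + h).
- by rewrite ltrDl.
- by apply: continuous_in_subspaceT => x _; exact: continuous_atan.
rewrite in_itv/= => /andP[uc cu] ->.
rewrite addrAC subrr add0r mulrA mulrC ler_pM2r//.
by apply: om_near; rewrite ler_norml; lra.
Qed.

(** By [om_atan] the Riemann sum is dominated by a telescoping sum of increments of [atan], whose
    total variation is [pi]. The bound is therefore uniform in [y], [h] and [M]. *)
Lemma om_sum y h (M : nat) : 0 <= h <= 1 ->
  \sum_(m < M) h * om (y - m%:R * h) <= 3 * pi.
Proof.
move=> hh.
apply: (@le_trans _ _ (\sum_(m < M) 3 * (atan (y - m%:R * h + h) - atan (y - m%:R * h)))).
  by apply: ler_sum => m _; exact: om_atan.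
rewrite -mulr_sumr ler_pM2l//.
rewrite (_ : \sum_(_ < _) _ = atan (y + h) - atan (y + h - M%:R * h)).
  by have := atan_gtNpi2 (y + h - M%:R * h); have := atan_ltpi2 (y + h); lra.
elim: M => [|M ih]; first by rewrite big_ord0 mul0r subr0 subrr.
rewrite big_ord_recr/= ih -[M.+1]addn1 natrD.
have -> : y - M%:R * h + h = y + h - M%:R * h by ring.
have -> : y + h - (M%:R + 1) * h = y - M%:R * h by ring.
ring.
Qed.

Local Notation mu := (@lebesgue_measure R).

Lemma continuous_om : continuous om.
Proof. exact: continuous_oneDsqrV. Qed.

Lemma integral_om : (\int[mu]_x (om x)%:E = pi%:E)%E.
Proof.
rewrite ge0_symfun_integralT//.
- rewrite -set_itvcy [X in (_ * X)%E](integral0y_oneDsqr R) -EFinM; congr EFin.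
  by rewrite mulrC -mulrA mulVf ?mulr1.
- by move=> x; exact: om_ge0.
- exact: continuous_om.
- by move=> x; rewrite /= /om sqrrN.
Qed.

Lemma integral_om_scale (l w : R) : 0 < l ->
  mu.-integrable setT (fun x => (om (l * (x - w)))%:E) /\
  Rintegral mu setT (fun x => om (l * (x - w))) = pi / l.
Proof.
move=> l0.
have dF x : is_derive x 1 (fun x : R => l * (x - w)) l.
  by apply: is_derive_eq; rewrite ?oppr0 ?addr0 ?scaler0 ?addr0; exact: mulr1.
have F' : derive1 (fun x : R => l * (x - w)) = fun=> l.
  by apply/funext => x; rewrite derive1E; exact: derive_val.
have cF : continuous (fun x : R => l * (x - w)).
  by move=> x; apply: differentiable_continuous; apply/derivable1_diffP; exact: ex_derive.
have mG : measurable_fun setT (fun x => (om (l * (x - w)))%:E).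
  apply/measurable_EFinP; apply: (@continuous_measurable_fun R) => x.
  by apply: (@continuous_comp _ _ _ (fun x : R => l * (x - w)) om); [exact: cF|exact: continuous_om].
have Fy : (fun x : R => l * (x - w)) @ +oo --> +oo.
  apply/cvgryPge => A; exists (A / l + w); split; first exact: num_real.
  by move=> x h; rewrite mulrC -ler_pdivrMr//; lra.
have FNy : (fun x : R => l * (x - w)) @ -oo --> -oo.
  apply/cvgrNyPle => A; exists (A / l + w); split; first exact: num_real.
  by move=> x h; rewrite mulrC -ler_pdivlMr//; lra.
have E : (\int[mu]_x (om (l * (x - w)))%:E = (pi / l)%:E)%E.
  have : {homo (fun x : R => l * (x - w)) : x y / x < y}.
    by move=> x y xy; rewrite ltr_pM2l// ltrD2r.
  move=> /(@increasing_ge0_integration_by_substitutionT R (fun x => l * (x - w)) om).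
  rewrite F' integral_om => hs.
  have c4 x : derivable (fun x : R => l * (x - w)) x 1 by exact: ex_derive.
  have c1 : continuous (fun _ : R => l) by move=> x; exact: cvg_cst.
  have c2 : cvg ((fun _ : R => l) @ -oo) by exact: is_cvg_cst.
  have c3 : cvg ((fun _ : R => l) @ +oo) by exact: is_cvg_cst.
  have /esym := hs c1 c2 c3 c4 FNy Fy continuous_om om_ge0.
  rewrite (_ : (fun x => _%:E) = fun x => ((om (l * (x - w)))%:E * l%:E)%E)//.
  rewrite ge0_integralZr//; last 2 first.
    by move=> x _; rewrite lee_fin om_ge0.
    by rewrite lee_fin ltW.
  move=> h; rewrite EFinM -h -muleA -EFinM mulfV ?gt_eqF// mule1//.
split; last by rewrite /Rintegral E.
apply/integrableP; split => //.
under eq_integral do rewrite gee0_abs ?lee_fin ?om_ge0//.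
by rewrite E ltry.
Qed.

End om.

(** * Schwartz functions and regular distributions *)

Section schwartz_functions.
Context {R : realType} {d : nat}.
Local Notation Rd := 'rV[R]_d.
Local Notation T := (d.-tuple (measurableTypeR R)).
Local Notation mu := (lebesgue_tuple R d).

Lemma coord_norm_le (x : Rd) i : `|x 0 i| <= `|x|.
Proof.
by rewrite [leRHS]/Num.norm/= mx_normrE; exact: (le_bigmax _ _ (0 : 'I_1, i)).
Qed.

Lemma norm_le_coord (x : Rd) (A : R) : 0 <= A ->
  (forall i, `|x 0 i| <= A) -> `|x| <= A.
Proof.
move=> A0 h; rewrite [leLHS]/Num.norm/= mx_normrE.
by apply/bigmax_leP; split=> // -[i j] _ /=; rewrite ord1.
Qed.

Lemma Cintegral_setT (f : Rd -> R[i]) :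
  Cintegral setT f = cint mu (f \o vec_of).
Proof. by rewrite /Cintegral preimage_setT. Qed.

Definition om_prod (x : Rd) : R := \prod_i om (x 0 i).

Lemma om_prod_ge0 x : 0 <= om_prod x.
Proof. by apply: prodr_ge0 => i _; exact: om_ge0. Qed.

Lemma om_prod_gt0 x : 0 < om_prod x.
Proof. by apply: prodr_gt0 => i _; exact: om_gt0. Qed.

Lemma om_prod_le1 x : om_prod x <= 1.
Proof.
by apply: prodr_ile1 => i _; rewrite om_ge0 om_le1.
Qed.

Lemma integrable_om : (@lebesgue_measure R).-integrable setT (EFin \o @om R).
Proof.
have [h _] := @integral_om_scale R 1 0 ltr01.
by apply: eq_integrable h => // x _ /=; rewrite subr0 mul1r.
Qed.

Lemma Rintegral_om : Rintegral (@lebesgue_measure R) setT (@om R) = pi.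
Proof. by rewrite /Rintegral integral_om. Qed.

Lemma om_prod_integral :
  mu.-integrable setT (fun t => (om_prod (vec_of t))%:E) /\
  Rintegral mu setT (fun t => om_prod (vec_of t)) = pi ^+ d.
Proof.
have [h1 h2] := @tensor_Rintegral _ _ R (@lebesgue_measure R) d (fun=> @om R)
  (fun=> integrable_om).
have E (t : T) : \prod_i om (tnth t i) = om_prod (vec_of t).
  by apply: eq_bigr => i _; rewrite vec_ofE.
split; first by apply: eq_integrable h1 => // t _; rewrite E.
under eq_Rintegral do rewrite -E.
by rewrite h2 Rintegral_om prodr_const card_ord.
Qed.

(** Each factor [1 + x_i ^ 2] is at most [(1 + |x|) ^ 2], hence the exponent [2 * d]. *)
Lemma om_prod_decay (x : Rd) : 1 <= (1 + `|x|) ^+ (2 * d) * om_prod x.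
Proof.
rewrite exprM -[X in _ ^+ X]card_ord -prodr_const -big_split/=.
elim/big_ind : _ => // [a c a1 c1|i _].
  by rewrite -[leLHS]mulr1 ler_pM.
rewrite /om -ler_pdivrMr ?invr_gt0 ?ltr_wpDr ?sqr_ge0// invrK mul1r.
have := coord_norm_le x i; rewrite -(real_normK (num_real (x 0 i))) => h.
by have := normr_ge0 (x 0 i); nra.
Qed.

Lemma CpartialsE0 (f : Rd -> R[i]) x : Cpartials [::] f x = f x.
Proof. by rewrite /Cpartials /=; case: (f x). Qed.

Lemma schwartz_seminorm_le m (f : Rd -> R[i]) x :
  (((1 + `|x|) ^+ m * normc (f x))%:E <= schwartz_seminorm m f)%E.
Proof.
apply: ereal_sup_ubound; exists [::], x; split=> //.
by rewrite CpartialsE0.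
Qed.

Lemma schwartz_seminorm_fin m (f : Rd -> R[i]) : schwartz f ->
  exists2 s : R, schwartz_seminorm m f = s%:E & 0 <= s.
Proof.
move=> [_ /(_ m)]; have := schwartz_seminorm_le m f 0.
case: (schwartz_seminorm m f) => [s| |//]; last by [].
rewrite lee_fin => h _; exists s => //; apply: le_trans h.
by rewrite mulr_ge0 ?normc_ge0// exprn_ge0// addr_ge0.
Qed.

Lemma schwartz_bound (f : Rd -> R[i]) : schwartz f ->
  exists2 C : R, 0 <= C & forall x, normc (f x) <= C * om_prod x.
Proof.
move=> sf; have [s Es s0] := schwartz_seminorm_fin (2 * d)%N sf.
exists s => // x; have := schwartz_seminorm_le (2 * d)%N f x.
rewrite Es lee_fin => h.
apply: le_trans (ler_wpM2r (om_prod_ge0 x) h).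
rewrite mulrAC -[leLHS]mul1r ler_wpM2r ?normc_ge0//.
exact: om_prod_decay.
Qed.

Lemma Ccontinuous_cmeas (f : Rd -> R[i]) : Ccontinuous f ->
  cmeas (fun t : T => f (vec_of t)).
Proof.
move=> [c1 c2]; split.
  exact: (measurable_continuous_vec c1).
exact: (measurable_continuous_vec c2).
Qed.

Lemma schwartz_continuous (f : Rd -> R[i]) : schwartz f -> Ccontinuous f.
Proof. by move=> [[/(_ [::])[c1 _] /(_ [::])[c2 _]] _]. Qed.

Lemma schwartz_cintble (f : Rd -> R[i]) : schwartz f ->
  cintble mu (fun t => f (vec_of t)).
Proof.
move=> sf; have [C C0 h] := schwartz_bound sf.
apply: (@cintble_le _ _ _ _ _ (fun t => C * om_prod (vec_of t))) => //.
  exact/Ccontinuous_cmeas/schwartz_continuous.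
exact: (integrableZl measurableT _ om_prod_integral.1).
Qed.

Definition function_distribution (g : Rd -> R[i]) : functional :=
  fun psi => Cintegral setT (fun x => g x * psi x).

(** An integrable function acts continuously for the supremum norm, so the seminorm of order 0
    controls it. *)
Lemma tempered_function_distribution (g : Rd -> R[i]) :
  cintble mu (g \o vec_of) -> tempered (function_distribution g).
Proof.
move=> ig.
have [A iA gA] := cintble_norm ig.
have sp psi (s : R) : schwartz psi -> (forall x, normc (psi x) <= s) ->
    cintble mu (fun t => g (vec_of t) * psi (vec_of t)) /\
    normc (cint mu (fun t => g (vec_of t) * psi (vec_of t))) <=
      2 * (Rintegral mu setT A * s).
  move=> spsi ps.
  have iAs : mu.-integrable setT (EFin \o (fun t => A t * s)).
    exact: (integrableZr measurableT _ iA).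
  have b t : normc (g (vec_of t) * psi (vec_of t)) <= A t * s.
    by rewrite normcM ler_pM ?normc_ge0//; exact: gA.
  have ic : cintble mu (fun t => g (vec_of t) * psi (vec_of t)).
    apply: cintble_le iAs b; apply: (cmeasM (cintble_meas ig)).
    exact/Ccontinuous_cmeas/schwartz_continuous.
  by split => //; rewrite -RintegralZr//; exact: normc_cint_le.
have sb (psi : Rd -> R[i]) : schwartz psi -> exists2 s : R,
    schwartz_seminorm 0 psi = s%:E & forall x, normc (psi x) <= s.
  move=> spsi; have [s Es s0] := schwartz_seminorm_fin 0%N spsi; exists s => // x.
  by have := schwartz_seminorm_le 0%N psi x; rewrite Es expr0 mul1r lee_fin.
split=> [a f h sf sh|].
  rewrite /function_distribution !Cintegral_setT.
  have [s1 _ b1] := sb _ sf; have [s2 _ b2] := sb _ sh.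
  have [i1 _] := sp _ _ sf b1; have [i2 _] := sp _ _ sh b2.
  rewrite -cintZ// -cintD//; last exact: cintbleZ.
  by apply: cint_eq => t /=; rewrite mulrDr mulrCA.
exists (2 * Rintegral mu setT A), 0%N => f sf.
have [s Es b] := sb _ sf; have [_ h] := sp _ _ sf b.
by rewrite /function_distribution Cintegral_setT Es -EFinM lee_fin -mulrA.
Qed.

End schwartz_functions.

(** * Differentiability on the line and of tensor products *)

Section smooth_functions_of_one_variable.
Context {R : realType}.
Implicit Types f g : R -> R.

Fixpoint Cn (n : nat) f : Prop :=
  if n is n'.+1 then (forall x, derivable f x 1) /\ Cn n' (derive1 f)
  else continuous f.

Lemma derivable_continuous f : (forall x, derivable f x 1) -> continuous f.
Proof. by move=> df x; apply/differentiable_continuous/derivable1_diffP. Qed.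

Lemma CnW n f : Cn n.+1 f -> Cn n f.
Proof.
elim: n f => [|n ih] f [df cf]; first exact: derivable_continuous.
by split => //; exact: ih.
Qed.

Lemma Cn_continuous n f : Cn n f -> continuous f.
Proof. by elim: n => [//|n ih] /CnW. Qed.

Lemma CnD n f g : Cn n f -> Cn n g -> Cn n (f \+ g).
Proof.
elim: n f g => [|n ih] f g.
  by move=> cf cg x; apply: cvgD; [exact: cf|exact: cg].
move=> [df cf] [dg cg]; split; first by move=> x; exact: derivableD.
rewrite (_ : derive1 _ = derive1 f \+ derive1 g); first exact: ih.
by apply/funext => x; rewrite /= !derive1E deriveD.
Qed.

Lemma CnM n f g : Cn n f -> Cn n g -> Cn n (f \* g).
Proof.
elim: n f g => [|n ih] f g.
  by move=> cf cg x; apply: cvgM; [exact: cf|exact: cg].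
move=> cf0 cg0; have [[df cf] [dg cg]] := (cf0, cg0).
split; first by move=> x; exact: derivableM.
rewrite (_ : derive1 _ = (f \* derive1 g) \+ (g \* derive1 f)).
  by apply: CnD; apply: ih => //; exact: CnW.
by apply/funext => x; rewrite /= !derive1E deriveM.
Qed.

Lemma Cn_cst n (c : R) : Cn n (fun=> c).
Proof.
elim: n c => [|n ih] c; first exact: cst_continuous.
split; first by move=> x; exact: derivable_cst.
rewrite (_ : derive1 _ = fun=> 0); first exact: ih.
by apply/funext => x; exact: derive1_cst.
Qed.

Lemma is_derive_affine f (c w x : R) : derivable f (c * (x - w)) 1 ->
  is_derive x 1 (fun x => f (c * (x - w))) (c * derive1 f (c * (x - w))).
Proof.
move=> df.
have dg : is_derive x 1 (fun x : R => c * (x - w)) c.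
  by apply: is_derive_eq; rewrite ?oppr0 ?addr0 ?scaler0 ?addr0; exact: mulr1.
have /derivableP df' := df.
have := @is_derive1_comp R f (fun x : R => c * (x - w)) x _ _ df' dg.
by rewrite -derive1E mulrC.
Qed.

Lemma Cn_affine n f c w : Cn n f -> Cn n (fun x => f (c * (x - w))).
Proof.
elim: n f => [|n ih] f.
  move=> cf x; apply: (@continuous_comp _ _ _ (fun x : R => c * (x - w)) f).
    by apply: cvgM; [exact: cvg_cst|apply: cvgB; [exact: cvg_id|exact: cvg_cst]].
  exact: cf.
move=> [df cf]; split.
  by move=> x; have := is_derive_affine (df (c * (x - w))) => ?; exact: ex_derive.
rewrite (_ : derive1 _ = (fun=> c) \* (fun x => derive1 f (c * (x - w)))).
  by apply: CnM; [exact: Cn_cst|exact: ih].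
apply/funext => x; rewrite derive1E.
by have := is_derive_affine (df (c * (x - w))) => ?; exact: derive_val.
Qed.

Lemma Cn_is_derive f : (forall n, Cn n f) ->
  forall n (x : R), is_derive x 1 (derive1n n f) (derive1n n.+1 f x).
Proof.
move=> cf n x.
have : forall n m f, Cn (n + m) f -> Cn m (derive1n n f).
  elim=> [//|k ih] m g [_ cg]; rewrite derive1Sn; exact: ih.
move=> /(_ n 1%N f (cf _)) [/(_ x) df _]; rewrite derive1nS derive1E.
exact/derivableP.
Qed.

Lemma derive_rV1 (a : R -> R) (x : 'rV[R]_1) :
  (derivable (fun x : 'rV[R]_1 => a (x 0 0)) x (delta_mx 0 0) <->
   derivable a (x 0 0) 1) /\
  'D_(delta_mx 0 0) (fun x : 'rV[R]_1 => a (x 0 0)) x = derive1 a (x 0 0).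
Proof.
have E : (fun h : R => h^-1 *: (((fun x : 'rV[R]_1 => a (x 0 0)) \o shift x) (h *: delta_mx 0 0) - a (x 0 0)))
  = (fun h : R => h^-1 *: ((a \o shift (x 0 0)) (h *: (1 : R)) - a (x 0 0))).
  apply/funext => h /=; congr (_ *: (a _ - _)).
  by rewrite !mxE !eqxx.
by split; rewrite /derivable ?derive1E /derive E.
Qed.

Lemma smooth_rV1_Cn (a : R -> R) : smooth (fun x : 'rV[R]_1 => a (x 0 0)) ->
  forall n, Cn n a.
Proof.
move=> sa n; elim: n a sa => [|n ih] a sa.
  have [ca _] := sa [::] => u.
  have E : (fun x : 'rV[R]_1 => a (x 0 0)) \o (fun u : R => (const_mx u : 'rV[R]_1)) = a.
    by apply/funext => y /=; rewrite mxE.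
  rewrite -E; apply: continuous_comp; last exact: ca.
  apply/cvg_ballP => e e0; have := nbhsx_ballx u e e0.
  by apply: filterS => y uy; split => // i j; rewrite !mxE.
split.
  move=> u; have [_ /(_ 0 (const_mx u))] := sa [::].
  by move=> /(derive_rV1 _ _).1; rewrite mxE.
apply: ih => s.
(* [foldr] applies the last index first, so differentiating [a] beforehand appends an index to
   [s]. *)
have E : partials s (fun x : 'rV[R]_1 => derive1 a (x 0 0)) =
    partials (rcons s 0) (fun x : 'rV[R]_1 => a (x 0 0)).
  rewrite /partials foldr_rcons; congr foldr; apply/funext => x.
  by rewrite (derive_rV1 a x).2.
by rewrite E; exact: sa.
Qed.

End smooth_functions_of_one_variable.

Section tensor_test_functions.
Context {R : realType} {d : nat}.
Local Notation Rd := 'rV[R]_d.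
Variable F : 'I_d -> nat -> R -> R.
Hypothesis dF : forall i n (u : R), is_derive u 1 (F i n) (F i n.+1 u).

Let tensor (k : 'I_d -> nat) (x : Rd) := \prod_i F i (k i) (x 0 i).

Lemma is_derive_tensor k (j : 'I_d) x :
  is_derive x (delta_mx 0 j) (tensor k) (tensor (fun i => (k i + (i == j))%N) x).
Proof.
have E y : tensor k y = (\prod_(i | i != j) F i (k i) (y 0 i)) * F j (k j) (y 0 j).
  by rewrite /tensor (bigD1 j)//= mulrC.
pose c := \prod_(i | i != j) F i (k i) (x 0 i).
have E' : (fun h : R => h^-1 *: ((tensor k \o shift x) (h *: delta_mx 0 j) - tensor k x))
  = (fun h : R => c *: (h^-1 *: ((F j (k j) \o shift (x 0 j)) (h *: (1 : R)) - F j (k j) (x 0 j)))).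
  apply/funext => h /=; rewrite !E.
  rewrite (_ : \prod_(i | _) _ = c); last first.
    apply: eq_bigr => i ij; rewrite !mxE eqxx/= (negbTE ij) mulr0n.
    by rewrite mulr0 add0r.
  rewrite -/c !mxE !eqxx/= mulr1 -mulrBr scalerA [RHS]scalerA mulrC.
  by congr (_ *: (F _ _ (_ + _) - _)); rewrite /GRing.scale/= mulr1.
have [df Df] := dF j (k j) (x 0 j).
have cv : (fun h : R => h^-1 *: ((tensor k \o shift x) (h *: delta_mx 0 j) - tensor k x)) @ 0^'
    --> c *: F j (k j).+1 (x 0 j).
  rewrite E'; apply: cvgZr; rewrite -Df; exact: df.
have -> : tensor (fun i => (k i + (i == j))%N) x = c *: F j (k j).+1 (x 0 j).
  rewrite /tensor (bigD1 j)//= eqxx addn1 mulrC; congr (_ * _).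
  by apply: eq_bigr => i /negbTE ->; rewrite addn0.
split; last exact: cvg_lim cv.
by apply/cvg_ex; exists (c *: F j (k j).+1 (x 0 j)).
Qed.

Lemma partials_tensor s k :
  partials s (tensor k) = tensor (fun i => (k i + count_mem i s)%N).
Proof.
elim: s => [|j s ih].
  by apply/funext => x; apply: eq_bigr => i _; rewrite addn0.
rewrite /partials/= -/(partials s (tensor k)) ih; apply/funext => x.
have h := is_derive_tensor (fun i => (k i + count_mem i s)%N) j x.
rewrite derive_val; apply: eq_bigr => i _; congr (F _ _ _).
by rewrite eq_sym -addnA; congr addn; rewrite addnC.
Qed.

Lemma continuous_tensor k : continuous (tensor k).
Proof.
rewrite /tensor => x; elim: (index_enum _) => [|i s ih].
  under eq_fun do rewrite big_nil; exact: cst_continuous.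
have -> : (fun y : Rd => \prod_(j <- i :: s) F j (k j) (y 0 j)) =
    (fun y => F i (k i) (y 0 i) * \prod_(j <- s) F j (k j) (y 0 j)).
  by apply/funext => y; rewrite big_cons.
have c1 : continuous_at x (fun y : Rd => F i (k i) (y 0 i)).
  apply: (@continuous_comp _ _ _ (fun x : Rd => x 0 i) (F i (k i))).
    exact: coord_continuous.
  apply/differentiable_continuous/derivable1_diffP.
  by have := dF i (k i) (x 0 i) => ?; exact: ex_derive.
exact: (cvgM c1 ih).
Qed.

Lemma smooth_tensor k : smooth (tensor k).
Proof.
move=> s; rewrite partials_tensor; split; first exact: continuous_tensor.
by move=> j x; have := is_derive_tensor (fun i => (k i + count_mem i s)%N) j x => ?; exact: ex_derive.
Qed.

End tensor_test_functions.

Section compact_support.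
Context {R : realType}.
Implicit Types (f : R -> R) (A : R).

Lemma derive1_supp f A : (forall u, A < `|u| -> f u = 0) ->
  forall u, A < `|u| -> derive1 f u = 0.
Proof.
move=> fA u Au; rewrite derive1E.
have : \forall y \near u, A < `|y|.
  have : continuous (fun y : R => `|y|) by move=> y; exact: norm_continuous.
  by move/(_ u)/cvgr_gt; apply.
move=> nA; rewrite (@near_eq_derive _ _ _ f (fun=> 0))//.
  exact: derive_cst.
by apply: filterS nA => y /fA.
Qed.

Lemma supp_bounded f A : continuous f -> (forall u, A < `|u| -> f u = 0) ->
  exists2 B, 0 <= B & forall u, `|f u| <= B.
Proof.
move=> cf fA; have [A0|A0] := ltP A 0.
  by exists 0 => // u; rewrite fA ?normr0// (lt_le_trans A0).
have AA : - A <= A by lra.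
have cnf : {within `[- A, A], continuous (fun u => `|f u|)}.
  apply: continuous_in_subspaceT => u _.
  by apply: (@continuous_comp _ _ _ f (fun y : R => `|y|)); [exact: cf|exact: norm_continuous].
have [c _ hc] := EVT_max AA cnf.
exists `|f c| => // u; have [uA|/fA ->] := leP `|u| A; last by rewrite normr0.
by apply: hc; rewrite in_itv/= -ler_norml.
Qed.

(** On the support [om u >= 1 / (1 + A ^ 2)], so a multiple of [om] dominates [f]. *)
Lemma supp_integrable f A B : measurable_fun setT f ->
  (forall u, A < `|u| -> f u = 0) -> (forall u, `|f u| <= B) ->
  (@lebesgue_measure R).-integrable setT (EFin \o f).
Proof.
move=> mf fA fB; have B0 : 0 <= B by rewrite (le_trans _ (fB 0)).
have h := integrableZl measurableT (B * (1 + A ^+ 2)) (@integrable_om R).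
apply: le_integrable h => //; first exact/measurable_EFinP.
move=> u _ /=; rewrite lee_fin normrM [X in _ * X]ger0_norm ?om_ge0//.
rewrite ger0_norm ?mulr_ge0 ?addr_ge0 ?sqr_ge0//.
have [uA|/fA ->] := leP `|u| A; last first.
  by rewrite normr0 !mulr_ge0 ?om_ge0 ?addr_ge0 ?sqr_ge0.
apply: le_trans (fB u) _; rewrite -[leLHS]mulr1 -mulrA ler_wpM2l//.
rewrite /om ler_pdivlMr ?mul1r ?ltr_wpDr ?sqr_ge0// lerD2l.
by rewrite -(real_normK (num_real u)) lerXn2r ?nnegrE// (le_trans _ uA).
Qed.

End compact_support.

(** * Bump functions *)

Section bumps.
Context {R : realType} {d : nat}.
Local Notation Rd := 'rV[R]_d.
Local Notation mu := (lebesgue_tuple R d).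
Variable th : R -> R.
Hypothesis Cth : forall n, Cn n th.
Hypothesis th_ge0 : forall u, 0 <= th u.
Hypothesis th_supp : forall u, 3 / 2 < `|u| -> th u = 0.
Hypothesis th1 : forall u, `|u| <= 1 -> th u = 1.
Variables (x0 : Rd) (c : R).
Hypothesis c0 : 0 < c.

(** Test functions that concentrate at [x0] as [c] grows. The profile [th] will be [|phi0| ^ 2], so
    the resolution of unity supplies its own bumps. *)
Definition bump (x : Rd) : R := \prod_i th (c * (x 0 i - x0 0 i)).

Let F (i : 'I_d) n := derive1n n (fun u => th (c * (u - x0 0 i))).

Let dF i n (u : R) : is_derive u 1 (F i n) (F i n.+1 u).
Proof. by apply: Cn_is_derive => k; exact: Cn_affine. Qed.

(** Radius of an interval about 0 that contains the support of every factor, whatever the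
    coordinate. *)
Let A := 3 / 2 / c + `|x0|.

Let F_supp i n u : A < `|u| -> F i n u = 0.
Proof.
elim: n u => [|n ih] u.
  move=> Au; apply: th_supp; rewrite normrM gtr0_norm//.
  have : 3 / 2 / c < `|u - x0 0 i|.
    have := ler_normD (u - x0 0 i) (x0 0 i); rewrite subrK.
    by have := coord_norm_le x0 i; rewrite /A in Au; lra.
  by rewrite ltr_pdivrMr// [c * _]mulrC.
by move=> Au; rewrite /F derive1nS; exact: (derive1_supp ih Au).
Qed.

Let F_bound m : exists2 B, 1 <= B & forall i n u, (n <= m)%N -> `|F i n u| <= B.
Proof.
have /choice[B hB] : forall q : 'I_d * 'I_m.+1, exists B, 0 <= B /\ forall u, `|F q.1 q.2 u| <= B.
  move=> [i n] /=.
  have cF : continuous (F i n).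
    move=> u; apply/differentiable_continuous/derivable1_diffP.
    by have := dF i n u => ?; exact: ex_derive.
  by have [B B0 hB] := supp_bounded cF (@F_supp i n); exists B.
exists (1 + \sum_q B q); first by rewrite lerDl sumr_ge0// => q _; case: (hB q).
move=> i n u nm; rewrite -ltnS in nm.
have [_ /(_ u) h] := hB (i, Ordinal nm).
apply: le_trans h _; rewrite (bigD1 (i, Ordinal nm))//= addrCA lerDl.
by rewrite addr_ge0// sumr_ge0// => q _; case: (hB q).
Qed.

Lemma smooth0 : smooth (fun _ : Rd => 0 : R).
Proof.
move=> s; have -> : partials s (fun _ : Rd => 0 : R) = fun=> 0.
  elim: s => [//|i s ih]; rewrite /partials/= -/(partials s _) ih.
  by apply/funext => x; exact: derive_cst.
by split; [exact: cst_continuous|move=> i x; exact: derivable_cst].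
Qed.

Lemma partials0 s : partials s (fun _ : Rd => 0 : R) = fun=> 0.
Proof.
elim: s => [//|i s ih]; rewrite /partials/= -/(partials s _) ih.
by apply/funext => x; exact: derive_cst.
Qed.

Lemma schwartz_bump : schwartz (fun x => (bump x)%:C).
Proof.
split.
  split; last exact: smooth0.
  exact: (smooth_tensor dF (fun=> 0%N)).
move=> m; have [B B1 hB] := F_bound m.
apply: (@le_lt_trans _ _ ((1 + A) ^+ m * B ^+ d)%:E); last exact: ltry.
apply: ge_ereal_sup => _ [s [x [sm ->]]]; rewrite lee_fin.
have -> : Cpartials s (fun x => (bump x)%:C) x =
    (\prod_i F i (count_mem i s) (x 0 i))%:C.
  rewrite /Cpartials (_ : Im \o _ = fun=> 0)// partials0.
  have P := partials_tensor dF s (fun=> 0%N).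
  by congr (_ +i* _); exact: (congr1 (fun f : Rd -> R => f x) P).
rewrite normc_real.
have A0 : 0 <= A by rewrite /A addr_ge0// divr_ge0// ltW.
have A1 : 0 <= 1 + A by rewrite addr_ge0.
have [/existsP[i hi]|] := boolP [exists i, A < `|x 0 i|].
  rewrite (bigD1 i)//= F_supp// mul0r normr0 mulr0.
  by rewrite mulr_ge0// exprn_ge0// (le_trans ler01).
rewrite negb_exists => /forallP hA.
apply: ler_pM; rewrite ?exprn_ge0 ?addr_ge0//.
  have xA : 1 + `|x| <= 1 + A.
    by rewrite lerD2l; apply: norm_le_coord => // i; rewrite leNgt hA.
  by apply: lerXn2r => //; rewrite nnegrE ?addr_ge0.
rewrite normr_prod -[X in B ^+ X]card_ord -prodr_const.
apply: ler_prod => i _; rewrite normr_ge0/= hB//.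
by rewrite (leq_trans _ sm)// count_size.
Qed.

Lemma bump_ge0 x : 0 <= bump x.
Proof. by apply: prodr_ge0. Qed.

Lemma bump_near (x : Rd) (rho : R) i : 2 <= c * rho -> rho <= `|x0 0 i - x 0 i| ->
  bump x = 0.
Proof.
move=> crho h; rewrite /bump (bigD1 i)//= th_supp ?mul0r//.
rewrite normrM gtr0_norm// distrC.
have : c * rho <= c * `|x0 0 i - x 0 i| by rewrite ler_pM2l.
lra.
Qed.

Lemma Rintegral_bump_gt0 :
  mu.-integrable setT (fun t => (bump (vec_of t))%:E) /\
  0 < Rintegral mu setT (fun t => bump (vec_of t)).
Proof.
have i1 i : (@lebesgue_measure R).-integrable setT (EFin \o (fun u => th (c * (u - x0 0 i)))).
  have [B B0 hB] := F_bound 0.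
  apply: (@supp_integrable _ _ A B).
  - apply: (@continuous_measurable_fun R).
    exact: (Cn_continuous (Cn_affine c (x0 0 i) (Cth 0))).
  - exact: (@F_supp i 0%N).
  - by move=> u; exact: (hB i 0%N u).
have [h1 h2] := tensor_Rintegral (m1 := @lebesgue_measure R) i1.
have E (t : d.-tuple (measurableTypeR R)) :
    \prod_i th (c * (tnth t i - x0 0 i)) = bump (vec_of t).
  by apply: eq_bigr => i _; rewrite vec_ofE.
split; first by apply: eq_integrable h1 => // t _; rewrite E.
under eq_Rintegral do rewrite -E.
rewrite h2; apply: prodr_gt0 => i _.
set w := x0 0 i.
pose J : set (measurableTypeR R) := `[w - c^-1, w + c^-1]%classic.
have mJ : measurable J by exact: measurable_itv.
have EJ : (@lebesgue_measure R J = (2 / c)%:E).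
  rewrite /J lebesgue_measure_itv/= lte_fin ifT.
    by rewrite -EFinB; congr EFin; lra.
  by rewrite ltrD2l gtrN ?invr_gt0.
have iJ : (@lebesgue_measure R).-integrable setT (EFin \o (\1_J : R -> R)).
  exact: integrable_indic_itv.
apply: (@lt_le_trans _ _ (Rintegral (@lebesgue_measure R) setT (\1_J : R -> R))).
  by rewrite /Rintegral integral_indic// setIT [X in fine X]EJ/= divr_gt0.
apply: (le_Rintegral measurableT iJ (i1 i)).
move=> u _; rewrite indicE; case: (boolP (u \in J)) => [|_]; last exact: th_ge0.
rewrite inE /J/= in_itv/= => /andP[u1 u2].
rewrite th1// normrM gtr0_norm// mulrC -ler_pdivlMr// mul1r ler_norml -/w.
by rewrite lerBrDr lerBlDr [- _ + w]addrC [_^-1 + w]addrC u1 u2.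
Qed.

End bumps.

(** * Uniqueness of the continuous representative *)

Section uniqueness.
Context {R : realType} {d : nat}.
Local Notation Rd := 'rV[R]_d.
Local Notation mu := (lebesgue_tuple R d).
Variable th : R -> R.
Hypothesis Cth : forall n, Cn n th.
Hypothesis th_ge0 : forall u, 0 <= th u.
Hypothesis th_supp : forall u, 3 / 2 < `|u| -> th u = 0.
Hypothesis th1 : forall u, `|u| <= 1 -> th u = 1.

(** The fundamental lemma of the calculus of variations: where [q] is positive it stays above half
    its value on a ball, and a bump supported in that ball has positive integral against [q]. *)
Lemma continuous_bump_le0 (q : Rd -> R) : continuous q ->
  (forall (x0 : Rd) (c : R), 0 < c ->
    mu.-integrable setT (fun t => (q (vec_of t) * bump th x0 c (vec_of t))%:E) /\
    Rintegral mu setT (fun t => q (vec_of t) * bump th x0 c (vec_of t)) = 0) ->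
  forall x, q x <= 0.
Proof.
move=> cq h x0; rewrite leNgt; apply/negP => q0.
have /cvgr_gt/(_ (q x0 / 2)) := cq x0.
have qq : q x0 / 2 < q x0 by lra.
move=> /(_ qq)/nbhs_ballP[rho /= rho0 hrho].
(* With [c * rho = 2 > 3 / 2] the bump vanishes as soon as one coordinate is [rho] away from that of
   [x0]. *)
pose c := 2 / rho.
have c0 : 0 < c by rewrite divr_gt0.
have [ib ib0] := @Rintegral_bump_gt0 R d th Cth th_ge0 th_supp th1 x0 c c0.
have [iq iq0] := h x0 c c0.
have : q x0 / 2 * Rintegral mu setT (fun t => bump th x0 c (vec_of t)) <= 0.
  rewrite -iq0 -RintegralZl//; apply: le_Rintegral => //.
    exact: (integrableZl measurableT _ ib).
  move=> t _.
  have [/existsP[i hi]|] := boolP [exists i, rho <= `|x0 0 i - vec_of t 0 i|].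
    rewrite (@bump_near _ _ _ th_supp _ _ c0 _ rho i) ?mulr0//.
    by rewrite /c divfK ?gt_eqF.
  rewrite negb_exists => /forallP hA.
  rewrite ler_wpM2r ?(bump_ge0 th_ge0)// ltW//; apply: hrho; split=> // i j.
  by rewrite ord1; have := hA j; rewrite -ltNge.
by rewrite leNgt mulr_gt0// divr_gt0.
Qed.

Lemma continuous_bump_eq0 (q : Rd -> R) : continuous q ->
  (forall (x0 : Rd) (c : R), 0 < c ->
    mu.-integrable setT (fun t => (q (vec_of t) * bump th x0 c (vec_of t))%:E) /\
    Rintegral mu setT (fun t => q (vec_of t) * bump th x0 c (vec_of t)) = 0) ->
  forall x, q x = 0.
Proof.
move=> cq h x; apply/eqP; rewrite eq_le (continuous_bump_le0 cq h)/=.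
rewrite -oppr_le0; apply: (@continuous_bump_le0 (fun x => - q x)).
  by move=> y; exact: (cvgN (cq y)).
move=> x0 c c0; have [i1 i2] := h x0 c c0.
have E (t : d.-tuple (measurableTypeR R)) : - q (vec_of t) * bump th x0 c (vec_of t) =
    -1 * (q (vec_of t) * bump th x0 c (vec_of t)) by rewrite mulN1r mulNr.
split.
  under eq_fun do rewrite E; exact: (integrableZl measurableT _ i1).
by under eq_Rintegral do rewrite E; rewrite RintegralZl// i2 mulr0.
Qed.

Lemma represents_unique (g h : Rd -> R[i]) (S : functional) :
  Ccontinuous g -> Ccontinuous h -> represents g S -> represents h S -> g = h.
Proof.
move=> [cg1 cg2] [ch1 ch2] rg rh.
have key (x0 : Rd) (c : R) : 0 < c ->
    cintble mu (fun t => (g (vec_of t) - h (vec_of t)) * (bump th x0 c (vec_of t))%:C) /\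
    cint mu (fun t => (g (vec_of t) - h (vec_of t)) * (bump th x0 c (vec_of t))%:C) = 0.
  move=> c0; have sb := @schwartz_bump R d th Cth th_supp x0 c c0.
  have [ig Eg] := rg _ sb; have [ih Eh] := rh _ sb.
  have E (t : d.-tuple (measurableTypeR R)) : (g (vec_of t) - h (vec_of t)) * (bump th x0 c (vec_of t))%:C =
     g (vec_of t) * (bump th x0 c (vec_of t))%:C + -1 * (h (vec_of t) * (bump th x0 c (vec_of t))%:C).
    by rewrite mulrBl mulN1r.
  split.
    by under eq_fun do rewrite E; apply: cintbleD => //; exact: cintbleZ.
  under cint_eq do rewrite E.
  rewrite cintD//; last exact: cintbleZ.
  by rewrite cintZ// mulN1r; rewrite !Cintegral_setT in Eg Eh; rewrite -Eg -Eh subrr.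
apply/funext => x; apply: subr0_eq; apply: complex_eq.
- apply: (@continuous_bump_eq0 (fun x => Re (g x - h x))).
    have E y : Re (g y - h y) = Re (g y) - Re (h y).
      by case: (g y) (h y) => [? ?] [].
    under eq_fun do rewrite E.
    by move=> y; exact: (cvgB (cg1 y) (ch1 y)).
  move=> x0 c c0; have [[k1 _] k2] := key x0 c c0.
  have E (t : d.-tuple (measurableTypeR R)) : Re ((g (vec_of t) - h (vec_of t)) * (bump th x0 c (vec_of t))%:C) =
     Re (g (vec_of t) - h (vec_of t)) * bump th x0 c (vec_of t).
    by rewrite ReM /= mulr0 subr0.
  split; first by apply: eq_integrable k1 => // t _; rewrite E.
  by under eq_Rintegral do rewrite -E; have [] := k2.
- apply: (@continuous_bump_eq0 (fun x => Im (g x - h x))).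
    have E y : Im (g y - h y) = Im (g y) - Im (h y).
      by case: (g y) (h y) => [? ?] [].
    under eq_fun do rewrite E.
    by move=> y; exact: (cvgB (cg2 y) (ch2 y)).
  move=> x0 c c0; have [[_ k1] k2] := key x0 c c0.
  have E (t : d.-tuple (measurableTypeR R)) : Im ((g (vec_of t) - h (vec_of t)) * (bump th x0 c (vec_of t))%:C) =
     Im (g (vec_of t) - h (vec_of t)) * bump th x0 c (vec_of t).
    by rewrite ImM /= mulr0 add0r.
  split; first by apply: eq_integrable k1 => // t _; rewrite E.
  by under eq_Rintegral do rewrite -E; have [] := k2.
Qed.

(** [dist_fun] chooses some continuous representative; uniqueness turns any representative found
    explicitly into its value. *)
Lemma dist_fun_represents (g : Rd -> R[i]) (S : functional) :
  Ccontinuous g -> represents g S -> dist_fun S = g.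
Proof.
move=> cg rg; rewrite /dist_fun; case: xgetP => [h -> [ch rh]|/(_ g)].
  exact: represents_unique ch cg rh rg.
by move=> /(_ (conj cg rg)).
Qed.

End uniqueness.

(** * Decay of Fourier transforms on the line *)

Section oscillatory_integrals.
Context {R : realType}.
Local Notation mu := (@lebesgue_measure R).
Implicit Types (h : R -> R) (l t th : R).

(** The substitution [xi = l u] shows that it depends on [t] through [l t] only. The phase [th]
    turns the cosine into a sine at [- pi / 2], so that one family of real integrals is closed under
    integration by parts. *)
Definition osc th l h t : R :=
  Rintegral mu setT (fun xi => l^-1 * h (xi / l) * cos (t * xi + th)).

Definition supp2 h := forall u, 2 < `|u| -> h u = 0.

Lemma dilate_supp h l : 0 < l -> supp2 h ->
  forall xi, 2 * l < `|xi| -> h (xi / l) = 0.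
Proof.
move=> l0 hs xi hx; apply: hs.
by rewrite normrM normfV (gtr0_norm l0) ltr_pdivlMr.
Qed.

Lemma continuous_dilate h l : continuous h ->
  continuous (fun xi : R => h (xi / l)).
Proof.
move=> ch x; apply: (@continuous_comp _ _ _ (fun xi : R => xi / l) h); last exact: ch.
by apply: cvgM; [exact: cvg_id|exact: cst_continuous].
Qed.

Lemma continuous_cos_affine t th : continuous (fun xi : R => cos (t * xi + th)).
Proof.
move=> x; apply: (@continuous_comp _ _ _ (fun xi : R => t * xi + th) (@cos R)).
  apply: cvgD; last exact: cst_continuous.
  by apply: cvgM; [exact: cst_continuous|exact: cvg_id].
exact: continuous_cos.
Qed.

Lemma osc_integrable th l h t (g : R -> R) : 0 < l -> continuous h -> supp2 h ->
  continuous g ->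
  mu.-integrable setT (EFin \o (fun xi => l^-1 * h (xi / l) * g xi)).
Proof.
move=> l0 ch hs cg.
have c1 : continuous (fun xi : R => l^-1 * h (xi / l) * g xi).
  move=> x; apply: cvgM; last exact: cg.
  by apply: cvgM; [exact: cst_continuous|exact: continuous_dilate].
have sp xi : 2 * l < `|xi| -> l^-1 * h (xi / l) * g xi = 0.
  by move=> hx; rewrite dilate_supp// mulr0 mul0r.
have [B B0 hB] := supp_bounded c1 sp.
apply: supp_integrable sp hB; exact: (@continuous_measurable_fun R).
Qed.

(** The support of the dilate has length [4 * l], and [l^-1] normalises it. *)
Lemma osc_bound_gen l h (g : R -> R) B G : 0 < l -> continuous h -> supp2 h ->
  continuous g -> (forall u, `|h u| <= B) ->
  (forall xi, `|xi| <= 2 * l -> `|g xi| <= G) ->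
  `|Rintegral mu setT (fun xi => l^-1 * h (xi / l) * g xi)| <= 4 * (B * G).
Proof.
move=> l0 ch hs cg hB hG.
have ig := osc_integrable 0 0 l0 ch hs cg.
have B0 : 0 <= B := le_trans (normr_ge0 _) (hB 0).
have G0 : 0 <= G.
  by apply: le_trans (normr_ge0 _) (hG 0 _); rewrite normr0 mulr_ge0// ltW.
pose J : set (measurableTypeR R) := `[- (2 * l), 2 * l]%classic.
have iJ : mu.-integrable setT (EFin \o (\1_J : R -> R)) by exact: integrable_indic_itv.
have iJ' : mu.-integrable setT (EFin \o (fun x => l^-1 * (B * G) * \1_J x)).
  exact: (integrableZl measurableT _ iJ).
apply: le_trans (le_normr_Rintegral _ _) _ => //.
apply: (@le_trans _ _ (Rintegral mu setT (fun x => l^-1 * (B * G) * \1_J x))).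
  apply: le_Rintegral => //; first exact: (integrable_norm ig).
  move=> x _; have [hx|hx] := leP `|x| (2 * l); last first.
    by rewrite dilate_supp// mulr0 mul0r normr0 !mulr_ge0// invr_ge0 ltW.
  rewrite indicE mem_set ?mulr1; last by rewrite /J/= in_itv/= -ler_norml.
  rewrite !normrM normfV (gtr0_norm l0) -mulrA ler_wpM2l ?invr_ge0 ?(ltW l0)//.
  by apply: ler_pM => //; exact: hG.
rewrite RintegralZl// [X in _ * X](_ : _ = 4 * l); last first.
  have EJ : (mu J = (4 * l)%:E).
    rewrite /J lebesgue_measure_itv/= lte_fin ifT; last by lra.
    by rewrite -EFinB; congr EFin; lra.
  rewrite /Rintegral integral_indic//; last exact: measurable_itv.
  by rewrite setIT [X in fine X]EJ.
rewrite le_eqVlt; apply/orP; left; apply/eqP; field.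
by rewrite gt_eqF.
Qed.

Lemma osc_bound th l h t B : 0 < l -> continuous h -> supp2 h ->
  (forall u, `|h u| <= B) -> `|osc th l h t| <= 4 * B.
Proof.
move=> l0 ch hs hB; rewrite -[B]mulr1.
apply: osc_bound_gen => //; first exact: continuous_cos_affine.
by move=> xi _; rewrite ler_norml cos_geN1 cos_le1.
Qed.

Lemma cos_lip (x y : R) : `|cos x - cos y| <= `|x - y|.
Proof.
wlog xy : x y / y < x.
  move=> hw; have [yx|xy|->] := ltgtP y x; first exact: hw.
    by rewrite distrC [leRHS]distrC hw.
  by rewrite !subrr normr0.
have [|c _ ->] := @MVT R (@cos R) (fun x => - sin x) y x xy.
- by apply: continuous_in_subspaceT => z _; exact: continuous_cos.
rewrite normrM normrN -[leRHS]mul1r ler_wpM2r//.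
by rewrite ler_norml sin_geN1 sin_le1.
Qed.

Lemma osc_lip th l h t t' B : 0 < l -> continuous h -> supp2 h ->
  (forall u, `|h u| <= B) ->
  `|osc th l h t - osc th l h t'| <= 8 * B * (l * `|t - t'|).
Proof.
move=> l0 ch hs hB; rewrite /osc.
rewrite -RintegralB//; try by apply: osc_integrable => //; exact: continuous_cos_affine.
under eq_Rintegral do rewrite -mulrBr.
have -> : 8 * B * (l * `|t - t'|) = 4 * (B * (`|t - t'| * (2 * l))) by ring.
apply: osc_bound_gen => //.
  by move=> x; apply: cvgB; exact: continuous_cos_affine.
move=> xi hx; apply: le_trans (cos_lip _ _) _.
rewrite (_ : _ - _ = (t - t') * xi); last by ring.
by rewrite normrM ler_wpM2l.
Qed.

(** Integration by parts. The primitive of the cosine is a sine, that is a cosine of phase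
    [th - pi / 2], and the compact support removes the boundary terms. *)
Lemma osc_ibp th l h t : 0 < l -> Cn 1 h -> supp2 h ->
  l * t * osc th l h t = - osc (th - pi / 2) l (derive1 h) t.
Proof.
move=> l0 [dh ch'] hs.
have ch := derivable_continuous dh.
have hs' : supp2 (derive1 h) by exact: derive1_supp.
pose G xi := h (xi / l) * cos (t * xi + (th - pi / 2)).
pose g xi := l^-1 * derive1 h (xi / l) * cos (t * xi + (th - pi / 2))
  + l * t * (l^-1 * h (xi / l) * cos (t * xi + th)).
have cosE u : - sin (u + (th - pi / 2)) = cos (u + th).
  by rewrite addrA sinB cos_pihalf sin_pihalf mulr0 sub0r mulr1 opprK.
have dG (xi : R) : is_derive xi 1 G (g xi).
  have d1 : is_derive xi 1 (fun xi : R => h (xi / l)) (l^-1 * derive1 h (xi / l)).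
    have := @is_derive_affine R h l^-1 0 xi.
    rewrite subr0 mulrC => /(_ (dh _)).
    by under [X in is_derive _ _ X _]eq_fun do rewrite subr0 mulrC.
  have d2 : is_derive xi 1 (fun xi : R => cos (t * xi + (th - pi / 2))) (t * cos (t * xi + th)).
    apply: is_derive_eq; rewrite -cosE.
    by rewrite ?addr0 ?scaler0 ?addr0; rewrite /GRing.scale/=; ring.
  apply: is_derive_eq; rewrite /g /GRing.scale/= addrC; congr (_ + _).
    by rewrite mulrC.
  by field; rewrite gt_eqF.
have c1 := @continuous_cos_affine t (th - pi / 2).
have c2 := @continuous_cos_affine t th.
have i1 := osc_integrable 0 0 l0 ch' hs' c1.
have i2 := osc_integrable 0 0 l0 ch hs c2.
have i3 : mu.-integrable setT (EFin \o (fun xi => l * t * (l^-1 * h (xi / l) * cos (t * xi + th)))).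
  exact: (integrableZl measurableT _ i2).
have cg : continuous g.
  move=> x; apply: cvgD; apply: cvgM; try exact: cst_continuous.
  - by apply: cvgM; [exact: cst_continuous|exact: continuous_dilate].
  - exact: c1.
  - apply: cvgM; last exact: c2.
    by apply: cvgM; [exact: cst_continuous|exact: continuous_dilate].
have dG' (xi : R) : derivable G xi 1 by have := dG xi => ?; exact: ex_derive.
have cG : continuous G by exact: derivable_continuous.
suff : Rintegral mu setT g = 0.
  rewrite RintegralD// RintegralZl// => /eqP.
  by rewrite addr_eq0 => /eqP h0; rewrite /osc h0 opprK.
(* The dilate of [h] lives on [[-2l, 2l]]. At [-3l] and [3l] the primitive [G] vanishes, so its
   derivative [g] has integral 0. *)
have l3 : - (3 * l) < 3 * l by lra.
have FTC := @continuous_FTC2 R g G (- (3 * l)) (3 * l) l3.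
have : (\int[mu]_(x in `[(- (3 * l))%R, (3 * l)%R]) (g x)%:E = 0)%E.
  rewrite FTC.
  - have z1 : h (3 * l / l) = 0.
      by rewrite mulfK ?gt_eqF// hs// gtr0_norm; lra.
    have z2 : h (- (3 * l) / l) = 0.
      by rewrite mulNr mulfK ?gt_eqF// hs// normrN gtr0_norm; lra.
    by rewrite /G z1 z2 !mul0r subee.
  - exact: continuous_subspaceT.
  - split; first by move=> x _; exact: dG'.
    + by apply: cvg_at_right_filter; exact: cG.
    + by apply: cvg_at_left_filter; exact: cG.
  - by move=> x _; rewrite derive1E; have := dG x => ?; exact: derive_val.
move=> E; rewrite -[RHS](_ : Rintegral mu `[(- (3 * l)), (3 * l)] g = 0); last by rewrite /Rintegral E.
rewrite [RHS]Rintegral_mkcond; apply: eq_Rintegral => x _; rewrite patchE.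
case: ifPn => // /negP hx.
have xl : 2 * l < `|x|.
  rewrite ltNge; apply/negP => hx'; apply: hx; rewrite inE/= in_itv/= -ler_norml.
  by apply: le_trans hx' _; rewrite ler_pM2r//; lra.
by rewrite /g (dilate_supp l0 hs xl) (dilate_supp l0 hs' xl) !mulr0 !mul0r mulr0 addr0.
Qed.

(** One integration by parts for each power of [l * t]. The constant is found before [th], because
    every step shifts the phase. *)
Lemma osc_decay m h : Cn m h -> supp2 h ->
  exists2 C, 0 <= C & forall th l t, 0 < l -> `|l * t| ^+ m * `|osc th l h t| <= C.
Proof.
elim: m h => [|m ih] h ch hs.
  have [B B0 hB] := supp_bounded ch hs.
  exists (4 * B); first by rewrite mulr_ge0.
  by move=> th l t l0; rewrite expr0 mul1r osc_bound.
have [dh ch'] := ch.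
have [|C C0 hC] := ih _ ch'; first exact: derive1_supp.
exists C => // th l t l0.
have c1 : Cn 1 h := conj dh (Cn_continuous ch').
rewrite exprSr -mulrA -normrM (osc_ibp th t l0 c1 hs) normrN.
exact: (hC (th - pi / 2) l t l0).
Qed.

Lemma osc_decay_lip m h : Cn m h -> supp2 h ->
  exists2 C, 0 <= C & forall th l t t', 0 < l -> l * `|t - t'| <= 1 ->
    `|l * t| ^+ m * `|osc th l h t - osc th l h t'| <= C * (l * `|t - t'|).
Proof.
elim: m h => [|m ih] h ch hs.
  have [B B0 hB] := supp_bounded ch hs.
  exists (8 * B); first by rewrite mulr_ge0.
  by move=> th l t t' l0 _; rewrite expr0 mul1r osc_lip.
have [dh ch'] := ch.
have hs' : supp2 (derive1 h) by exact: derive1_supp.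
have c1 : Cn 1 h := conj dh (Cn_continuous ch').
have [C C0 hC] := ih _ ch' hs'.
have [D D0 hD] := osc_decay (CnW ch) hs.
have [E E0 hE] := @osc_decay 0 h (Cn_continuous ch) hs.
have K0 : 0 <= 2 ^+ m * (D + E) by rewrite mulr_ge0 ?exprn_ge0 ?addr_ge0.
exists (C + 2 ^+ m * (D + E)); first by rewrite addr_ge0.
move=> th l t t' l0 ltt.
have lt0 : 0 <= l * `|t - t'| by rewrite mulr_ge0// ltW.
rewrite exprSr -mulrA -normrM.
(* [osc_ibp] at [t] and at [t'] have different factors [l t] and [l t']. Their difference leaves the
   last term, without the derivative of [h], which already carries the wanted [l (t - t')]. *)
have -> : l * t * (osc th l h t - osc th l h t') =
   - (osc (th - pi / 2) l (derive1 h) t - osc (th - pi / 2) l (derive1 h) t')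
   - l * (t - t') * osc th l h t'.
  have e1 := @osc_ibp th l h t l0 c1 hs; have e2 := @osc_ibp th l h t' l0 c1 hs.
  rewrite mulrBr e1 opprB [in RHS]addrC -[in RHS](opprK (osc (th - pi / 2) l _ t')) -e2.
  ring.
apply: le_trans (ler_wpM2l _ (ler_normB _ _)) _; first by rewrite exprn_ge0.
rewrite normrN mulrDr [in leRHS]mulrDl lerD//; first exact: (hC (th - pi / 2) l t t' l0 ltt).
rewrite [`|_ * osc _ _ _ _|]normrM [`|l * (t - t')|]normrM (gtr0_norm l0) mulrCA mulrC.
rewrite ler_wpM2r//.
have h1 := hD th l t' l0; have := hE th l t' l0; rewrite expr0 mul1r => h2.
(* The decay of that last term is known at [t'] and wanted at [t]. Since [l t] and [l t'] differ by
   at most 1, [|l t|] is at most [2 |l t'|] or at most 2. *)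
have h3 : `|l * t| ^+ m <= 2 ^+ m * (`|l * t'| ^+ m + 1).
  have h4 : `|l * t| <= `|l * t'| + 1.
    rewrite -lerBlDl; apply: le_trans (lerB_dist _ _) _.
    by rewrite -mulrBr normrM (gtr0_norm l0).
  have [h5|h5] := leP 1 `|l * t'|.
    apply: (@le_trans _ _ ((2 * `|l * t'|) ^+ m)).
      by rewrite lerXn2r ?nnegrE ?mulr_ge0//; lra.
    by rewrite exprMn ler_wpM2l ?exprn_ge0// lerDl.
  apply: (@le_trans _ _ (2 ^+ m)); first by rewrite lerXn2r ?nnegrE//; lra.
  by rewrite ler_peMr ?exprn_ge0// lerDr exprn_ge0.
apply: le_trans (ler_wpM2r (normr_ge0 _) h3) _.
by rewrite -mulrA ler_wpM2l ?exprn_ge0// mulrDl mul1r lerD.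
Qed.

Lemma om3_from_moments (u X C0 C6 : R) : 0 <= X -> X <= C0 ->
  `|u| ^+ 6 * X <= C6 -> X <= 8 * (C0 + C6) * om u ^+ 3.
Proof.
move=> X0 h0 h6.
have e6 : `|u| ^+ 6 = (u ^+ 2) ^+ 3 by rewrite -(real_normK (num_real u)) -exprM.
rewrite /om exprVn ler_pdivlMr; last by rewrite exprn_gt0// ltr_wpDr ?sqr_ge0.
have : (1 + u ^+ 2) ^+ 3 <= 8 * (1 + (u ^+ 2) ^+ 3).
  have : 0 <= u ^+ 2 by rewrite sqr_ge0.
  move: (u ^+ 2) => w w0.
  have : 0 <= (w - 1) ^+ 2 * (w + 1) by rewrite mulr_ge0 ?sqr_ge0 ?addr_ge0.
  nra.
rewrite e6 in h6 => h.
apply: le_trans (ler_wpM2l X0 h) _; rewrite mulrCA ler_wpM2l//.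
by rewrite mulrDr mulr1 lerD// mulrC.
Qed.

(** Six integrations by parts, together with the bound without any, give the cube of [om]. Two of
    the three factors will pay for the weight [om x ^ 2]; the third keeps the decay at scale
    [2 ^- k]. *)
Lemma osc_om h : Cn 6 h -> supp2 h -> exists2 C, 0 <= C &
  (forall th l t, 0 < l -> `|osc th l h t| <= C * om (l * t) ^+ 3) /\
  (forall th l t t', 0 < l -> l * `|t - t'| <= 1 ->
    `|osc th l h t - osc th l h t'| <= C * (l * `|t - t'|) * om (l * t) ^+ 3).
Proof.
move=> ch hs.
have ch0 : Cn 0 h by exact: Cn_continuous ch.
have [C0 C00 h0] := osc_decay ch0 hs; have [C6 C60 h6] := osc_decay ch hs.
have [D0 D00 k0] := osc_decay_lip ch0 hs; have [D6 D60 k6] := osc_decay_lip ch hs.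
exists (8 * (C0 + C6) + 8 * (D0 + D6)).
  by rewrite addr_ge0// mulr_ge0// addr_ge0.
have o3 (u : R) : 0 <= om u ^+ 3 by rewrite exprn_ge0// om_ge0.
split=> [th l t l0|th l t t' l0 ltt].
  apply: (@le_trans _ _ (8 * (C0 + C6) * om (l * t) ^+ 3)).
    apply: om3_from_moments => //; last exact: h6.
    by have := h0 th l t l0; rewrite expr0 mul1r.
  by rewrite ler_wpM2r// lerDl mulr_ge0// addr_ge0.
have lt0 : 0 <= l * `|t - t'| by rewrite mulr_ge0// ltW.
apply: (@le_trans _ _ (8 * (D0 * (l * `|t - t'|) + D6 * (l * `|t - t'|)) * om (l * t) ^+ 3)).
  apply: om3_from_moments => //; last exact: k6.
  by have := k0 th l t t' l0 ltt; rewrite expr0 mul1r.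
rewrite ler_wpM2r// -mulrDl mulrA ler_wpM2r// lerDr mulr_ge0// addr_ge0//.
Qed.

End oscillatory_integrals.

(** * Division by the frequency *)

Section division.
Context {R : realType}.
Implicit Types (h : R -> R).

(** The dyadic profile [chi] below has this property, so dividing it by the frequency, as the
    Fourier transform of an interval demands, keeps it smooth. With [x / 0 = 0] the quotient has the
    right value at the origin too. *)
Definition vanish0 h := forall u, `|u| < 1 / 2 -> h u = 0.

Lemma vanish0_derive h : vanish0 h -> vanish0 (derive1 h).
Proof.
move=> h0 u hu; rewrite derive1E.
have nA : \forall y \near u, `|y| < 1 / 2.
  have : continuous (fun y : R => `|y|) by move=> y; exact: norm_continuous.
  by move/(_ u)/cvgr_lt; apply.
rewrite (@near_eq_derive _ _ _ h (fun=> 0))//; first exact: derive_cst.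
by apply: filterS nA => y /h0.
Qed.

Lemma vanish0_div h : vanish0 h -> vanish0 (fun u => h u / u).
Proof. by move=> h0 u hu; rewrite h0// mul0r. Qed.

Lemma is_derive_div h : vanish0 h -> (forall x, derivable h x 1) ->
  forall x : R, is_derive x 1 (fun u => h u / u) (derive1 h x / x - h x / x / x).
Proof.
move=> h0 dh x; have [->|x0] := eqVneq x 0.
  rewrite !invr0 !mulr0 subr0.
  have nA : \forall y \near (0 : R), h y / y = (fun=> 0) y.
    have : continuous (fun y : R => `|y|) by move=> y; exact: norm_continuous.
    move/(_ 0)/cvgr_lt => /(_ (1 / 2)); rewrite normr0 => /(_ _)/filterS; apply.
      by move=> y /h0 ->; rewrite mul0r.
    by rewrite divr_gt0.
  have d0 : is_derive (0 : R) (1 : R) (fun=> 0 : R) 0 by exact: is_derive_cst.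
  have nA' : \forall y \near (0 : R), 0 = h y / y by apply: filterS nA => y ->.
  exact: (near_eq_is_derive nA' d0).
have d1 : is_derive x 1 h (derive1 h x) by rewrite derive1E; exact/derivableP.
have d2 : is_derive x 1 (fun u : R => u^-1) (- x ^- 2).
  have := @is_deriveV R id x 1 1 x0 (is_derive_id _ _).
  by rewrite [_ *: 1]mulr1.
apply: is_derive_eq (is_deriveM d1 d2) _.
by rewrite /GRing.scale/= expr2 invfM mulrN mulrA addrC [x^-1 * _]mulrC.
Qed.

Lemma Cn_div n h : Cn n h -> vanish0 h -> Cn n (fun u => h u / u).
Proof.
elim: n h => [|n ih] h.
  move=> ch h0 x; have [->|x0] := eqVneq x 0.
    have nA : \forall y \near (0 : R), 0 = h y / y.
      have : continuous (fun y : R => `|y|) by move=> y; exact: norm_continuous.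
      move/(_ 0)/cvgr_lt => /(_ (1 / 2)); rewrite normr0 => /(_ _)/filterS; apply.
        by move=> y /h0 ->; rewrite mul0r.
      by rewrite divr_gt0.
    rewrite /continuous_at invr0 mulr0.
    apply: cvg_trans (near_eq_cvg nA) _; exact: cvg_cst.
  by apply: cvgM; [exact: ch|exact: cvgV].
move=> ch h0; have [dh ch'] := ch.
have D := is_derive_div h0 dh.
split; first by move=> x; have := D x => ?; exact: ex_derive.
have -> : derive1 (fun u => h u / u) = (fun x => derive1 h x / x - h x / x / x).
  by apply/funext => x; rewrite derive1E; have := D x => ?; exact: derive_val.
have c1 : Cn n (fun x => derive1 h x / x) := ih _ ch' (vanish0_derive h0).
have c2 : Cn n (fun x => h x / x / x).
  exact: (ih _ (ih _ (CnW ch) h0) (vanish0_div h0)).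
rewrite (_ : (fun x => _ - _) = (fun x => derive1 h x / x) \+ ((fun=> -1) \* (fun x => h x / x / x))).
  by apply: CnD => //; apply: CnM => //; exact: Cn_cst.
by apply/funext => x; rewrite /= mulN1r.
Qed.

End division.

Section cis_facts.
Context {R : realType}.
Implicit Types (s t : R).

Lemma cisD s t : cis (s + t) = cis s * cis t :> R[i].
Proof. by apply: complex_eq; rewrite ?ReM ?ImM /= ?cosD ?sinD// addrC. Qed.

Lemma cis0 : cis 0 = 1 :> R[i].
Proof. by rewrite /cis cos0 sin0. Qed.

Lemma normc_cis t : normc (cis t : R[i]) = 1.
Proof. by rewrite /= cos2Dsin2 sqrtr1. Qed.

Lemma cos_shift t : cos (t - pi / 2) = sin t.
Proof. by rewrite cosB cos_pihalf sin_pihalf mulr0 add0r mulr1. Qed.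

Lemma cmeas_cis (dX : measure_display) (X : measurableType dX) (f : X -> R) :
  measurable_fun setT f -> cmeas (fun x => cis (f x) : R[i]).
Proof.
move=> mf; split.
  apply: (measurableT_comp _ mf).
  by apply: (@continuous_measurable_fun R) => x; exact: continuous_cos.
apply: (measurableT_comp _ mf).
by apply: (@continuous_measurable_fun R) => x; exact: continuous_sin.
Qed.

Lemma cmeas_continuous (F : R -> R[i]) : continuous (Re \o F) -> continuous (Im \o F) ->
  @cmeas _ (measurableTypeR R) R F.
Proof.
by move=> c1 c2; split; exact: (@continuous_measurable_fun R).
Qed.

Lemma locally_lipschitz_continuous (F : R -> R[i]) (K dl : R) : 0 < dl ->
  (forall t t', `|t - t'| <= dl -> normc (F t - F t') <= K * `|t - t'|) ->
  continuous (Re \o F) /\ continuous (Im \o F).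
Proof.
move=> dl0 FK.
have K0 : 0 <= K.
  have := FK 0 dl; rewrite sub0r normrN gtr0_norm// => /(_ (lexx _)) h.
  by rewrite -(pmulr_lge0 _ dl0); apply: le_trans h; exact: normc_ge0.
have key (G : R -> R) : (forall t t', `|G t - G t'| <= normc (F t - F t')) -> continuous G.
  move=> hG t; apply/cvgrPdist_lt => e e0.
  have m0 : 0 < Num.min dl (e / (K + 1)).
    by rewrite lt_min dl0 divr_gt0// ltr_wpDl.
  apply/nbhs_ballP; exists (Num.min dl (e / (K + 1))) => //= y; rewrite /ball/= lt_min => /andP[y1 y2].
  apply: le_lt_trans (hG _ _) _; apply: le_lt_trans (FK _ _ (ltW y1)) _.
  rewrite ltr_pdivlMr ?ltr_wpDl// mulrC in y2; apply: le_lt_trans y2.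
  by rewrite ler_wpM2r// lerDl.
split; apply: key => t t' /=.
  have -> : Re (F t) - Re (F t') = Re (F t - F t') by case: (F t) (F t') => [? ?] [].
  exact: normr_Re_le.
have -> : Im (F t) - Im (F t') = Im (F t - F t') by case: (F t) (F t') => [? ?] [].
exact: normr_Im_le.
Qed.

End cis_facts.

(** * Oscillatory integrals with complex amplitude *)

Section complex_oscillatory.
Context {R : realType}.
Local Notation mu := (@lebesgue_measure R).
Variable H : R -> R[i].
Hypothesis CRe : Cn 6 (fun u => Re (H u)).
Hypothesis CIm : Cn 6 (fun u => Im (H u)).
Hypothesis supH : forall u, 2 < `|u| -> H u = 0.

Definition cosc (l t : R) : R[i] :=
  cint mu (fun xi => (l^-1)%:C * H (xi / l) * cis (t * xi)).

Let sRe : supp2 (fun u => Re (H u)). Proof. by move=> u /supH ->. Qed.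
Let sIm : supp2 (fun u => Im (H u)). Proof. by move=> u /supH ->. Qed.

Let cRe := Cn_continuous CRe.
Let cIm := Cn_continuous CIm.

Let intR l th t : 0 < l -> mu.-integrable setT
  (EFin \o (fun xi : R => l^-1 * Re (H (xi / l)) * cos (t * xi + th))).
Proof.
move=> l0; apply: (osc_integrable 0 0 l0 cRe sRe).
exact: continuous_cos_affine.
Qed.

Let intI l th t : 0 < l -> mu.-integrable setT
  (EFin \o (fun xi : R => l^-1 * Im (H (xi / l)) * cos (t * xi + th))).
Proof.
move=> l0; apply: (osc_integrable 0 0 l0 cIm sIm).
exact: continuous_cos_affine.
Qed.

Let ReE l t xi : Re ((l^-1)%:C * H (xi / l) * cis (t * xi)) =
  l^-1 * Re (H (xi / l)) * cos (t * xi + 0)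
  - l^-1 * Im (H (xi / l)) * cos (t * xi + - (pi / 2)).
Proof. by rewrite cos_shift addr0 !ReM !ImM/= !mul0r subr0 addr0. Qed.

Let ImE l t xi : Im ((l^-1)%:C * H (xi / l) * cis (t * xi)) =
  l^-1 * Re (H (xi / l)) * cos (t * xi + - (pi / 2))
  + l^-1 * Im (H (xi / l)) * cos (t * xi + 0).
Proof. by rewrite cos_shift addr0 !ImM !ReM/= !mul0r subr0 addr0. Qed.

Lemma cosc_cintble l t : 0 < l ->
  cintble mu (fun xi : measurableTypeR R => (l^-1)%:C * H (xi / l) * cis (t * xi)).
Proof.
move=> l0; split.
  under eq_fun do rewrite ReE EFinB.
  by apply: (integrableB measurableT); [exact: intR|exact: intI].
under eq_fun do rewrite ImE EFinD.
by apply: (integrableD measurableT); [exact: intR|exact: intI].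
Qed.

Lemma coscE l t : 0 < l -> cosc l t =
  (osc 0 l (fun u => Re (H u)) t - osc (- (pi / 2)) l (fun u => Im (H u)) t) +i*
  (osc (- (pi / 2)) l (fun u => Re (H u)) t + osc 0 l (fun u => Im (H u)) t).
Proof.
move=> l0; apply: complex_eq; rewrite /cosc /cint /=.
  under eq_Rintegral do rewrite ReE.
  by rewrite RintegralB//; [exact: intR|exact: intI].
under eq_Rintegral do rewrite ImE.
by rewrite RintegralD//; [exact: intR|exact: intI].
Qed.

Lemma cosc_om : exists2 C, 0 <= C &
  (forall l t, 0 < l -> normc (cosc l t) <= C * om (l * t) ^+ 3) /\
  (forall l t t', 0 < l -> l * `|t - t'| <= 1 ->
    normc (cosc l t - cosc l t') <= C * (l * `|t - t'|) * om (l * t) ^+ 3).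
Proof.
have [C C0 [hC kC]] := osc_om CRe sRe.
have [D D0 [hD kD]] := osc_om CIm sIm.
exists (2 * (C + D)); first by rewrite mulr_ge0// addr_ge0.
split=> [l t l0|l t t' l0 ltt].
  rewrite coscE//; apply: le_trans (normc_le_ReIm _) _ => /=.
  apply: le_trans (lerD (ler_normB _ _) (ler_normD _ _)) _.
  have := hC 0 l t l0; have := hC (- (pi / 2)) l t l0.
  have := hD 0 l t l0; have := hD (- (pi / 2)) l t l0.
  by rewrite -[2 * _ * _]mulrA mulrDl; lra.
rewrite !coscE//; apply: le_trans (normc_le_ReIm _) _.
set a1 := osc 0 l _ t; set a2 := osc (- (pi / 2)) l _ t.
set a3 := osc (- (pi / 2)) l _ t; set a4 := osc 0 l _ t.
set b1 := osc 0 l _ t'; set b2 := osc (- (pi / 2)) l _ t'.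
set b3 := osc (- (pi / 2)) l _ t'; set b4 := osc 0 l _ t'.
rewrite /= (_ : a1 - a2 - (b1 - b2) = (a1 - b1) - (a2 - b2)); last by ring.
rewrite (_ : a3 + a4 - (b3 + b4) = (a3 - b3) + (a4 - b4)); last by ring.
apply: le_trans (lerD (ler_normB _ _) (ler_normD _ _)) _.
have := kC 0 l t t' l0 ltt; have := kC (- (pi / 2)) l t t' l0 ltt.
have := kD 0 l t t' l0 ltt; have := kD (- (pi / 2)) l t t' l0 ltt.
rewrite -/a1 -/a2 -/a3 -/a4 -/b1 -/b2 -/b3 -/b4.
have -> : 2 * (C + D) * (l * `|t - t'|) * om (l * t) ^+ 3 =
  2 * (C * (l * `|t - t'|) * om (l * t) ^+ 3) + 2 * (D * (l * `|t - t'|) * om (l * t) ^+ 3) by ring.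
lra.
Qed.

End complex_oscillatory.

(** * Fourier transform of an interval of length 1 *)

Section interval_transform.
Context {R : realType}.
Local Notation mu := (@lebesgue_measure R).
Implicit Types (z xi t : R).

Definition unit_itv z : set (measurableTypeR R) := `]z, z + 1]%classic.

Definition ind_itv z (y : measurableTypeR R) : R := \1_(unit_itv z) y.

Lemma ind_itvE z (y : R) : ind_itv z y = ((z < y <= z + 1)%R)%:R.
Proof.
rewrite /ind_itv indicE /unit_itv; congr (nat_of_bool _)%:R.
by apply/idP/idP; rewrite inE/= in_itv.
Qed.

Lemma ind_itv_integrable z : mu.-integrable setT (EFin \o ind_itv z).
Proof. exact: integrable_indic_itv. Qed.

Lemma measurable_ind_itv z : measurable_fun setT (ind_itv z).
Proof. by have /measurable_int/measurable_EFinP := ind_itv_integrable z. Qed.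

Lemma Rintegral_ind_itv z : Rintegral mu setT (ind_itv z) = 1.
Proof.
have E : mu (unit_itv z) = 1%:E.
  rewrite /unit_itv lebesgue_measure_itv/= lte_fin ltrDl ltr01.
  by rewrite -EFinB; congr EFin; ring.
rewrite /Rintegral integral_indic//; last exact: measurable_itv.
by rewrite setIT [X in fine X]E.
Qed.

Lemma ind_itv_ge0 z y : 0 <= ind_itv z y.
Proof. by rewrite ind_itvE ler0n. Qed.

Definition itv_hat z xi : R[i] :=
  cint mu (fun y => (ind_itv z y)%:C * cis (- (y * xi))).

Lemma cmeas_ind_cis z xi : cmeas (fun y : measurableTypeR R => (ind_itv z y)%:C * cis (- (y * xi))).
Proof.
apply: cmeasM; first by apply: cmeas_real; exact: measurable_ind_itv.
apply: cmeas_cis; apply: (@continuous_measurable_fun R) => y.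
by apply: cvgN; apply: cvgM; [exact: cvg_id|exact: cst_continuous].
Qed.

Lemma normc_ind_cis z xi y : normc ((ind_itv z y)%:C * cis (- (y * xi))) <= ind_itv z y.
Proof. by rewrite normcM normc_cis mulr1 normc_real ger0_norm// ind_itv_ge0. Qed.

Lemma Rintegral_ind_cos z xi th :
  xi * Rintegral mu setT (fun y => ind_itv z y * cos (xi * y + th)) =
  cos (xi * (z + 1) + th - pi / 2) - cos (xi * z + th - pi / 2).
Proof.
have i1 : mu.-integrable `[z, z + 1] (EFin \o (fun y => cos (xi * y + th))).
  apply: continuous_compact_integrable; first exact: segment_compact.
  by apply: continuous_subspaceT => x; exact: continuous_cos_affine.
have -> : Rintegral mu setT (fun y => ind_itv z y * cos (xi * y + th)) =
    Rintegral mu `[z, z + 1] (fun y => cos (xi * y + th)).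
  rewrite -Rintegral_itv_obnd_cbnd; last first.
    by apply: integrableS i1 => //; exact: subset_itv_oc_cc.
  rewrite [RHS]Rintegral_mkcond; apply: eq_Rintegral => y _.
  rewrite patchE ind_itvE; case: ifPn; rewrite ?inE/= ?in_itv/=.
    by move=> ->; rewrite mul1r.
  by move=> /negP; rewrite inE/= in_itv/= => /negP/negbTE ->; rewrite mul0r.
rewrite -RintegralZl//.
have zz : z < z + 1 by rewrite ltrDl.
pose G y := cos (xi * y + th - pi / 2).
have dG (y : R) : is_derive y 1 G (xi * cos (xi * y + th)).
  apply: is_derive_eq; rewrite /GRing.scale/=.
  by rewrite -[in RHS](opprK (cos _)) -[in RHS]sinBpihalf; ring.
rewrite /Rintegral (@continuous_FTC2 R _ G z (z + 1) zz).
- by [].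
- apply: continuous_subspaceT => x; apply: cvgM; first exact: cst_continuous.
  exact: continuous_cos_affine.
- have cG : continuous G.
    by apply: derivable_continuous => x; have := dG x => ?; exact: ex_derive.
  split; first by move=> x _; have := dG x => ?; exact: ex_derive.
  + by apply: cvg_at_right_filter; exact: cG.
  + by apply: cvg_at_left_filter; exact: cG.
- by move=> x _; rewrite derive1E; have := dG x => ?; exact: derive_val.
Qed.

Lemma itv_hatE z xi : itv_hat z xi =
  (Rintegral mu setT (fun y => ind_itv z y * cos (xi * y + 0))) +i*
  (- Rintegral mu setT (fun y => ind_itv z y * cos (xi * y + - (pi / 2)))).
Proof.
apply: complex_eq; rewrite /itv_hat /cint /=.
  apply: eq_Rintegral => y _.
  by rewrite mul0r subr0 cosN addr0 [y * _]mulrC.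
under eq_Rintegral do rewrite mul0r addr0 sinN mulrN [_ * xi]mulrC -cos_shift -mulN1r.
rewrite RintegralZl ?mulN1r//.
have c1 : cmeas (fun y : measurableTypeR R => (ind_itv z y)%:C * (cos (xi * y - pi / 2))%:C).
  apply: cmeasM; first by apply: cmeas_real; exact: measurable_ind_itv.
  by apply: cmeas_real; apply: (@continuous_measurable_fun R) => x; exact: continuous_cos_affine.
have b1 y : normc ((ind_itv z y)%:C * (cos (xi * y - pi / 2))%:C) <= ind_itv z y.
  rewrite normcM !normc_real ger0_norm ?ind_itv_ge0//.
  by rewrite ler_piMr ?ind_itv_ge0// ler_norml cos_geN1 cos_le1.
have [+ _] := cintble_le c1 (ind_itv_integrable z) b1.
by apply: eq_integrable => // y _; rewrite -rmorphM.
Qed.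

(** The fundamental theorem of calculus, kept as a product with [i xi] so that the frequency 0 is no
    exception. *)
Lemma itv_hat_mul z xi : itv_hat z xi * (0 +i* xi) = cis (- (z * xi)) - cis (- ((z + 1) * xi)).
Proof.
rewrite itv_hatE; apply: complex_eq.
  rewrite ReM /= mulr0 sub0r mulNr opprK mulrC Rintegral_ind_cos.
  rewrite -!addrA -!opprD -!splitr !cosB cospi sinpi !mulr0 !addr0 !mulrN1 !cosN.
  by rewrite ![xi * _]mulrC; ring.
rewrite ImM /= mulr0 addr0 mulrC Rintegral_ind_cos !addr0 !cos_shift !sinN.
by rewrite ![xi * _]mulrC; ring.
Qed.

Lemma itv_hat0 z : itv_hat z 0 = 1.
Proof.
rewrite /itv_hat; under cint_eq do rewrite mulr0 oppr0 cis0 mulr1.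
by rewrite cint_real Rintegral_ind_itv.
Qed.

(** For [xi != 0] the factor [i xi] cancels from [itv_hat_mul], which replaces a change of
    variables; at 0 both sides are 1. *)
Lemma itv_hat_shift z xi : itv_hat z xi = cis (- (z * xi)) * itv_hat 0 xi.
Proof.
have [->|x0] := eqVneq xi 0; first by rewrite mulr0 oppr0 cis0 !itv_hat0 mulr1.
have i0 : (0 +i* xi : R[i]) != 0 by rewrite eq_complex/= eqxx.
apply: (mulIf i0); rewrite -mulrA !itv_hat_mul mul0r oppr0 cis0 mulrBr mulr1.
by rewrite -cisD add0r mul1r; congr (_ - cis _); ring.
Qed.

End interval_transform.

(** * Dyadic blocks of intervals *)

Section cells.
Context {R : realType}.
Local Notation mu := (@lebesgue_measure R).

Definition cell (a c : R) (y : measurableTypeR R) : R :=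
  \1_(`]a, c]%classic : set (measurableTypeR R)) y.

Lemma cellE a c (y : R) : cell a c y = ((a < y <= c)%R)%:R.
Proof.
rewrite /cell indicE; congr (nat_of_bool _)%:R.
by apply/idP/idP; rewrite inE/= in_itv.
Qed.

Lemma cell_ge0 a c y : 0 <= cell a c y. Proof. by rewrite cellE ler0n. Qed.

Lemma cell_integrable a c : mu.-integrable setT (EFin \o cell a c).
Proof. exact: integrable_indic_itv. Qed.

Lemma Rintegral_cell a c : a <= c -> Rintegral mu setT (cell a c) = c - a.
Proof.
move=> ac.
have E : mu (`]a, c]%classic : set (measurableTypeR R)) = (c - a)%:E.
  rewrite lebesgue_measure_itv/= lte_fin; move: ac; rewrite le_eqVlt => /predU1P[->|ac].
    by rewrite ltxx subrr.
  by rewrite ac -EFinB.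
rewrite /Rintegral /cell integral_indic//.
by rewrite setIT [X in fine X]E.
Qed.

Lemma ind_itv0_cell : ind_itv 0 = cell (0 : R) 1.
Proof. by rewrite /ind_itv /unit_itv add0r. Qed.

Lemma cell_sum (M : nat) (y : R) : (0 < M)%N ->
  cell 0 1 y = \sum_(m < M) cell (m%:R / M%:R) (m.+1%:R / M%:R) y.
Proof.
move=> M0; have M0' : (0 : R) < M%:R by rewrite ltr0n.
suff h j : \sum_(m < j) cell (m%:R / M%:R) (m.+1%:R / M%:R) y = cell 0 (j%:R / M%:R) y.
  by rewrite h divff ?gt_eqF.
elim: j => [|j ih].
  by rewrite big_ord0 mul0r cellE; case: ltP.
rewrite big_ord_recr/= ih !cellE.
have h1 : j%:R / M%:R < j.+1%:R / M%:R :> R by rewrite ltr_pM2r ?invr_gt0// ltr_nat.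
have h0 : 0 <= j%:R / M%:R :> R by rewrite divr_ge0.
have [y0|y0] := leP y 0.
  have -> : (j%:R / M%:R < y) = false by apply/negbTE; rewrite -leNgt (le_trans y0).
  by rewrite addr0.
have [y1|y1] := leP y (j%:R / M%:R).
  by rewrite (le_trans y1 (ltW h1)) addr0.
by rewrite /= add0r.
Qed.

Lemma cmeas_cell_mul a c (F : R -> R[i]) : continuous (Re \o F) ->
  continuous (Im \o F) -> cmeas (fun y : measurableTypeR R => (cell a c y)%:C * F y).
Proof.
move=> c1 c2; apply: cmeasM; last exact: cmeas_continuous.
by apply: cmeas_real; have /measurable_int/measurable_EFinP := cell_integrable a c.
Qed.

Lemma cell_cintble a c (F : R -> R[i]) B : continuous (Re \o F) ->
  continuous (Im \o F) -> (forall y, a < y <= c -> normc (F y) <= B) -> 0 <= B ->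
  cintble mu (fun y : measurableTypeR R => (cell a c y)%:C * F y).
Proof.
move=> c1 c2 FB B0.
apply: (@cintble_le _ _ _ _ _ (fun y => B * cell a c y)); first exact: cmeas_cell_mul.
  exact: (integrableZl measurableT _ (cell_integrable a c)).
move=> y; rewrite normcM normc_real ger0_norm ?cell_ge0// cellE.
by case: (boolP (a < y <= c)%R) => [/FB h|_]; rewrite ?mul1r ?mulr1// mul0r mulr0.
Qed.

Lemma cell_cint_le a c (F : R -> R[i]) B : continuous (Re \o F) ->
  continuous (Im \o F) -> a <= c -> (forall y, a < y <= c -> normc (F y) <= B) -> 0 <= B ->
  normc (cint mu (fun y : measurableTypeR R => (cell a c y)%:C * F y)) <=
  2 * (c - a) * B.
Proof.
move=> c1 c2 ac FB B0.
have h : forall y, normc ((cell a c y)%:C * F y) <= B * cell a c y.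
  move=> y; rewrite normcM normc_real ger0_norm ?cell_ge0// cellE.
  by case: (boolP (a < y <= c)%R) => [/FB h|_]; rewrite ?mul1r ?mulr1// mul0r mulr0.
have := normc_cint_le (cell_cintble c1 c2 FB B0) (integrableZl measurableT B (cell_integrable a c)) h.
by rewrite RintegralZl ?Rintegral_cell//; [rewrite mulrA mulrAC|exact: cell_integrable].
Qed.

End cells.

Section alpha.
Context {R : realType}.
Local Notation mu := (@lebesgue_measure R).
Variable phi0 : R -> R[i].
Hypothesis seed : resolution_seed phi0.

Let phi1 u : `|u| <= 1 -> phi0 u = 1. Proof. by case: seed => _ h _; exact: h. Qed.

Lemma seed_supp u : 3 / 2 < `|u| -> phi0 u = 0.
Proof. by case: seed => _ _ h; exact: h. Qed.

Lemma seed_Re n : Cn n (fun u => Re (phi0 u)).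
Proof. by case: seed => -[[sm _] _] _ _; exact: (smooth_rV1_Cn sm). Qed.

Lemma seed_Im n : Cn n (fun u => Im (phi0 u)).
Proof. by case: seed => -[[_ sm] _] _ _; exact: (smooth_rV1_Cn sm). Qed.

(** All dyadic functions of positive level are dilates of this one, see [dyadicS]. *)
Definition chi (u : R) : R[i] := phi0 u - phi0 (2 * u).

(** The quotient [chi u / (i u)], in real and imaginary parts. *)
Definition chi_div (u : R) : R[i] := (Im (chi u) / u) +i* (- (Re (chi u) / u)).

Lemma chi_vanish u : `|u| < 1 / 2 -> chi u = 0.
Proof.
move=> hu; rewrite /chi !phi1 ?subrr//; last by lra.
by rewrite normrM gtr0_norm//; lra.
Qed.

Lemma chi_supp u : 2 < `|u| -> chi u = 0.
Proof.
move=> hu; rewrite /chi !seed_supp ?subrr//; last by lra.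
by rewrite normrM gtr0_norm//; lra.
Qed.

Lemma chi_Re n : Cn n (fun u => Re (chi u)).
Proof.
have -> : (fun u => Re (chi u)) = (fun u => Re (phi0 u)) \+
    ((fun=> -1) \* (fun u => Re (phi0 (2 * (u - 0))))).
  apply/funext => u /=; rewrite subr0 mulN1r /chi.
  by case: (phi0 u) (phi0 (2 * u)) => [? ?] [].
apply: CnD; first exact: seed_Re.
by apply: CnM; [exact: Cn_cst|exact: (Cn_affine 2 0 (seed_Re n))].
Qed.

Lemma chi_Im n : Cn n (fun u => Im (chi u)).
Proof.
have -> : (fun u => Im (chi u)) = (fun u => Im (phi0 u)) \+
    ((fun=> -1) \* (fun u => Im (phi0 (2 * (u - 0))))).
  apply/funext => u /=; rewrite subr0 mulN1r /chi.
  by case: (phi0 u) (phi0 (2 * u)) => [? ?] [].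
apply: CnD; first exact: seed_Im.
by apply: CnM; [exact: Cn_cst|exact: (Cn_affine 2 0 (seed_Im n))].
Qed.

Lemma chi_div_Re n : Cn n (fun u => Re (chi_div u)).
Proof.
by apply: (Cn_div (chi_Im n)) => u /chi_vanish ->.
Qed.

Lemma chi_div_Im n : Cn n (fun u => Im (chi_div u)).
Proof.
have -> : (fun u => Im (chi_div u)) = (fun=> -1) \* (fun u => Re (chi u) / u).
  by apply/funext => u /=; rewrite mulN1r.
apply: CnM; first exact: Cn_cst.
by apply: (Cn_div (chi_Re n)) => u /chi_vanish ->.
Qed.

Lemma chi_div_supp u : 2 < `|u| -> chi_div u = 0.
Proof. by move=> /chi_supp h; rewrite /chi_div h /= !mul0r oppr0. Qed.

Lemma chi_divE u : (0 +i* u) * chi_div u = chi u.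
Proof.
have [->|u0] := eqVneq u 0.
  by rewrite (_ : 0 +i* 0 = 0)// mul0r chi_vanish// normr0 divr_gt0.
rewrite /chi_div; case: (chi u) => a e /=; apply: complex_eq => /=.
  by rewrite mul0r sub0r mulrN opprK mulrCA mulfV ?mulr1.
by rewrite mul0r add0r mulrCA mulfV ?mulr1.
Qed.

Lemma dyadicS k u : dyadic phi0 k.+1 u = chi (u / 2 ^+ k.+1).
Proof.
rewrite /dyadic /chi; congr (_ - phi0 _).
rewrite exprS; field; rewrite expf_neq0//.
Qed.

Lemma dyadic_continuous k : continuous (Re \o dyadic phi0 k) /\
  continuous (Im \o dyadic phi0 k).
Proof.
case: k => [|k].
  by split; [exact: Cn_continuous (seed_Re 0)|exact: Cn_continuous (seed_Im 0)].
split.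
- have -> : Re \o dyadic phi0 k.+1 = fun u => Re (chi (u / 2 ^+ k.+1)).
    by apply/funext => u; rewrite /comp dyadicS.
  exact: (continuous_dilate (Cn_continuous (chi_Re 0))).
- have -> : Im \o dyadic phi0 k.+1 = fun u => Im (chi (u / 2 ^+ k.+1)).
    by apply/funext => u; rewrite /comp dyadicS.
  exact: (continuous_dilate (Cn_continuous (chi_Im 0))).
Qed.

Lemma dyadic_supp k u : 2 * 2 ^+ k < `|u| -> dyadic phi0 k u = 0.
Proof.
case: k => [|k] h; first by rewrite /= seed_supp//; move: h; rewrite expr0; lra.
rewrite dyadicS chi_supp// normrM normfV (@gtr0_norm _ (2 ^+ k.+1)) ?exprn_gt0//.
by rewrite ltr_pdivlMr ?exprn_gt0.
Qed.

Lemma cintble_supp (H : R -> R[i]) A : continuous (Re \o H) ->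
  continuous (Im \o H) -> (forall u, A < `|u| -> H u = 0) ->
  @cintble _ (measurableTypeR R) R mu H.
Proof.
move=> c1 c2 HA.
have sr u : A < `|u| -> (Re \o H) u = 0 by move=> /HA /= ->.
have si u : A < `|u| -> (Im \o H) u = 0 by move=> /HA /= ->.
have [B _ hB] := supp_bounded c1 sr; have [D _ hD] := supp_bounded c2 si.
split.
  by apply: (supp_integrable _ sr hB); exact: (@continuous_measurable_fun R).
by apply: (supp_integrable _ si hD); exact: (@continuous_measurable_fun R).
Qed.

Lemma dyadic_cintble k : @cintble _ (measurableTypeR R) R mu (dyadic phi0 k).
Proof.
by have [c1 c2] := dyadic_continuous k; exact: cintble_supp c1 c2 (@dyadic_supp k).
Qed.

(* Dyadic block [k] of the indicator of ]0, 1]. *)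
Definition alpha k (t : R) : R[i] := ((2 * pi)^-1)%:C *
  cint mu (fun xi : measurableTypeR R => dyadic phi0 k xi * itv_hat 0 xi * cis (t * xi)).

(** The multiplier is [i xi] times a dilate of [chi_div], and
    [i xi * itv_hat 0 xi = 1 - cis (- xi)]. What remains are two smooth kernels, one for each
    endpoint of the interval: away from the endpoints the block is small. *)
Lemma alphaS k t : alpha k.+1 t = ((2 * pi)^-1)%:C *
  (cosc chi_div (2 ^+ k.+1) t - cosc chi_div (2 ^+ k.+1) (t - 1)).
Proof.
have l0 : (0 : R) < 2 ^+ k.+1 by rewrite exprn_gt0.
have i t' := @cosc_cintble R chi_div (chi_div_Re 6) (chi_div_Im 6) chi_div_supp _ t' l0.
rewrite /alpha /cosc -cintB//; congr (_ * _); apply: cint_eq => xi.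
rewrite dyadicS -chi_divE.
have -> : (0 +i* (xi / 2 ^+ k.+1) : R[i]) = (0 +i* xi) * ((2 ^+ k.+1)^-1)%:C.
  by apply: complex_eq; rewrite ?ReM ?ImM /= ?mul0r ?mulr0 ?subr0 ?add0r.
set L := ((2 ^+ k.+1)^-1)%:C; set X := chi_div _.
have -> : (t - 1) * xi = t * xi + - ((0 + 1) * xi) by ring.
rewrite cisD; have := itv_hat_mul 0 xi; rewrite mul0r oppr0 cis0 => h.
have -> : cis (- ((0 + 1) * xi)) = 1 - itv_hat 0 xi * (0 +i* xi) by rewrite h; ring.
ring.
Qed.

Lemma cosc_seed t : cosc phi0 1 t = cint mu (fun xi : measurableTypeR R => phi0 xi * cis (t * xi)).
Proof. by apply: cint_eq => xi; rewrite divr1 invr1 mul1r. Qed.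

Lemma cmeas_cis_kernel (t : R) :
  cmeas (fun z : measurableTypeR R * measurableTypeR R => cis ((t - z.2) * z.1)).
Proof.
apply: cmeas_cis; apply: measurable_funM; last exact: measurable_fst.
by apply: measurable_funB; [exact: measurable_cst|exact: measurable_snd].
Qed.

Lemma ind_itv_cintble z : cintble mu (fun y => (ind_itv z y)%:C).
Proof. exact: cintble_real (ind_itv_integrable z). Qed.

Lemma dyadic_hat_fubini k t :
  cint mu (fun xi : measurableTypeR R => dyadic phi0 k xi * itv_hat 0 xi * cis (t * xi)) =
  cint mu (fun y => (ind_itv 0 y)%:C *
    cint mu (fun xi : measurableTypeR R => dyadic phi0 k xi * cis ((t - y) * xi))).
Proof.
have e1 (z : measurableTypeR R * measurableTypeR R) :
    normc (cis ((t - z.2) * z.1) : R[i]) <= 1 by rewrite normc_cis.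
have [<- _ _] := @cfubini_kernel R _ _ _ _ mu mu (dyadic phi0 k)
  (fun y => (ind_itv 0 y)%:C) (fun z => cis ((t - z.2) * z.1))
  (dyadic_cintble k) (ind_itv_cintble 0) (cmeas_cis_kernel t) e1.
apply: cint_eq => xi; rewrite -mulrA; congr (_ * _).
rewrite -cintZr; last first.
  exact: cintble_le (cmeas_ind_cis 0 xi) (ind_itv_integrable 0) (normc_ind_cis 0 xi).
apply: cint_eq => y /=; rewrite -mulrA -cisD; congr (_ * cis _); ring.
Qed.

(** At level 0 the multiplier is 1 near the origin and cannot be divided by the frequency; the block
    is instead treated as the convolution of a smooth kernel with the interval. *)
Lemma alpha0 t : alpha 0 t = ((2 * pi)^-1)%:C *
  cint mu (fun y => (cell 0 1 y)%:C * cosc phi0 1 (t - y)).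
Proof.
have E : cint mu (fun y => (ind_itv 0 y)%:C *
    cint mu (fun xi : measurableTypeR R => dyadic phi0 0 xi * cis ((t - y) * xi))) =
    cint mu (fun y => (cell 0 1 y)%:C * cosc phi0 1 (t - y)).
  by rewrite ind_itv0_cell; apply: cint_eq => y; rewrite cosc_seed.
by rewrite /alpha dyadic_hat_fubini E.
Qed.

Definition omk3 k t : R := om (2 ^+ k * t) ^+ 3 + om (2 ^+ k * (t - 1)) ^+ 3.

Lemma omk3_ge0 k t : 0 <= omk3 k t.
Proof. by rewrite addr_ge0// exprn_ge0// om_ge0. Qed.

Lemma normc_pi : normc (((2 * pi)^-1)%:C : R[i]) <= 1.
Proof.
rewrite normc_real normfV gtr0_norm ?mulr_gt0 ?pi_gt0// invf_le1 ?mulr_gt0 ?pi_gt0//.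
have := @pi_ge2 R; lra.
Qed.

Lemma om3_near (u w : R) : `|u - w| <= 1 -> om u ^+ 3 <= 27 * om w ^+ 3.
Proof.
move=> /om_near h; have -> : 27 * om w ^+ 3 = (3 * om w) ^+ 3 by ring.
by rewrite lerXn2r ?nnegrE ?mulr_ge0 ?om_ge0.
Qed.

Lemma alpha_bounds : exists2 C, 0 <= C &
  (forall k t, normc (alpha k t) <= C * omk3 k t) /\
  (forall k t t', 2 ^+ k * `|t - t'| <= 1 ->
     normc (alpha k t - alpha k t') <= C * (2 ^+ k * `|t - t'|) * omk3 k t).
Proof.
have [C C0 [hC kC]] := cosc_om (chi_div_Re 6) (chi_div_Im 6) chi_div_supp.
have sup0 u : 2 < `|u| -> phi0 u = 0 by move=> hu; apply: seed_supp; lra.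
have [D D0 [hD kD]] := cosc_om (seed_Re 6) (seed_Im 6) sup0.
have dcont t : continuous (Re \o (fun y => cosc phi0 1 (t - y))) /\
    continuous (Im \o (fun y => cosc phi0 1 (t - y))).
  apply: (@locally_lipschitz_continuous _ _ D 1) => // y y' yy.
  have := kD 1 (t - y) (t - y') ltr01; rewrite !mul1r.
  rewrite (_ : t - y - (t - y') = - (y - y')); last by ring.
  rewrite normrN => /(_ yy) h; apply: le_trans h _.
  by rewrite ler_piMr ?mulr_ge0// exprn_ile1 ?om_ge0 ?om_le1.
have o3 (u : R) : 0 <= om u ^+ 3 by rewrite exprn_ge0// om_ge0.
(* [C] serves the positive levels. At level 0, [54 = 2 * 27], where 2 comes from [normc_cint_le] and
   27 from moving the argument of [om ^ 3] by at most 1. *)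
exists (C + 54 * D); first by rewrite addr_ge0// mulr_ge0.
split.
- case=> [|k] t.
  + rewrite alpha0 normcM.
    apply: le_trans (ler_wpM2r (normc_ge0 _) normc_pi) _; rewrite mul1r.
    have [c1 c2] := dcont t.
    apply: le_trans (@cell_cint_le _ 0 1 _ (27 * D * om t ^+ 3) c1 c2 _ _ _) _.
    * exact: ler01.
    * move=> y /andP[y0 y1]; apply: le_trans (hD 1 (t - y) ltr01) _.
      have -> : 27 * D * om t ^+ 3 = D * (27 * om t ^+ 3) by ring.
      rewrite mul1r ler_wpM2l//; apply: om3_near.
      by rewrite addrAC subrr add0r normrN gtr0_norm.
    * by rewrite mulr_ge0// mulr_ge0.
    rewrite subr0 mulr1 /omk3 expr0 !mul1r.
    have -> : 2 * (27 * D * om t ^+ 3) = 54 * D * om t ^+ 3 by ring.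
    apply: ler_pM; rewrite ?mulr_ge0 ?exprn_ge0 ?om_ge0 ?lerDl ?lerDr//.
  + rewrite alphaS normcM.
    apply: le_trans (ler_wpM2r (normc_ge0 _) normc_pi) _; rewrite mul1r.
    have l0 : (0 : R) < 2 ^+ k.+1 by rewrite exprn_gt0.
    apply: le_trans (normcB _ _) _.
    apply: le_trans (lerD (hC _ t l0) (hC _ (t - 1) l0)) _.
    by rewrite -mulrDr -/(omk3 k.+1 t) ler_wpM2r ?omk3_ge0// lerDl mulr_ge0.
- case=> [|k] t t' tt.
  + rewrite !alpha0 -mulrBr normcM.
    apply: le_trans (ler_wpM2r (normc_ge0 _) normc_pi) _; rewrite mul1r.
    have [c1 c2] := dcont t; have [c1' c2'] := dcont t'.
    rewrite expr0 mul1r in tt *.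
    have bd s y : 0 < y <= 1 -> normc (cosc phi0 1 (s - y)) <= D.
      move=> _; apply: le_trans (hD 1 (s - y) ltr01) _.
      by rewrite ler_piMr// exprn_ile1 ?om_ge0 ?om_le1.
    rewrite -cintB; [|exact: (cell_cintble c1 c2 (bd t) D0)|exact: (cell_cintble c1' c2' (bd t') D0)].
    under cint_eq do rewrite -mulrBr.
    apply: le_trans (@cell_cint_le _ 0 1 (fun y => cosc phi0 1 (t - y) - cosc phi0 1 (t' - y))
      (27 * D * `|t - t'| * om t ^+ 3) _ _ _ _ _) _.
    * have E y : Re (cosc phi0 1 (t - y) - cosc phi0 1 (t' - y)) =
         Re (cosc phi0 1 (t - y)) - Re (cosc phi0 1 (t' - y)).
        by case: (cosc _ _ _) (cosc _ _ _) => [? ?] [].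
      by rewrite /comp; under eq_fun do rewrite E; move=> y; exact: (cvgB (c1 y) (c1' y)).
    * have E y : Im (cosc phi0 1 (t - y) - cosc phi0 1 (t' - y)) =
         Im (cosc phi0 1 (t - y)) - Im (cosc phi0 1 (t' - y)).
        by case: (cosc _ _ _) (cosc _ _ _) => [? ?] [].
      by rewrite /comp; under eq_fun do rewrite E; move=> y; exact: (cvgB (c2 y) (c2' y)).
    * exact: ler01.
    * move=> y /andP[y0 y1].
      have := kD 1 (t - y) (t' - y) ltr01; rewrite !mul1r.
      rewrite (_ : t - y - (t' - y) = t - t'); last by ring.
      move=> /(_ tt) h; apply: le_trans h _.
      have h3 : om (t - y) ^+ 3 <= 27 * om t ^+ 3.
        by apply: om3_near; rewrite addrAC subrr add0r normrN gtr0_norm.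
      have -> : 27 * D * `|t - t'| * om t ^+ 3 = D * `|t - t'| * (27 * om t ^+ 3) by ring.
      by rewrite ler_wpM2l// mulr_ge0.
    * by rewrite mulr_ge0// mulr_ge0// mulr_ge0.
    rewrite subr0 mulr1 /omk3 expr0 !mul1r.
    have -> : 2 * (27 * D * `|t - t'| * om t ^+ 3) = 54 * D * `|t - t'| * om t ^+ 3 by ring.
    apply: ler_pM; rewrite ?mulr_ge0 ?exprn_ge0 ?om_ge0 ?lerDl//.
    by rewrite ler_wpM2r// lerDr.
  + rewrite !alphaS -mulrBr normcM.
    apply: le_trans (ler_wpM2r (normc_ge0 _) normc_pi) _; rewrite mul1r.
    have l0 : (0 : R) < 2 ^+ k.+1 by rewrite exprn_gt0.
    set L : R := 2 ^+ k.+1 in tt l0 *.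
    rewrite (_ : _ - _ - _ = (cosc chi_div L t - cosc chi_div L t') -
      (cosc chi_div L (t - 1) - cosc chi_div L (t' - 1))); last by ring.
    apply: le_trans (normcB _ _) _.
    have e1 : t - 1 - (t' - 1) = t - t' by ring.
    have h2 := kC L (t - 1) (t' - 1) l0; rewrite e1 in h2.
    apply: le_trans (lerD (kC _ t t' l0 tt) (h2 tt)) _.
    rewrite -mulrDr -/(omk3 k.+1 t) ler_wpM2r ?omk3_ge0//.
    by rewrite ler_wpM2r ?mulr_ge0 ?(ltW l0)// lerDl mulr_ge0.
Qed.

End alpha.

(** * The kernels relative to the weight, and their means over the unit interval *)

Section alpha_beta.
Context {R : realType}.
Local Notation mu := (@lebesgue_measure R).
Variable phi0 : R -> R[i].
Hypothesis seed : resolution_seed phi0.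
Local Notation alpha := (alpha phi0).

Definition omk k t : R := om (2 ^+ k * t) + om (2 ^+ k * (t - 1)).

Lemma omk_ge0 k t : 0 <= omk k t. Proof. by rewrite addr_ge0// om_ge0. Qed.

(** Two of the three factors are traded for a weight that no longer depends on [w] or [k]: dilation
    by [2 ^ k >= 1] decreases [om], and a shift by at most 2 costs 9, whose square is 81. *)
Lemma om3_le k (x w : R) : `|w| <= 2 ->
  om (2 ^+ k * (x - w)) ^+ 3 <= 81 * om x ^+ 2 * om (2 ^+ k * (x - w)).
Proof.
move=> hw; rewrite exprS mulrC ler_wpM2r ?om_ge0//.
have h : om (2 ^+ k * (x - w)) <= 9 * om x.
  apply: le_trans (om_shift x hw); apply: om_mono.
  rewrite normrM ger0_norm ?exprn_ge0// ler_peMl// exprn_ege1//.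
  by lra.
have -> : 81 * om x ^+ 2 = (9 * om x) ^+ 2 by ring.
by rewrite lerXn2r ?nnegrE ?mulr_ge0 ?om_ge0.
Qed.

Lemma omk3_le k (x z : R) : 0 <= z <= 1 ->
  omk3 k (x - z) <= 81 * om x ^+ 2 * omk k (x - z).
Proof.
move=> /andP[z0 z1]; rewrite /omk3 /omk [81 * _ * _]mulrDr lerD//.
  by apply: om3_le; rewrite ger0_norm//; lra.
rewrite (_ : x - z - 1 = x - (z + 1)); last by ring.
by apply: om3_le; rewrite ger0_norm//; lra.
Qed.

Lemma alpha_estimates : exists2 C, 0 <= C &
  (forall k x z, 0 <= z <= 1 ->
     normc (alpha k (x - z)) <= C * om x ^+ 2 * omk k (x - z)) /\
  (forall k x z z', 0 <= z <= 1 -> 2 ^+ k * `|z - z'| <= 1 ->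
     normc (alpha k (x - z) - alpha k (x - z')) <=
     C * (2 ^+ k * `|z - z'|) * om x ^+ 2 * omk k (x - z)).
Proof.
have [C C0 [hC kC]] := alpha_bounds seed.
exists (C * 81); first by rewrite mulr_ge0.
split=> [k x z z01|k x z z' z01 zz].
  apply: le_trans (hC _ _) _.
  have -> : C * 81 * om x ^+ 2 * omk k (x - z) = C * (81 * om x ^+ 2 * omk k (x - z)) by ring.
  by rewrite ler_wpM2l// omk3_le.
have e : x - z - (x - z') = - (z - z') by ring.
have := kC k (x - z) (x - z'); rewrite e normrN => /(_ zz) h.
apply: le_trans h _.
have -> : C * 81 * (2 ^+ k * `|z - z'|) * om x ^+ 2 * omk k (x - z) =
  C * (2 ^+ k * `|z - z'|) * (81 * om x ^+ 2 * omk k (x - z)) by ring.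
by rewrite ler_wpM2l ?mulr_ge0 ?exprn_ge0// omk3_le.
Qed.

Lemma alpha_lipschitz k : exists2 K, 0 <= K &
  forall t t', `|t - t'| <= 2 ^- k -> normc (alpha k t - alpha k t') <= K * `|t - t'|.
Proof.
have [C C0 [_ kC]] := alpha_bounds seed.
have p2 : (0 : R) < 2 ^+ k by rewrite exprn_gt0.
exists (C * 2 ^+ k * 2); first by rewrite !mulr_ge0// ltW.
move=> t t' tt; apply: le_trans (kC k t t' _) _.
  by rewrite mulrC -ler_pdivlMr// mul1r.
rewrite mulrA mulrAC ler_wpM2r// ler_wpM2l ?mulr_ge0 ?(ltW p2)//.
have h (u : R) : om u ^+ 3 <= 1 by rewrite exprn_ile1 ?om_ge0 ?om_le1.
by have := h (2 ^+ k * t); have := h (2 ^+ k * (t - 1)); rewrite /omk3; lra.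
Qed.

Lemma alpha_continuous k : continuous (Re \o alpha k) /\ continuous (Im \o alpha k).
Proof.
have [K K0 h] := alpha_lipschitz k.
by apply: (@locally_lipschitz_continuous _ _ K (2 ^- k)) h; rewrite invr_gt0 exprn_gt0.
Qed.

Lemma alpha_sub_continuous k x : continuous (Re \o (fun w => alpha k (x - w))) /\
  continuous (Im \o (fun w => alpha k (x - w))).
Proof.
have [K K0 h] := alpha_lipschitz k.
apply: (@locally_lipschitz_continuous _ _ K (2 ^- k)); first by rewrite invr_gt0 exprn_gt0.
move=> w w' ww.
have e : x - w - (x - w') = - (w - w') by ring.
by have := h (x - w) (x - w'); rewrite e normrN => /(_ ww).
Qed.

Lemma alpha_le k : exists2 K, 0 <= K & forall t, normc (alpha k t) <= K.
Proof.
have [C C0 [hC _]] := alpha_bounds seed.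
exists (C * 2); first by rewrite mulr_ge0.
move=> t; apply: le_trans (hC k t) _; rewrite ler_wpM2l//.
have h (u : R) : om u ^+ 3 <= 1 by rewrite exprn_ile1 ?om_ge0 ?om_le1.
by have := h (2 ^+ k * t); have := h (2 ^+ k * (t - 1)); rewrite /omk3; lra.
Qed.

(** [om_sum] with the step [h = 2 ^ k / M], at most 1, once for each of the two endpoints. *)
Lemma omk_sum k x (M : nat) : (2 ^ k <= M)%N ->
  \sum_(m < M) (2 ^+ k / M%:R) * omk k (x - m%:R / M%:R) <= 6 * pi.
Proof.
move=> kM; have M0 : (0 : R) < M%:R by rewrite ltr0n (leq_trans _ kM)// expn_gt0.
pose h : R := 2 ^+ k / M%:R.
have hh : 0 <= h <= 1.
  rewrite divr_ge0 ?exprn_ge0//= ler_pdivrMr// mul1r.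
  by rewrite (_ : 2 ^+ k = (2 ^ k)%:R) ?ler_nat// natrX.
rewrite -/h; under eq_bigr do rewrite /omk mulrDr.
rewrite big_split/=.
have -> : 6 * pi = 3 * pi + 3 * pi :> R by ring.
apply: lerD.
  have := om_sum (2 ^+ k * x) M hh; congr (_ <= _); apply: eq_bigr => m _.
  by congr (_ * om _); rewrite /h; ring.
have := om_sum (2 ^+ k * (x - 1)) M hh; congr (_ <= _); apply: eq_bigr => m _.
by congr (_ * om _); rewrite /h; ring.
Qed.

Definition beta k x : R[i] :=
  cint mu (fun w => (cell 0 1 w)%:C * alpha k (x - w)).

Lemma alpha_cell_cintble a c k x :
  cintble mu (fun w : measurableTypeR R => (cell a c w)%:C * alpha k (x - w)).
Proof.
have [K K0 hK] := alpha_le k; have [c1 c2] := alpha_sub_continuous k x.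
by apply: (cell_cintble c1 c2 _ K0).
Qed.

Lemma beta_continuous k : continuous (Re \o beta k) /\ continuous (Im \o beta k).
Proof.
have [K K0 h] := alpha_lipschitz k.
apply: (@locally_lipschitz_continuous _ _ (2 * K) (2 ^- k)); first by rewrite invr_gt0 exprn_gt0.
move=> x x' xx; rewrite /beta -cintB; try exact: alpha_cell_cintble.
have b w : normc ((cell 0 1 w)%:C * alpha k (x - w) - (cell 0 1 w)%:C * alpha k (x' - w))
    <= K * `|x - x'| * cell 0 1 w.
  rewrite -mulrBr normcM normc_real ger0_norm ?cell_ge0// mulrC ler_wpM2r ?cell_ge0//.
  have e : x - w - (x' - w) = x - x' by ring.
  by have := h (x - w) (x' - w); rewrite e => /(_ xx).
have i1 : cintble mu (fun w => (cell 0 1 w)%:C * alpha k (x - w) - (cell 0 1 w)%:C * alpha k (x' - w)).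
  apply: cintble_le (integrableZl measurableT _ (cell_integrable 0 1)) b.
  have h1 := cintble_meas (alpha_cell_cintble 0 1 k x).
  have h2 := cintble_meas (cintbleZ (-1) (alpha_cell_cintble 0 1 k x')).
  by have := cmeasD h1 h2; under eq_fun do rewrite mulN1r.
have := normc_cint_le i1 (integrableZl measurableT _ (cell_integrable 0 1)) b.
rewrite RintegralZl ?Rintegral_cell//; last exact: cell_integrable.
by rewrite subr0 mulr1 mulrA.
Qed.

(** The error of a Riemann sum, cell by cell. The Lipschitz constant is of order [2 ^ k], but the
    increments are concentrated near two points at scale [2 ^- k], and by [omk_sum] the two effects
    cancel: the error is [C / M] uniformly in [k]. *)
Lemma beta_approx : exists2 C, 0 <= C & forall k x (M : nat), (2 ^ k <= M)%N ->
  normc (beta k x - (M%:R^-1)%:C * \sum_(m < M) alpha k (x - m%:R / M%:R)) <=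
  C / M%:R * om x ^+ 2.
Proof.
have [C C0 [_ kC]] := alpha_estimates.
exists (2 * C * (6 * pi)); first by rewrite !mulr_ge0// pi_ge0.
move=> k x M kM.
have M0' : (0 < M)%N by rewrite (leq_trans _ kM)// expn_gt0.
have M0 : (0 : R) < M%:R by rewrite ltr0n.
have p2M : (2 ^+ k / M%:R : R) <= 1.
  by rewrite ler_pdivrMr// mul1r (_ : 2 ^+ k = (2 ^ k)%:R) ?ler_nat// natrX.
pose A m : R := m%:R / M%:R.
have A1 m : A m.+1 - A m = M%:R^-1 by rewrite /A -mulrBl -natrB// subSnn mul1r.
have AA m : A m <= A m.+1 by rewrite -subr_ge0 A1 invr_ge0 ltW.
have icst m (c : R[i]) : cintble mu (fun w => (cell (A m) (A m.+1) w)%:C * c).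
  have := cintbleZ c (cintble_real (cell_integrable (A m) (A m.+1))).
  by under eq_fun do rewrite mulrC.
have -> : beta k x - (M%:R^-1)%:C * \sum_(m < M) alpha k (x - m%:R / M%:R) =
    \sum_(m < M) cint mu (fun w => (cell (A m) (A m.+1) w)%:C * (alpha k (x - w) - alpha k (x - A m))).
  transitivity (\sum_(m < M) (cint mu (fun w => (cell (A m) (A m.+1) w)%:C * alpha k (x - w)) -
     cint mu (fun w => (cell (A m) (A m.+1) w)%:C * alpha k (x - A m)))).
    rewrite sumrB; congr (_ - _).
      rewrite -cint_sum; last by move=> m; exact: alpha_cell_cintble.
      by apply: cint_eq => w; rewrite -mulr_suml (cell_sum w M0') rmorph_sum.
    rewrite mulr_sumr; apply: eq_bigr => m _.
    rewrite cintZr; last exact: cintble_real (cell_integrable _ _).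
    by rewrite cint_real Rintegral_cell// A1.
  apply: eq_bigr => m _; rewrite -cintB//; last exact: alpha_cell_cintble.
  by apply: cint_eq => w; rewrite mulrBr.
apply: le_trans (normc_sum _ _ _) _.
apply: (@le_trans _ _ (\sum_(m < M) (2 * C * om x ^+ 2 / M%:R) * (2 ^+ k / M%:R * omk k (x - m%:R / M%:R)))).
  apply: ler_sum => m _.
  have m01 : 0 <= A m <= 1.
    by rewrite /A divr_ge0//= ler_pdivrMr// mul1r ler_nat ltnW.
  have b w : A m < w <= A m.+1 -> normc (alpha k (x - w) - alpha k (x - A m)) <=
      C * (2 ^+ k / M%:R) * om x ^+ 2 * omk k (x - A m).
    move=> /andP[w1 w2]; rewrite normcBC.
    have wM : `|A m - w| <= M%:R^-1.
      by rewrite distrC gtr0_norm ?subr_gt0// -(A1 m) lerD2r.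
    have kw : 2 ^+ k * `|A m - w| <= 2 ^+ k / M%:R by rewrite ler_wpM2l ?exprn_ge0.
    apply: le_trans (kC k x (A m) w m01 (le_trans kw p2M)) _.
    by rewrite ler_wpM2r ?omk_ge0// ler_wpM2r ?exprn_ge0 ?om_ge0// ler_wpM2l.
  have B0 : 0 <= C * (2 ^+ k / M%:R) * om x ^+ 2 * omk k (x - A m).
    by rewrite mulr_ge0 ?omk_ge0// mulr_ge0 ?exprn_ge0 ?om_ge0// mulr_ge0// divr_ge0// exprn_ge0.
  have [c1 c2] := alpha_sub_continuous k x.
  apply: le_trans (@cell_cint_le _ (A m) (A m.+1) (fun w => alpha k (x - w) - alpha k (x - A m)) _ _ _ (AA m) b B0) _.
  - have E w : Re (alpha k (x - w) - alpha k (x - A m)) = Re (alpha k (x - w)) - Re (alpha k (x - A m)).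
      by rewrite ReD; case: (alpha _ (x - A m)).
    by rewrite /comp; under eq_fun do rewrite E; move=> w; apply: cvgB; [exact: c1|exact: cst_continuous].
  - have E w : Im (alpha k (x - w) - alpha k (x - A m)) = Im (alpha k (x - w)) - Im (alpha k (x - A m)).
      by rewrite ImD; case: (alpha _ (x - A m)).
    by rewrite /comp; under eq_fun do rewrite E; move=> w; apply: cvgB; [exact: c2|exact: cst_continuous].
  by rewrite A1 -/(A m) le_eqVlt; apply/orP; left; apply/eqP; ring.
rewrite -mulr_sumr.
have -> : 2 * C * (6 * pi) / M%:R * om x ^+ 2 = 2 * C * om x ^+ 2 / M%:R * (6 * pi) by ring.
rewrite ler_wpM2l ?omk_sum// mulr_ge0 ?invr_ge0 ?(ltW M0)// mulr_ge0 ?exprn_ge0 ?om_ge0// mulr_ge0//.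
Qed.

End alpha_beta.

(** * Dyadic blocks of integrable functions *)

Section bandpass.
Context {R : realType} {d : nat}.
Local Notation Rd := 'rV[R]_d.
Local Notation T := (d.-tuple (measurableTypeR R)).
Local Notation mu := (lebesgue_tuple R d).
Local Notation mu1 := (@lebesgue_measure R).

Lemma eq_cintble (dX : measure_display) (X : measurableType dX)
    (m : {measure set X -> \bar R}) (f g : X -> R[i]) :
  f =1 g -> cintble m f -> cintble m g.
Proof. by move=> /funext ->. Qed.

Lemma dotC (x y : Rd) : dot x y = dot y x.
Proof. by apply: eq_bigr => i _; rewrite mulrC. Qed.

Lemma cmeas_cis_dot (s : R) :
  cmeas (fun z : T * T => cis (s * dot (vec_of z.2) (vec_of z.1)) : R[i]).
Proof.
apply: cmeas_cis; apply: measurable_funM; first exact: measurable_cst.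
rewrite /dot; under eq_fun do under eq_bigr do rewrite !vec_ofE.
apply: measurable_sum => i; apply: measurable_funM.
  exact: (measurableT_comp (measurable_tnth i) measurable_snd).
exact: (measurableT_comp (measurable_tnth i) measurable_fst).
Qed.

(** Fourier integral without normalisation, forward for [s = -1] and inverse for [s = 1], so that
    one multiplication formula covers both. *)
Definition tr (s : R) (b : Rd -> R[i]) (xi : Rd) : R[i] :=
  cint mu (fun y : T => b (vec_of y) * cis (s * dot (vec_of y) xi)).

Lemma tr_fubini s (a b : Rd -> R[i]) :
  cintble mu (fun x : T => a (vec_of x)) ->
  cintble mu (fun x : T => b (vec_of x)) ->
  cint mu (fun x : T => a (vec_of x) * tr s b (vec_of x)) =
  cint mu (fun y : T => b (vec_of y) * tr s a (vec_of y)) /\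
  cintble mu (fun x : T => a (vec_of x) * tr s b (vec_of x)).
Proof.
move=> ia ib.
have le1 (z : T * T) : normc (cis (s * dot (vec_of z.2) (vec_of z.1)) : R[i]) <= 1.
  by rewrite normc_cis.
have [E I _] := cfubini_kernel ia ib (cmeas_cis_dot s) le1.
split; last exact: I.
rewrite E; apply: cint_eq => y; congr (_ * _).
by apply: cint_eq => x; rewrite dotC.
Qed.

Definition fourier_cst : R[i] := ((2 * pi) `^ (- (d%:R / 2)))%:C.

Lemma fourierE (f : Rd -> R[i]) xi : fourier f xi = fourier_cst * tr (-1) f xi.
Proof.
rewrite /fourier Cintegral_setT; congr (_ * _); apply: cint_eq => x.
by rewrite mulN1r.
Qed.

Lemma inv_fourierE (f : Rd -> R[i]) xi : inv_fourier f xi = fourier_cst * tr 1 f xi.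
Proof.
rewrite /inv_fourier Cintegral_setT; congr (_ * _); apply: cint_eq => x.
by rewrite mul1r dotC.
Qed.

Lemma tr_scale s (c : R[i]) (h : Rd -> R[i]) xi :
  cintble mu (fun x : T => h (vec_of x)) ->
  tr s (fun y => c * h y) xi = c * tr s h xi.
Proof.
move=> ih; rewrite /tr -cintZ; last first.
  have [A iA gA] := cintble_norm ih.
  apply: cintble_le iA _.
    apply: cmeasM; first exact: cintble_meas ih.
    apply: cmeas_cis; apply: measurable_funM; first exact: measurable_cst.
    rewrite /dot; under eq_fun do under eq_bigr do rewrite vec_ofE.
    apply: measurable_sum => j; apply: measurable_funM; last exact: measurable_cst.
    exact: measurable_tnth.
  by move=> y; rewrite normcM normc_cis mulr1.
by apply: cint_eq => y; rewrite mulrA.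
Qed.

Lemma mulr_swap4 (c u w : R[i]) : c * c * u * w = c * c * (w * u).
Proof. by rewrite [w * u]mulrC mulrA. Qed.

Lemma mulr_swap3 (c u w : R[i]) : w * (c * (c * u)) = c * c * (w * u).
Proof. by rewrite [c * (c * u)]mulrA mulrCA. Qed.

(** Two uses of the multiplication formula [tr_fubini], with the signs -1 and 1, move the whole
    operator from the test function [psi] to [g]. *)
Lemma bandpass_duality (c : R[i]) (phi g psi : Rd -> R[i]) :
  cintble mu (fun x : T => phi (vec_of x)) ->
  cintble mu (fun x : T => g (vec_of x)) ->
  cintble mu (fun x : T => psi (vec_of x)) ->
  cint mu (fun x : T => g (vec_of x) *
    (c * tr (-1) (fun xi => c * (phi xi * tr 1 psi xi)) (vec_of x))) =
  cint mu (fun x : T =>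
    (c * c * tr 1 (fun xi => phi xi * tr (-1) g xi) (vec_of x)) * psi (vec_of x)) /\
  cintble mu (fun x : T =>
    (c * c * tr 1 (fun xi => phi xi * tr (-1) g xi) (vec_of x)) * psi (vec_of x)).
Proof.
move=> iphi ig ipsi.
have [_ I1] := tr_fubini 1 iphi ipsi.
have [_ I3] := tr_fubini (-1) iphi ig.
have -> : (fun x : T => c * c * tr 1 (fun xi => phi xi * tr (-1) g xi) (vec_of x) * psi (vec_of x)) =
    (fun x : T => c * c * (psi (vec_of x) * tr 1 (fun xi => phi xi * tr (-1) g xi) (vec_of x))).
  by apply/funext => x; exact: mulr_swap4.
have -> : (fun x : T => g (vec_of x) *
      (c * tr (-1) (fun xi => c * (phi xi * tr 1 psi xi)) (vec_of x))) =
    (fun x : T => c * c * (g (vec_of x) * tr (-1) (fun xi => phi xi * tr 1 psi xi) (vec_of x))).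
  by apply/funext => x; rewrite (tr_scale _ _ _ I1); exact: mulr_swap3.
have E5 : cint mu (fun y : T => phi (vec_of y) * tr 1 psi (vec_of y) * tr (-1) g (vec_of y)) =
    cint mu (fun y : T => phi (vec_of y) * tr (-1) g (vec_of y) * tr 1 psi (vec_of y)).
  by apply: cint_eq => x; exact: mulrAC.
have [E2 I2] := @tr_fubini (-1) g (fun xi => phi xi * tr 1 psi xi) ig I1.
have [E4 I4] := @tr_fubini 1 psi (fun xi => phi xi * tr (-1) g xi) ipsi I3.
split; last exact: cintbleZ.
exact (etrans (cintZ (c * c) I2) (etrans (congr1 (fun u => c * c * u)
  (etrans E2 (etrans E5 (esym E4)))) (esym (cintZ (c * c) I4)))).
Qed.

Definition bandpass (phi g : Rd -> R[i]) (x : Rd) : R[i] :=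
  fourier_cst * fourier_cst * tr 1 (fun xi => phi xi * tr (-1) g xi) x.

Lemma bandpass_represents (phi g : Rd -> R[i]) :
  cintble mu (fun x : T => phi (vec_of x)) ->
  cintble mu (fun x : T => g (vec_of x)) ->
  represents (bandpass phi g)
    (dist_inv_fourier (dist_mul phi (dist_fourier (function_distribution g)))).
Proof.
move=> iphi ig psi spsi.
have [E I] := bandpass_duality fourier_cst iphi ig (schwartz_cintble spsi).
split; first exact: I.
rewrite /dist_inv_fourier /dist_mul /dist_fourier /function_distribution !Cintegral_setT.
have -> : (fun xi => phi xi * inv_fourier psi xi) =
    (fun xi => fourier_cst * (phi xi * tr 1 psi xi)).
  by apply/funext => xi; rewrite inv_fourierE mulrCA.
apply: etrans E; apply: cint_eq => x; congr (_ * _).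
exact: fourierE.
Qed.

Lemma tr_linear s (I : finType) (c : I -> R[i]) (g : I -> Rd -> R[i]) xi :
  (forall i, cintble mu (fun x : T => g i (vec_of x))) ->
  tr s (fun y => \sum_i c i * g i y) xi = \sum_i c i * tr s (g i) xi.
Proof.
move=> ig.
have ic i : cintble mu (fun y : T => g i (vec_of y) * cis (s * dot (vec_of y) xi)).
  have [A iA gA] := cintble_norm (ig i).
  apply: cintble_le iA _.
    apply: cmeasM; first exact: cintble_meas (ig i).
    apply: cmeas_cis; apply: measurable_funM; first exact: measurable_cst.
    rewrite /dot; under eq_fun do under eq_bigr do rewrite vec_ofE.
    apply: measurable_sum => j; apply: measurable_funM; last exact: measurable_cst.
    exact: measurable_tnth.
  by move=> y; rewrite normcM normc_cis mulr1.
rewrite /tr -(eq_bigr _ (fun i _ => cintZ (c i) (ic i))) -cint_sum; last first.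
  by move=> i; exact: cintbleZ.
apply: cint_eq => y; rewrite mulr_suml; apply: eq_bigr => i _.
by rewrite mulrA.
Qed.

Lemma bandpass_linear (phi : Rd -> R[i]) (I : finType) (c : I -> R[i]) (g : I -> Rd -> R[i]) x :
  cintble mu (fun x : T => phi (vec_of x)) ->
  (forall i, cintble mu (fun x : T => g i (vec_of x))) ->
  bandpass phi (fun y => \sum_i c i * g i y) x = \sum_i c i * bandpass phi (g i) x.
Proof.
move=> iphi ig; rewrite /bandpass.
have -> : (fun xi => phi xi * tr (-1) (fun y => \sum_i c i * g i y) xi) =
   (fun xi => \sum_i c i * (phi xi * tr (-1) (g i) xi)).
  apply/funext => xi; rewrite tr_linear// mulr_sumr; apply: eq_bigr => i _.
  by rewrite mulrCA.
rewrite tr_linear; last by move=> i; have [_] := tr_fubini (-1) iphi (ig i).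
by rewrite mulr_sumr; apply: eq_bigr => i _; rewrite mulrCA.
Qed.

Definition hat1 (u : R -> R[i]) (xi : R) : R[i] :=
  cint mu1 (fun y : measurableTypeR R => u y * cis (- (y * xi))).

Definition bandpass1 (phi u : R -> R[i]) (x : R) : R[i] :=
  ((2 * pi)^-1)%:C * cint mu1 (fun xi : measurableTypeR R => phi xi * hat1 u xi * cis (x * xi)).

Lemma cis_sum (I : finType) (f : I -> R) : cis (\sum_i f i) = \prod_i cis (f i) :> R[i].
Proof. exact: (big_morph _ (@cisD R) (@cis0 R)). Qed.

Lemma cmeas_cis_mul (x : R) : cmeas (fun y : measurableTypeR R => cis (x * y) : R[i]).
Proof. by apply: cmeas_cis; apply: measurable_funM => //; exact: measurable_cst. Qed.

Lemma phi_hat1_cintble (phi u : R -> R[i]) :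
  @cintble _ (measurableTypeR R) R mu1 phi -> @cintble _ (measurableTypeR R) R mu1 u ->
  cintble mu1 (fun xi : measurableTypeR R => phi xi * hat1 u xi).
Proof.
move=> iphi iu.
have me : cmeas (fun z : measurableTypeR R * measurableTypeR R => cis (- (z.2 * z.1)) : R[i]).
  apply: cmeas_cis; apply: measurableT_comp => //.
  by apply: measurable_funM; [exact: measurable_snd|exact: measurable_fst].
have le1 (z : measurableTypeR R * measurableTypeR R) : normc (cis (- (z.2 * z.1)) : R[i]) <= 1.
  by rewrite normc_cis.
by have [] := cfubini_kernel iphi iu me le1.
Qed.

Lemma fourier_cst_sqr : fourier_cst * fourier_cst = \prod_(i < d) ((2 * pi)^-1)%:C :> R[i].
Proof.
rewrite prodr_const card_ord -rmorphM -rmorphXn; congr (_%:C).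
rewrite -powRD; last by rewrite (gt_eqF (mulr_gt0 _ (pi_gt0 R)))// implybT.
rewrite -opprD -splitr powRN powR_mulrn ?exprVn//.
by rewrite mulr_ge0// pi_ge0.
Qed.

(** The character of an inner product is a product of characters, so [tensor_cint] factors first the
    forward and then the inverse transform. The two factors [fourier_cst] amount to one
    [(2 * pi)^-1] per coordinate. *)
Lemma bandpass_tensor (phi u : 'I_d -> R -> R[i]) x :
  (forall i, @cintble _ (measurableTypeR R) R mu1 (phi i)) ->
  (forall i, @cintble _ (measurableTypeR R) R mu1 (u i)) ->
  bandpass (fun xi => \prod_i phi i (xi 0 i)) (fun y => \prod_i u i (y 0 i)) x =
  \prod_i bandpass1 (phi i) (u i) (x 0 i).
Proof.
move=> iphi iu; rewrite /bandpass fourier_cst_sqr [RHS]big_split/=.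
have cis_cintble (f : R -> R[i]) (s : R) : @cintble _ (measurableTypeR R) R mu1 f ->
    cintble mu1 (fun y : measurableTypeR R => f y * cis (s * y)).
  move=> If; have [A iA fA] := cintble_norm If.
  apply: cintble_le iA _; last by move=> y; rewrite normcM normc_cis mulr1.
  by apply: cmeasM; [exact: cintble_meas If|exact: cmeas_cis_mul].
have E1 (xi : T) : tr (-1) (fun y => \prod_i u i (y 0 i)) (vec_of xi) =
    \prod_i hat1 (u i) (tnth xi i).
  have iu' i : cintble mu1 (fun y : measurableTypeR R => u i y * cis (- (y * tnth xi i))).
    by apply: eq_cintble (cis_cintble (u i) (- tnth xi i) (iu i)) => y; rewrite mulNr [tnth xi i * y]mulrC.
  have [_ <-] := tensor_cint iu'.
  apply: cint_eq => y; rewrite big_split/=; congr (_ * _).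
    by apply: eq_bigr => i _; rewrite vec_ofE.
  rewrite -cis_sum; congr cis; rewrite mulN1r /dot -sumrN; apply: eq_bigr => i _.
  by rewrite !vec_ofE.
have ih i : cintble mu1 (fun xi : measurableTypeR R => phi i xi * hat1 (u i) xi * cis (x 0 i * xi)).
  exact: (cis_cintble _ _ (phi_hat1_cintble (iphi i) (iu i))).
have [_ E2] := tensor_cint ih.
rewrite -E2; congr (_ * _).
apply: cint_eq => xi; rewrite E1 -big_split/= [RHS]big_split/=; congr (_ * _).
  by apply: eq_bigr => i _; rewrite vec_ofE.
rewrite -cis_sum; congr cis; rewrite mul1r /dot; apply: eq_bigr => i _.
by rewrite vec_ofE mulrC.
Qed.

End bandpass.

(** * One-dimensional factors of the extension *)

Section extension.
Context {R : realType}.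
Local Notation mu1 := (@lebesgue_measure R).
Local Notation T1 := (measurableTypeR R).

(* The convolution of the indicator of ]0, 1] with itself, cut off at 2: it
   extends the function [y] on ]0, 1[. *)
Definition tri (y : R) : R[i] := (cell 0 2 y)%:C *
  cint mu1 (fun w : T1 => (cell 0 1 w)%:C * (cell 0 1 (y - w))%:C).

Lemma cmeas_cell_sub :
  cmeas (fun z : T1 * T1 => (cell 0 1 (z.1 - z.2))%:C : R[i]).
Proof.
apply: cmeas_real; rewrite /cell; apply: measurableT_comp.
  by apply: measurable_indic; exact: measurable_itv.
by apply: measurable_funB; [exact: measurable_fst|exact: measurable_snd].
Qed.

Lemma normc_cell_sub (z : T1 * T1) : normc ((cell 0 1 (z.1 - z.2))%:C : R[i]) <= 1.
Proof. by rewrite normc_real cellE normr_nat; case: (_ && _). Qed.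

Lemma cell_cintbleC (a c : R) : cintble mu1 (fun w : T1 => (cell a c w)%:C).
Proof. exact/cintble_real/cell_integrable. Qed.

(** The factor [cell 0 2 y] is the integrable amplitude in [y] that [cfubini_kernel] asks for. *)
Lemma tri_cintble : @cintble _ T1 R mu1 tri.
Proof.
by have [] := cfubini_kernel (cell_cintbleC 0 2) (cell_cintbleC 0 1)
  cmeas_cell_sub normc_cell_sub.
Qed.

Lemma tri_itv (y w : R) : 0 < y < 1 ->
  (0 < w <= 1) && (0 < y - w <= 1) = (0 < w < y).
Proof. by move=> h; apply/idP/idP => ?; lra. Qed.

Lemma itv_unit (z x : R) : 0 <= z < 1 -> 0 < x < 1 ->
  (z < x <= z + 1) = (0 <= z < x).
Proof. by move=> h1 h2; apply/idP/idP => ?; lra. Qed.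

Lemma tri_itv2 (y w : R) : 0 < w <= 1 ->
  (0 < y <= 2) && (0 < y - w <= 1) = (w < y <= w + 1).
Proof. by move=> h; apply/idP/idP => ?; lra. Qed.

Lemma triE (y : R) : 0 < y < 1 -> tri y = y%:C.
Proof.
move=> y01; have /andP[y0 y1] := y01; rewrite /tri cellE y0 (ltW (lt_trans y1 _)) ?ltr1n// mul1r.
have -> : (fun w : T1 => (cell 0 1 w)%:C * (cell 0 1 (y - w))%:C) =
    (fun w : T1 => (\1_(`]0, y[%classic : set T1) w : R)%:C).
  apply/funext => w; rewrite -rmorphM/= !cellE indicE mem_setE -natrM mulnb.
  by rewrite tri_itv// in_itv.
rewrite cint_real; congr (_%:C).
rewrite /Rintegral integral_indic//= setIT lebesgue_measure_itv/= lte_fin y0.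
by rewrite oppr0 addr0.
Qed.

Lemma hat1_ind (z xi : R) : hat1 (fun y => (ind_itv z y)%:C) xi = itv_hat z xi.
Proof. by []. Qed.

(** The convolution theorem: for fixed [w] the integral over [y] is the transform of []w, w + 1]], a
    modulation of [itv_hat 0]. The second transform is left as an integral over [w], which becomes
    the mean over [w] in [beta]. *)
Lemma hat1_tri (xi : R) : hat1 tri xi =
  itv_hat 0 xi * cint mu1 (fun w : T1 => (cell 0 1 w)%:C * cis (- (w * xi))).
Proof.
have ia : cintble mu1 (fun y : T1 => (cell 0 2 y)%:C * cis (- (y * xi))).
  apply: cintble_le (cell_integrable 0 2) _ => [|y].
    apply: cmeasM; first exact: cintble_meas (cell_cintbleC 0 2).
    apply: cmeas_cis; apply: measurableT_comp => //.
    by apply: measurable_funM => //; exact: measurable_cst.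
  by rewrite normcM normc_cis mulr1 normc_real ger0_norm// cell_ge0.
have -> : hat1 tri xi = cint mu1 (fun w : T1 => (cell 0 1 w)%:C *
    cint mu1 (fun y : T1 => (cell 0 2 y)%:C * cis (- (y * xi)) * (cell 0 1 (y - w))%:C)).
  have [<- _ _] := cfubini_kernel ia (cell_cintbleC 0 1) cmeas_cell_sub normc_cell_sub.
  by apply: cint_eq => y; rewrite /tri -!mulrA [cis _ * _]mulrC.
have ic : cintble mu1 (fun w : T1 => (cell 0 1 w)%:C * cis (- (w * xi))).
  apply: cintble_le (cell_integrable 0 1) _ => [|y].
    apply: cmeasM; first exact: cintble_meas (cell_cintbleC 0 1).
    apply: cmeas_cis; apply: measurableT_comp => //.
    by apply: measurable_funM => //; exact: measurable_cst.
  by rewrite normcM normc_cis mulr1 normc_real ger0_norm// cell_ge0.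
rewrite -cintZ//; apply: cint_eq => w.
have [w01|w01] := boolP (0 < w <= 1); last first.
  by rewrite cellE (negbTE w01) !mul0r mulr0.
have -> : cint mu1 (fun y : T1 => (cell 0 2 y)%:C * cis (- (y * xi)) * (cell 0 1 (y - w))%:C) =
    itv_hat w xi.
  apply: cint_eq => y; rewrite mulrAC -rmorphM/=; congr (_%:C * _).
  by rewrite !cellE ind_itvE -natrM mulnb tri_itv2.
by rewrite itv_hat_shift [RHS]mulrC -mulrA.
Qed.

Variable phi0 : R -> R[i].
Hypothesis seed : resolution_seed phi0.

Lemma bandpass1_ind k (z x : R) :
  bandpass1 (dyadic phi0 k) (fun y => (ind_itv z y)%:C) x = alpha phi0 k (x - z).
Proof.
rewrite /bandpass1 /alpha; congr (_ * _); apply: cint_eq => xi.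
rewrite hat1_ind itv_hat_shift mulrBl cisD -!mulrA; congr (_ * _).
by rewrite mulrCA [cis (x * xi) * _]mulrC.
Qed.

Lemma bandpass1_tri k (x : R) : bandpass1 (dyadic phi0 k) tri x = beta phi0 k x.
Proof.
have ia : cintble mu1 (fun xi : T1 => dyadic phi0 k xi * itv_hat 0 xi).
  exact: phi_hat1_cintble (dyadic_cintble seed k) (ind_itv_cintble 0).
have me : cmeas (fun z : T1 * T1 => cis ((x - z.2) * z.1) : R[i]).
  exact: cmeas_cis_kernel.
have le1 (z : T1 * T1) : normc (cis ((x - z.2) * z.1) : R[i]) <= 1.
  by rewrite normc_cis.
rewrite /bandpass1.
have -> : cint mu1 (fun xi : T1 => dyadic phi0 k xi * hat1 tri xi * cis (x * xi)) =
    cint mu1 (fun w : T1 => (cell 0 1 w)%:C *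
      cint mu1 (fun xi : T1 => dyadic phi0 k xi * itv_hat 0 xi * cis ((x - w) * xi))).
  have [<- _ _] := cfubini_kernel ia (cell_cintbleC 0 1) me le1.
  apply: cint_eq => xi; rewrite hat1_tri !mulrA -!mulrA; congr (_ * (_ * _)).
  rewrite mulrC -cintZ; last first.
    apply: cintble_le (cell_integrable 0 1) _ => [|y].
      apply: cmeasM; first exact: cintble_meas (cell_cintbleC 0 1).
      apply: cmeas_cis; apply: measurableT_comp => //.
      by apply: measurable_funM => //; exact: measurable_cst.
    by rewrite normcM normc_cis mulr1 normc_real ger0_norm// cell_ge0.
  apply: cint_eq => w; rewrite mulrCA -cisD; congr (_ * cis _).
  by rewrite mulrBl.
have [_ _ I3] := cfubini_kernel ia (cell_cintbleC 0 1) me le1.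
rewrite -cintZ//; apply: cint_eq => w.
by rewrite mulrCA.
Qed.

End extension.

Lemma continuous_shift {R : realType} (f : R -> R) (a : R) :
  continuous f -> continuous (fun x : R => f (x - a)).
Proof.
move=> cf x; apply: (@continuous_comp R R R (fun x : R => x - a) f); last exact: cf.
by apply: cvgB; [exact: cvg_id|exact: cst_continuous].
Qed.

Section Ccontinuous.
Context {R : realType} {d : nat}.
Local Notation Rd := 'rV[R]_d.

Lemma Ccontinuous_cst (c : R[i]) : Ccontinuous (fun _ : Rd => c).
Proof. by split => x; exact: cst_continuous. Qed.

Lemma CcontinuousD (f g : Rd -> R[i]) :
  Ccontinuous f -> Ccontinuous g -> Ccontinuous (fun x => f x + g x).
Proof.
move=> [f1 f2] [g1 g2]; split => x.
  have -> : Re \o (fun x => f x + g x) = (Re \o f) \+ (Re \o g).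
    by apply/funext => y /=; rewrite ReD.
  by apply: continuousD; [exact: f1|exact: g1].
have -> : Im \o (fun x => f x + g x) = (Im \o f) \+ (Im \o g).
  by apply/funext => y /=; rewrite ImD.
by apply: continuousD; [exact: f2|exact: g2].
Qed.

Lemma CcontinuousM (f g : Rd -> R[i]) :
  Ccontinuous f -> Ccontinuous g -> Ccontinuous (fun x => f x * g x).
Proof.
move=> [f1 f2] [g1 g2]; split => x.
  have -> : Re \o (fun x => f x * g x) =
      ((Re \o f) \* (Re \o g)) \- ((Im \o f) \* (Im \o g)).
    by apply/funext => y; rewrite [LHS]ReM.
  by apply: continuousB; apply: continuousM; solve [exact: f1|exact: g1|exact: f2|exact: g2].
have -> : Im \o (fun x => f x * g x) =
    ((Re \o f) \* (Im \o g)) \+ ((Im \o f) \* (Re \o g)).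
  by apply/funext => y; rewrite [LHS]ImM.
by apply: continuousD; apply: continuousM; solve [exact: f1|exact: g1|exact: f2|exact: g2].
Qed.

Lemma Ccontinuous_sum (I : finType) (F : I -> Rd -> R[i]) :
  (forall i, Ccontinuous (F i)) -> Ccontinuous (fun x => \sum_i F i x).
Proof.
move=> cF; suff h s : Ccontinuous (fun x => \sum_(i <- s) F i x) by exact: h.
elim: s => [|i s ih].
  have -> : (fun x => \sum_(i <- [::]) F i x) = fun=> 0.
    by apply/funext => x; rewrite big_nil.
  exact: Ccontinuous_cst.
have -> : (fun x => \sum_(i <- i :: s) F i x) = fun x => F i x + \sum_(i <- s) F i x.
  by apply/funext => x; rewrite big_cons.
exact: CcontinuousD.
Qed.

Lemma Ccontinuous_prod (I : finType) (F : I -> Rd -> R[i]) :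
  (forall i, Ccontinuous (F i)) -> Ccontinuous (fun x => \prod_i F i x).
Proof.
move=> cF; suff h s : Ccontinuous (fun x => \prod_(i <- s) F i x) by exact: h.
elim: s => [|i s ih].
  have -> : (fun x => \prod_(i <- [::]) F i x) = fun=> 1.
    by apply/funext => x; rewrite big_nil.
  exact: Ccontinuous_cst.
have -> : (fun x => \prod_(i <- i :: s) F i x) = fun x => F i x * \prod_(i <- s) F i x.
  by apply/funext => x; rewrite big_cons.
exact: CcontinuousM.
Qed.

Lemma Ccontinuous_coord (f : R -> R[i]) (i : 'I_d) :
  continuous (Re \o f) /\ continuous (Im \o f) ->
  Ccontinuous (fun x : Rd => f (x 0 i)).
Proof.
move=> [c1 c2]; split => x.
  by apply: (@continuous_comp Rd R R (fun x : Rd => x 0 i) (Re \o f)); [exact: coord_continuous|exact: c1].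
by apply: (@continuous_comp Rd R R (fun x : Rd => x 0 i) (Im \o f)); [exact: coord_continuous|exact: c2].
Qed.

End Ccontinuous.

(** * Blocks of the extended discrepancy function *)

Section net_extension.
Context {R : realType} {d : nat}.
Variable phi0 : R -> R[i].
Hypothesis seed : resolution_seed phi0.
Local Notation Rd := 'rV[R]_d.
Local Notation T := (d.-tuple (measurableTypeR R)).
Local Notation mu := (lebesgue_tuple R d).
Variables (N : nat) (z : 'I_N -> Rd).
Hypothesis z01 : forall nu i, 0 <= z nu 0 i < 1.

(** [None] stands for the volume term and [Some nu] for a point of the net, so that linearity is
    applied to a single finite sum of tensor products. *)
Let c (o : option 'I_N) : R[i] := if o is Some _ then (N%:R^-1)%:C else -1.
Let u (o : option 'I_N) (i : 'I_d) (y : R) : R[i] :=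
  if o is Some nu then (ind_itv (z nu 0 i) y)%:C else tri y.
Let fac (k : {ffun 'I_d -> nat}) (o : option 'I_N) (i : 'I_d) (x : R) : R[i] :=
  if o is Some nu then alpha phi0 (k i) (x - z nu 0 i) else beta phi0 (k i) x.

Definition extension (y : Rd) : R[i] := \sum_o c o * \prod_i u o i (y 0 i).

Let u_cintble o i : @cintble _ (measurableTypeR R) R (@lebesgue_measure R) (u o i).
Proof.
case: o => [nu|]; first exact: (ind_itv_cintble (z nu 0 i)).
exact: tri_cintble.
Qed.

Let prod_cintble o : cintble mu (fun t : T => (fun y : Rd => \prod_i u o i (y 0 i)) (vec_of t)).
Proof.
apply: eq_cintble (proj1 (tensor_cint (u_cintble o))) => t /=.
by apply: eq_bigr => i _; rewrite vec_ofE.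
Qed.

Lemma extension_cintble : cintble mu (fun t : T => extension (vec_of t)).
Proof. by apply: cintble_sum => o; apply: cintbleZ; exact: prod_cintble. Qed.

Lemma extension_cube (x : Rd) : (forall i, 0 < x 0 i < 1) ->
  extension x = (discrepancy z x)%:C.
Proof.
move=> x01; rewrite /extension /discrepancy rmorphB/= rmorphM/= rmorph_sum/= rmorph_prod/=.
have -> : \sum_o c o * \prod_i u o i (x 0 i) =
    \sum_(nu < N) c (Some nu) * \prod_i u (Some nu) i (x 0 i) +
    c None * \prod_i u None i (x 0 i).
  rewrite (bigD1 None)//= addrC; congr (_ + _).
  rewrite (reindex_omap Some id)//=; last by case.
  by apply: eq_bigl => nu; rewrite eqxx.
rewrite mulN1r; congr (_ - _); last first.
  by apply: eq_bigr => i _ /=; rewrite triE.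
rewrite mulr_sumr; apply: eq_bigr => nu _; congr (_ * _) => /=.
transitivity (\prod_(i < d) ((nat_of_bool (0 <= z nu ord0 i < x ord0 i)%R)%:R : R)%:C).
  apply: eq_bigr => i _; rewrite ind_itvE; congr ((nat_of_bool _)%:R%:C).
  exact: itv_unit (z01 nu i) (x01 i).
rewrite -rmorph_prod/=; congr (_%:C).
have [/forallP h|/forallPn[i hi]] := boolP [forall i, 0 <= z nu 0 i < x 0 i].
  by rewrite big1// => i _; rewrite h.
by rewrite (bigD1 i)//= (negbTE hi) mul0r.
Qed.

Lemma extension_cube_distribution psi : test_function psi ->
  function_distribution extension psi = cube_distribution (discrepancy z) psi.
Proof.
move=> [_ [K [_ K01 K0]]].
have E (x : Rd) : extension x * psi x =
    if x \in (cube : set Rd) then (discrepancy z x)%:C * psi x else 0.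
  have [Kx|nKx] := pselect (K x); last by rewrite K0// !mulr0 if_same.
  rewrite extension_cube; last exact: K01.
  rewrite mem_set// => i; have /andP[h1 h2] := K01 x Kx i.
  by rewrite (ltW h1) h2.
have preE (t : T) : (t \in vec_of @^-1` (cube : set Rd)) = (vec_of t \in (cube : set Rd)).
  by apply/idP/idP => /set_mem h; exact/mem_set.
rewrite /function_distribution /cube_distribution /Cintegral preimage_setT.
congr (_ +i* _).
  rewrite [RHS]Rintegral_mkcond; apply: eq_Rintegral => t _.
  by rewrite E patchE preE; case: ifP.
rewrite [RHS]Rintegral_mkcond; apply: eq_Rintegral => t _.
by rewrite E patchE preE; case: ifP.
Qed.

Definition net_block (k : {ffun 'I_d -> nat}) (x : Rd) : R[i] :=
  (N%:R^-1)%:C * \sum_(nu < N) \prod_i alpha phi0 (k i) (x 0 i - z nu 0 i) -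
  \prod_i beta phi0 (k i) (x 0 i).

Let net_blockE k x : net_block k x = \sum_o c o * \prod_i fac k o i (x 0 i).
Proof.
rewrite (bigD1 None)//= addrC /net_block mulN1r; congr (_ - _).
rewrite (reindex_omap Some id)//=; last by case.
rewrite mulr_sumr; apply: eq_big => [nu|nu _//]; by rewrite eqxx.
Qed.

(** [net_block] is continuous and represents the block as a distribution, which determines
    [dist_fun]. Linearity and the tensor structure reduce the identification to [alpha] and [beta]
    on the line. *)
Lemma block_extension k : block phi0 (function_distribution extension) k = net_block k.
Proof.
(* [|phi0| ^ 2] is smooth, nonnegative, 1 on [[-1, 1]] and 0 beyond [3 / 2]: the profile of the
   bumps. *)
pose th (u : R) := Re (phi0 u) * Re (phi0 u) + Im (phi0 u) * Im (phi0 u).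
have [_ s1 s2] := seed.
apply: (@dist_fun_represents R d th).
- by move=> n; apply: CnD; apply: CnM; solve [exact: seed_Re|exact: seed_Im].
- by move=> w; rewrite /th addr_ge0// -expr2 sqr_ge0.
- by move=> w w1; rewrite /th s2// mulr0 addr0.
- by move=> w w1; rewrite /th s1//= mulr1 mulr0 addr0.
- have cfac o i : continuous (Re \o fac k o i) /\ continuous (Im \o fac k o i).
    case: o => [nu|] /=; last exact: beta_continuous.
    have [c1 c2] := alpha_continuous seed (k i).
    by split; [exact: (@continuous_shift _ _ (z nu 0 i) c1)|exact: (@continuous_shift _ _ (z nu 0 i) c2)].
  have -> : net_block k = fun x => \sum_o c o * \prod_i fac k o i (x 0 i).
    by apply/funext => x; exact: net_blockE.
  apply: Ccontinuous_sum => o; apply: CcontinuousM; first exact: Ccontinuous_cst.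
  by apply: Ccontinuous_prod => i; exact: (Ccontinuous_coord i (cfac o i)).
have -> : net_block k = bandpass (dyadic_prod phi0 k) extension.
  apply/funext => x; rewrite bandpass_linear; last 2 first.
  - apply: eq_cintble (proj1 (tensor_cint (fun i => dyadic_cintble seed (k i)))) => t /=.
    by apply: eq_bigr => i _; rewrite vec_ofE.
  - exact: prod_cintble.
  rewrite net_blockE; apply: eq_bigr => o _; congr (_ * _).
  rewrite (bandpass_tensor x (fun i => dyadic_cintble seed (k i)) (u_cintble o)).
  apply: eq_bigr => i _; case: o => [nu|] /=.
    by rewrite bandpass1_ind.
  by rewrite bandpass1_tri.
apply: bandpass_represents; last exact: extension_cintble.
apply: eq_cintble (proj1 (tensor_cint (fun i => dyadic_cintble seed (k i)))) => t /=.
by apply: eq_bigr => i _; rewrite vec_ofE.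
Qed.

End net_extension.

(** * Digital nets *)

Section base_expansion.
Variable b : nat.

(** The integer with base-[b] digits [D 0], ..., [D j.-1], the most significant first; for the
    digits of a point [x] it is the integer part of [b ^ j x]. *)
Fixpoint base_value (D : nat -> nat) (j : nat) : nat :=
  if j is j'.+1 then (base_value D j' * b + D j')%N else 0%N.

Lemma base_value_eq D D' j : (forall k, (k < j)%N -> D k = D' k) ->
  base_value D j = base_value D' j.
Proof.
elim: j => //= j ih h; rewrite ih ?h// => k kj; by rewrite h// ltnW.
Qed.

Lemma base_value_lt D j : (forall k, (D k < b)%N) -> (base_value D j < b ^ j)%N.
Proof.
move=> Db; elim: j => //= j ih; rewrite expnSr.
have := Db j; move: ih; move: (base_value D j) (D j) (b ^ j)%N => q e B; nia.
Qed.

Lemma base_value_inj D D' j : (forall k, (D k < b)%N) -> (forall k, (D' k < b)%N) ->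
  base_value D j = base_value D' j -> forall k, (k < j)%N -> D k = D' k.
Proof.
move=> Db D'b; elim: j => //= j ih h k.
have [h1 h2] : base_value D j = base_value D' j /\ D j = D' j.
  have b0 : (0 < b)%N := leq_ltn_trans (leq0n _) (Db 0%N).
  have := congr1 (divn^~ b) h; have := congr1 (modn^~ b) h.
  by rewrite /= !modnMDl !divnMDl// !modn_small// !divn_small// !addn0.
by rewrite ltnS leq_eqVlt => /orP[/eqP ->//|]; exact: ih.
Qed.

Lemma base_value_surj j m : (0 < b)%N -> (m < b ^ j)%N ->
  exists2 D, (forall k, (D k < b)%N) & base_value D j = m.
Proof.
move=> b0 mb; elim: j m mb => [|j ih] m /= mb.
  by exists (fun=> 0%N) => //; move: mb; rewrite expn0 ltnS leqn0 => /eqP.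
have [|D Db Dm] := ih (m %/ b)%N; first by rewrite ltn_divLR// -expnSr.
exists (fun k => if k == j then m %% b else D k)%N => [k|/=].
  by case: eqP => // _; rewrite ltn_pmod.
rewrite eqxx (@base_value_eq _ D) ?Dm -?divn_eq// => k kj.
by rewrite ltn_eqF.
Qed.

Lemma base_value_div D j : (forall k, (D k < b)%N) ->
  (base_value D j.+1 %/ b = base_value D j)%N.
Proof.
move=> Db; have b0 : (0 < b)%N := leq_ltn_trans (leq0n _) (Db 0%N).
by rewrite /= divnMDl// divn_small// addn0.
Qed.

End base_expansion.

(** * Equidistribution of digital nets *)

Section net_equidistribution.
Context {d b s n v : nat}.
Variable M : 'I_d -> 'M['F_b]_(s, n).
Hypothesis bP : prime b.
Hypothesis netM : order_digital_net 1 v M.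

Let b0 : (0 < b)%N. Proof. exact: prime_gt0. Qed.

Lemma Fp_lt (u : 'F_b) : (u < b)%N.
Proof. by rewrite -[X in (_ < X)%N](Fp_cast bP). Qed.

Lemma digit_vector_inj : injective (@digit_vector b n).
Proof.
move=> x y /matrixP h; apply: val_inj.
have {}h j : (j < n)%N -> (x %/ b ^ j %% b = y %/ b ^ j %% b)%N.
  move=> jn; have := congr1 val (h (Ordinal jn) 0); rewrite !mxE/=.
  by rewrite !val_Fp_nat// !modn_mod.
have := h; have := ltn_ord y; have := ltn_ord x.
change (\val x = \val y) with (nat_of_ord x = nat_of_ord y).
move: (nat_of_ord x) (nat_of_ord y) => {h}{}x {}y xb yb h.
elim: n x y xb yb h => [|m ih] x y xb yb h.
  by move: xb yb; rewrite !expn0 !ltnS !leqn0 => /eqP -> /eqP ->.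
rewrite (divn_eq x b) (divn_eq y b).
have := h 0%N isT; rewrite expn0 !divn1 => ->; congr (_ * _ + _)%N.
apply: ih; rewrite ?ltn_divLR// -?expnSr// => j jm.
by rewrite -!divnMA -expnS; exact: h.
Qed.

Lemma digit_vector_bij : bijective (@digit_vector b n).
Proof.
apply: inj_card_bij digit_vector_inj _.
by rewrite card_mx card_Fp// muln1 card_ord.
Qed.

(** The first [j i] rows, in the decreasing order in which [order_digital_net] lists indices. *)
Let rows (j : 'I_d -> nat) (i : 'I_d) : seq 'I_s := rev [seq k : 'I_s <- enum 'I_s | (k < j i)%N].

Let free_rows j : (\sum_i j i <= n - v)%N ->
  free [seq row k (M i) | i <- enum 'I_d, k <- rows j i].
Proof.
move=> jn; have [_ _ _ /(_ (rows j))] := netM; apply.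
  move=> i; rewrite rev_sorted; apply: sorted_filter.
    by move=> x y w; exact: ltn_trans.
  have := iota_ltn_sorted 0 s; rewrite -val_enum_ord sorted_map.
  by apply: sub_sorted => x y.
rewrite mul1n; apply: leq_trans jn; apply: leq_sum => i _.
(* For order 1 only the head of each list is counted. It is an index [k < j i], and contributes
   [k.+1 <= j i]. *)
have : all (fun k : 'I_s => (k < j i)%N) (rows j i) by rewrite all_rev filter_all.
by case: (rows j i) => [_|k l /= /andP[kj _]]; rewrite ?big_nil ?take0 ?big_seq1.
Qed.

(** The selected rows form a matrix with independent rows, hence with a right inverse [B], and [B]
    applied to the prescribed values solves the system. *)
Lemma prescribed_rows (j : 'I_d -> nat) (w : 'I_d -> 'I_s -> 'F_b) :
  (\sum_i j i <= n - v)%N ->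
  exists x : 'cV['F_b]_n, forall i (k : 'I_s), (k < j i)%N -> (M i *m x) k 0 = w i k.
Proof.
move=> /free_rows; set X := (X in free X) => fX.
pose L := [seq (i, k) | i <- enum 'I_d, k <- rows j i].
have XL : X = [seq row p.2 (M p.1) | p <- L] by rewrite /L map_allpairs.
have sX : size X = size L by rewrite XL size_map.
pose A := \matrix_(t < size X) nth 0 X t.
have : row_free A.
  apply: inj_row_free => u; rewrite mulmx_sum_row => hu.
  have /freeP fr : free (in_tuple X) by [].
  apply/rowP => t; rewrite mxE; apply: (fr (fun t => u 0 t)).
  by rewrite -[RHS]hu; apply: eq_bigr => t' _; rewrite rowK.
move=> /row_freeP[B AB].
case: (posnP d) => [d0|dP].
  by exists 0 => i; have := ltn_ord i; rewrite {2}d0.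
pose W : 'cV_(size X) := \col_t (nth 0 [seq w p.1 p.2 | p <- L] t).
exists (B *m W) => i k kj.
have iL : (i, k) \in L.
  apply/allpairsPdep; exists i, k; split=> //; first by rewrite mem_enum.
  by rewrite mem_rev mem_filter kj mem_enum.
have tX : (index (i, k) L < size X)%N by rewrite sX index_mem.
have := congr1 (fun C : 'cV_(size X) => C (Ordinal tX) 0) (mulmxA A B W).
rewrite AB mul1mx [RHS]mxE (nth_map (i, k)) ?index_mem//= nth_index//= => <-.
have : row k (M i) = row (Ordinal tX) A.
  rewrite rowK/=; have -> : nth 0 X (index (i, k) L) = nth 0 [seq row p.2 (M p.1) | p <- L] (index (i, k) L).
    by rewrite -XL.
  by rewrite (nth_map (i, k)) ?index_mem//= nth_index.
by move=> /rowP h; rewrite !mxE; apply: eq_bigr => l _; have := h l; rewrite !mxE => ->.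
Qed.

(** Digits beyond the [s] available rows are 0, which makes the digit sequence total. *)
Definition net_digit (nu : 'I_(b ^ n)) (i : 'I_d) (k : nat) : nat :=
  if insub k is Some k' then (M i *m digit_vector nu) (k' : 'I_s) 0 else 0%N.

(** Index of the b-adic interval of length [b ^- j] that contains the [i]-th coordinate, see
    [digital_net_index]. *)
Definition net_index (j : nat) (nu : 'I_(b ^ n)) (i : 'I_d) : nat :=
  base_value b (net_digit nu i) j.

Lemma net_digit_lt nu i k : (net_digit nu i k < b)%N.
Proof. by rewrite /net_digit; case: insubP => [k' _ _|_]; [exact: Fp_lt|]. Qed.

Lemma net_index_lt j nu i : (net_index j nu i < b ^ j)%N.
Proof. by apply: base_value_lt => k; exact: net_digit_lt. Qed.

Let level_le (j : 'I_d -> nat) : (\sum_i j i <= n - v)%N -> forall i, (j i <= n)%N.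
Proof.
move=> h i; apply: leq_trans (leq_trans h (leq_subr _ _)).
by rewrite (bigD1 i)//= leq_addr.
Qed.

Let sn : (n <= s)%N. Proof. by have [_] := netM; rewrite mul1n. Qed.

(** Every fibre is a coset of one subspace, the common kernel of the first [j i] rows: subtracting a
    solution [x0] of the inhomogeneous system maps it bijectively onto that kernel. The cardinality
    need only be independent of [m]; its value follows later from the total number of points. *)
Lemma card_net_fiber (j : 'I_d -> nat) : (\sum_i j i <= n - v)%N ->
  exists c, forall m : 'I_d -> nat, (forall i, (m i < b ^ j i)%N) ->
    #|[pred nu : 'I_(b ^ n) | [forall i, net_index (j i) nu i == m i]]| = c.
Proof.
move=> jn; have [g gK Kg] := digit_vector_bij.
pose P := [pred x : 'cV['F_b]_n | [forall i, forall k : 'I_s, (k < j i)%N ==> ((M i *m x) k 0 == 0)]].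
exists #|P|.
move=> m mb.
have /choice[D hD] : forall i, exists D, (forall k, (D k < b)%N) /\ base_value b D (j i) = m i.
  by move=> i; have [D h1 h2] := base_value_surj b0 (mb i); exists D.
have [x0 hx0] := prescribed_rows (fun i k => (D i k)%:R) jn.
pose f nu := digit_vector nu - x0 : 'cV['F_b]_n.
rewrite -(@on_card_preimset _ _ f P); last first.
  apply: onW_bij; exists (fun x => g (x + x0)) => x; rewrite /f.
    by rewrite subrK gK.
  by rewrite Kg addrK.
apply: eq_card => nu; rewrite !inE/=.
suff h i : (net_index (j i) nu i == m i) =
    [forall k : 'I_s, (k < j i)%N ==> ((M i *m f nu) k 0 == 0)].
  by apply: eq_forallb => i; exact: h.
have [Db <-] := hD i.
have digE (k : 'I_s) : net_digit nu i k = (M i *m digit_vector nu) k 0.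
  by rewrite /net_digit valK.
apply/eqP/forallP => [h k|h].
  apply/implyP => kj; rewrite /f mulmxBr mxE [X in _ + X]mxE hx0//.
  rewrite -(base_value_inj (net_digit_lt nu i) Db h kj) digE subr_eq0; apply/eqP.
  by apply: val_inj; rewrite /= val_Fp_nat// modn_small// Fp_lt.
apply: base_value_eq => k kj.
have ks : (k < s)%N := leq_trans (leq_trans kj (level_le jn i)) sn.
have /eqP := implyP (h (Ordinal ks)) kj.
rewrite /f mulmxBr mxE [X in _ + X]mxE hx0// => /eqP; rewrite subr_eq0 => /eqP E.
by rewrite (digE (Ordinal ks)) E/= val_Fp_nat// modn_small.
Qed.

Lemma net_average (K : numFieldType) (j : 'I_d -> nat) (g : 'I_d -> nat -> K) :
  (\sum_i j i <= n - v)%N ->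
  (b ^ n)%:R^-1 * \sum_nu \prod_i g i (net_index (j i) nu i) =
  \prod_i ((b ^ j i)%:R^-1 * \sum_(m < b ^ j i) g i m).
Proof.
move=> jn; have [c hc] := card_net_fiber jn.
have jl i : (b ^ j i <= b ^ n)%N by rewrite leq_pexp2l// level_le.
have bn0 : (0 < b ^ n)%N by rewrite expn_gt0 b0.
have E (F : 'I_d -> nat -> K) : \sum_nu \prod_i F i (net_index (j i) nu i) =
    c%:R * \prod_i \sum_(m < b ^ j i) F i m.
  (* The ranges [b ^ j i] depend on [i]. All indices are embedded in ['I_(b ^ n)], so that the
     product of sums becomes a sum over finite functions. *)
  have -> : \prod_i \sum_(m < b ^ j i) F i m =
      \prod_i \sum_(m < b ^ n | (m < b ^ j i)%N) F i m.
    by apply: eq_bigr => i _; rewrite (big_ord_widen _ (F i) (jl i)).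
  rewrite bigA_distr_big_dep mulr_sumr.
  pose p nu : {ffun 'I_d -> 'I_(b ^ n)} :=
    [ffun i => Ordinal (leq_trans (net_index_lt (j i) nu i) (jl i))].
  pose Q := family (fun (i : 'I_d) (l : 'I_(b ^ n)) => (l < b ^ j i)%N).
  rewrite (partition_big p [in Q]) => [|nu _]; last first.
    by apply/familyP => i; rewrite ffunE; exact: net_index_lt.
  apply: eq_bigr => f /familyP fQ.
  transitivity (\sum_(nu | p nu == f) \prod_i F i (f i)).
    by apply: eq_bigr => nu /eqP <-; apply: eq_bigr => i _; rewrite ffunE.
  rewrite sumr_const -(hc (fun i => f i) (fun i => fQ i)) mulr_natl; congr (_ *+ _).
  apply: eq_card => nu; rewrite [RHS]inE.
  change ((p nu == f) = [forall i, net_index (j i) nu i == f i :> nat]).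
  apply/eqP/forallP => [<- i|h].
    by rewrite ffunE.
  by apply/ffunP => i; apply: val_inj; rewrite ffunE/=; exact/eqP/h.
(* Constant functions count all points of the net and thereby determine [c]. *)
have := E (fun _ _ => 1).
rewrite big1_eq sumr_const card_ord => bn.
rewrite E mulrA big_split/=; congr (_ * _).
have c0 : c%:R != 0 :> K.
  apply/eqP => c0; move: bn; rewrite c0 mul0r => /eqP.
  by rewrite pnatr_eq0 gtn_eqF.
rewrite bn invfM mulrAC mulVf// mul1r -prodfV.
by apply: eq_bigr => i _; rewrite sumr_const card_ord.
Qed.

Section net_points.
Context {R : realType}.
Local Notation z := (@digital_net R d b s n M).

Lemma base_value_expansion (D : nat -> nat) j :
  (base_value b D j)%:R / b%:R ^+ j = \sum_(k < j) (D k)%:R / b%:R ^+ k.+1 :> R.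
Proof.
have b0' : b%:R != 0 :> R by rewrite pnatr_eq0 -lt0n b0.
elim: j => [|j ih]; first by rewrite big_ord0 mul0r.
rewrite big_ord_recr -ih/= natrD natrM mulrDl; congr (_ + _).
by rewrite exprSr invfM mulrA mulrAC mulfK.
Qed.

Lemma base_value_mono (D : nat -> nat) j t : (forall k, (D k < b)%N) -> (j <= t)%N ->
  (base_value b D j)%:R / b%:R ^+ j <= (base_value b D t)%:R / b%:R ^+ t :> R /\
  (base_value b D t).+1%:R / b%:R ^+ t <= (base_value b D j).+1%:R / b%:R ^+ j :> R.
Proof.
move=> Db; have b0' : 0 < b%:R :> R by rewrite ltr0n b0.
elim: t => [|t ih]; first by rewrite leqn0 => /eqP ->.
rewrite leq_eqVlt => /orP[/eqP ->//|/ih[h1 h2]]; split.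
  apply: le_trans h1 _; rewrite ler_pdivlMr ?exprn_gt0// exprSr mulrA divfK ?gt_eqF ?exprn_gt0//.
  by rewrite -natrM ler_nat leq_addr.
apply: le_trans h2; rewrite ler_pdivrMr ?exprn_gt0// exprSr mulrA divfK ?gt_eqF ?exprn_gt0//.
rewrite -natrM ler_nat /=; have := Db t; nia.
Qed.

Lemma digital_net_index nu i j : (j <= n)%N ->
  (net_index j nu i)%:R / b%:R ^+ j <= z nu 0 i < (net_index j nu i).+1%:R / b%:R ^+ j.
Proof.
move=> jn; have js := leq_trans jn sn.
have -> : z nu 0 i = (net_index s nu i)%:R / b%:R ^+ s.
  rewrite base_value_expansion mxE; apply: eq_bigr => k _.
  by rewrite /net_digit valK.
have [h1 h2] := base_value_mono (net_digit_lt nu i) js.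
rewrite h1/=; apply: lt_le_trans h2.
by rewrite ltr_pM2r ?invr_gt0 ?exprn_gt0 ?ltr0n// ltr_nat.
Qed.

Lemma digital_net01 nu i : 0 <= z nu 0 i < 1.
Proof.
have := digital_net_index nu i (leq0n _).
by rewrite /net_index/= expr0 !divr1.
Qed.

End net_points.

End net_equidistribution.

(** * Telescoping and the quadrature error *)

Section telescoping.

(** The first term is the full value at [j0]. In the application [b ^ j0] is about [2 ^ k], the
    resolution from which on the kernel of level [k] varies slowly between neighbouring grid
    points. *)
Definition increment (K : zmodType) (u : nat -> K) (j0 j : nat) : K :=
  if j == j0 then u j else u j - u j.-1.

Lemma sum_increment (K : zmodType) (u : nat -> K) (j0 m : nat) : (j0 <= m)%N ->
  \sum_(j < m.+1 | (j0 <= j)%N) increment u j0 j = u m.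
Proof.
rewrite leq_eqVlt => /orP[/eqP ->|].
  rewrite (bigD1 ord_max)//= /increment eqxx big1 ?addr0// => j /andP[h1 h2].
  by move: h2; rewrite -val_eqE/= eqn_leq h1 -ltnS ltn_ord.
elim: m => // m ih; rewrite ltnS => j0m.
rewrite big_mkcond big_ord_recr/= -big_mkcond/= (leqW j0m) {2}/increment gtn_eqF ?ltnS//=.
suff -> : \sum_(j < m.+1 | (j0 <= j)%N) increment u j0 j = u m by rewrite addrC subrK.
move: j0m; rewrite leq_eqVlt => /orP[/eqP ->|]; last exact: ih.
rewrite (bigD1 ord_max)//= /increment eqxx big1 ?addr0// => j /andP[h1 h2].
by move: h2; rewrite -val_eqE/= eqn_leq h1 -ltnS ltn_ord.
Qed.

Lemma sum_divn (K : pzSemiRingType) (f : nat -> K) (b c : nat) : (0 < b)%N ->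
  \sum_(m < c * b) f (m %/ b)%N = b%:R * \sum_(m < c) f m.
Proof.
move=> b0; elim: c => [|c ih]; first by rewrite !big_ord0 mulr0.
have -> : \sum_(m < c.+1 * b) f (m %/ b)%N = \sum_(m < c * b + b) f (m %/ b)%N.
  by rewrite -!(big_mkord xpredT (fun m => f (m %/ b)%N)) mulSnr.
rewrite big_split_ord/= ih big_ord_recr/= mulrDr; congr (_ + _).
rewrite (eq_bigr (fun=> f c)) => [|i _].
  by rewrite sumr_const card_ord mulr_natl.
by rewrite divnMDl// divn_small// addn0.
Qed.

End telescoping.

Section net_error.
Context {R : realType} {d b s n v : nat}.
Variable M : 'I_d -> 'M['F_b]_(s, n).
Hypothesis bP : prime b.
Hypothesis netM : order_digital_net 1 v M.
Local Notation z := (@digital_net R d b s n M).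

Let b0 : (0 < b)%N. Proof. exact: prime_gt0. Qed.

(** Truncation of a coordinate to [j] digits; the additional level [n.+1] is the exact coordinate,
    so that the telescoping sum ends at the net itself. *)
Definition net_point (j : nat) (nu : 'I_(b ^ n)) (i : 'I_d) : R :=
  if (j <= n)%N then (net_index M j nu i)%:R / b%:R ^+ j else z nu 0 i.

Definition grid_mean (a : R -> R[i]) (m : nat) : R[i] :=
  ((b ^ m)%:R^-1) * \sum_(l < b ^ m) a (l%:R / b%:R ^+ m).

(** The counterpart of [net_point] for the integral: averages over the grids, and at level [n.+1]
    the limiting value [beta]. *)
Definition net_mean (a : R -> R[i]) (beta : R[i]) (j : nat) : R[i] :=
  if (j <= n)%N then grid_mean a j else beta.

(** The increment as a function of the b-adic index [m] alone, a form that [net_average] can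
    integrate; dropping the last digit turns [m] into [m %/ b]. *)
Let grid_increment (a : R -> R[i]) (j0 j m : nat) : R[i] :=
  if j == j0 then a (m%:R / b%:R ^+ j)
  else a (m%:R / b%:R ^+ j) - a ((m %/ b)%N%:R / b%:R ^+ j.-1).

Let net_increment a j0 j nu i : (j0 <= j)%N -> (j <= n)%N ->
  increment (fun j => a (net_point j nu i)) j0 j =
  grid_increment a j0 j (net_index M j nu i).
Proof.
move=> j0j jn; rewrite /increment /grid_increment /net_point jn.
case: eqP => // /eqP jj0; have jp : (0 < j)%N.
  by rewrite lt0n; apply: contra jj0 => /eqP j00; rewrite j00 eq_sym -leqn0 -j00.
rewrite (leq_trans (leq_pred _) jn); congr (_ - a (_%:R / _)).
by rewrite -{2}(prednK jp) base_value_div// => k; exact: net_digit_lt.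
Qed.

Let mean_increment a beta j0 j : (j0 <= j)%N -> (j <= n)%N ->
  ((b ^ j)%:R^-1) * \sum_(m < b ^ j) grid_increment a j0 j m =
  increment (net_mean a beta) j0 j.
Proof.
move=> j0j jn; rewrite /increment /grid_increment /net_mean jn.
case: eqP => // /eqP jj0; have jp : (0 < j)%N.
  by rewrite lt0n; apply: contra jj0 => /eqP j00; rewrite j00 eq_sym -leqn0 -j00.
rewrite (leq_trans (leq_pred _) jn) sumrB mulrBr; congr (_ - _).
rewrite /grid_mean; case: j jp {j0j jn jj0} => // j _ /=.
have -> : \sum_(m < b ^ j.+1) a ((m %/ b)%N%:R / b%:R ^+ j) =
    b%:R * \sum_(m < b ^ j) a (m%:R / b%:R ^+ j).
  rewrite -(sum_divn (fun m => a (m%:R / b%:R ^+ j)))//.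
  by rewrite -!(big_mkord xpredT (fun m => a ((m %/ b)%N%:R / b%:R ^+ j))) expnSr.
by rewrite mulrA expnSr natrM invfM -[_ * _ * b%:R]mulrA mulVf ?mulr1// pnatr_eq0 -lt0n.
Qed.

(** Both products are expanded over level vectors [J]. For [|J| <= n - v] the net average of a term
    is, by [net_average], the corresponding term of the product of the [beta i]. The other terms are
    estimated by absolute values, those of the net and those of the mean apart. *)
Lemma net_error_le (a : 'I_d -> R -> R[i]) (beta : 'I_d -> R[i]) (j0 : 'I_d -> nat)
    (L : 'I_d -> R) (A : 'I_d -> 'I_(b ^ n) -> R) (E : 'I_d -> R) :
  (forall i, (j0 i <= n)%N) ->
  (forall i nu j, (j0 i <= j <= n.+1)%N ->
     normc (increment (fun j => a i (net_point j nu i)) (j0 i) j) <=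
     L i / b%:R ^+ j * A i nu) ->
  (forall i j, (j0 i <= j <= n.+1)%N ->
     normc (increment (net_mean (a i) (beta i)) (j0 i) j) <= L i / b%:R ^+ j * E i) ->
  normc ((b ^ n)%:R^-1 * \sum_nu \prod_i a i (z nu 0 i) - \prod_i beta i) <=
  (\prod_i L i) * ((b ^ n)%:R^-1 * \sum_nu \prod_i A i nu + \prod_i E i) *
  \sum_(J : {ffun 'I_d -> 'I_n.+2} | [forall i, (j0 i <= J i)%N] &&
      (n - v < \sum_i J i)%N) \prod_i b%:R ^- J i.
Proof.
move=> j0n hA hE.
pose Q := family (fun (i : 'I_d) (j : 'I_n.+2) => (j0 i <= j)%N).
have E1 nu : \prod_i a i (z nu 0 i) = \sum_(J in Q)
    \prod_i increment (fun j => a i (net_point j nu i)) (j0 i) (J i).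
  transitivity (\prod_i \sum_(j < n.+2 | (j0 i <= j)%N)
      increment (fun j => a i (net_point j nu i)) (j0 i) j).
    by apply: eq_bigr => i _; rewrite sum_increment ?leqW// /net_point ltnn.
  by rewrite bigA_distr_big_dep.
have E2 : \prod_i beta i = \sum_(J in Q)
    \prod_i increment (net_mean (a i) (beta i)) (j0 i) (J i).
  transitivity (\prod_i \sum_(j < n.+2 | (j0 i <= j)%N)
      increment (net_mean (a i) (beta i)) (j0 i) j).
    by apply: eq_bigr => i _; rewrite sum_increment ?leqW// /net_mean ltnn.
  by rewrite bigA_distr_big_dep.
have -> : (b ^ n)%:R^-1 * \sum_nu \prod_i a i (z nu 0 i) - \prod_i beta i =
    \sum_(J in Q) ((b ^ n)%:R^-1 * \sum_nu \prod_i increment (fun j => a i (net_point j nu i)) (j0 i) (J i)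
      - \prod_i increment (net_mean (a i) (beta i)) (j0 i) (J i)).
  rewrite E2 (eq_bigr _ (fun nu _ => E1 nu)) exchange_big/= mulr_sumr -sumrB.
  by [].
rewrite (bigID (fun J : {ffun 'I_d -> 'I_n.+2} => (\sum_i J i <= n - v)%N))/=.
(* [|J| <= n - v] forces every [J i <= n], so no factor involves an exact point or a value
   [beta i]. *)
rewrite big1 ?add0r => [|J /andP[/familyP JQ Jn]]; last first.
  have Jin i : (J i <= n)%N.
    by apply: leq_trans (leq_trans Jn (leq_subr _ _)); rewrite (bigD1 i)//= leq_addr.
  rewrite (eq_bigr (fun nu => \prod_i grid_increment (a i) (j0 i) (J i) (net_index M (J i) nu i))).
    rewrite (net_average bP netM (fun i => grid_increment (a i) (j0 i) (J i)) Jn).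
    apply/eqP; rewrite subr_eq0; apply/eqP; apply: eq_bigr => i _.
    by rewrite (mean_increment _ (beta i))//; exact: JQ.
  by move=> nu _; apply: eq_bigr => i _; rewrite net_increment//; exact: JQ.
apply: le_trans (normc_sum _ _ _) _.
rewrite [leRHS]mulr_sumr [leRHS](eq_bigl (fun J => (J \in Q) && ~~ (\sum_i J i <= n - v)%N)); last first.
  move=> J; rewrite -ltnNge; suff -> : (J \in Q) = [forall i, (j0 i <= J i)%N] by [].
  by apply/idP/idP => [/familyP h|/forallP h]; [apply/forallP|apply/familyP].
apply: ler_sum => J /andP[/familyP JQ _].
have JQ' i : (j0 i <= J i <= n.+1)%N by apply/andP; split; [exact: JQ|rewrite -ltnS].
have b0' : 0 <= b%:R :> R by [].
have Lprod (X : 'I_d -> R) : \prod_i (L i / b%:R ^+ J i * X i) =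
    (\prod_i L i) * (\prod_i b%:R ^- J i) * \prod_i X i.
  by rewrite !big_split.
apply: le_trans (normcB _ _) _.
rewrite mulrDr mulrDl; apply: lerD; last first.
  rewrite mulrAC -Lprod normc_prod; apply: ler_prod => i _.
  by rewrite normc_ge0 hE.
rewrite normcM.
have -> : normc ((b ^ n)%:R^-1 : R[i]) = (b ^ n)%:R^-1.
  have -> : ((b ^ n)%:R^-1 : R[i]) = ((b ^ n)%:R^-1)%:C by rewrite fmorphV/= rmorph_nat.
  by rewrite normc_real ger0_norm// invr_ge0.
rewrite mulrA [_ * (b ^ n)%:R^-1]mulrC -!mulrA ler_wpM2l ?invr_ge0//.
apply: le_trans (normc_sum _ _ _) _.
rewrite mulrA mulrAC mulr_sumr; apply: ler_sum => nu _.
by rewrite -Lprod normc_prod; apply: ler_prod => i _; rewrite normc_ge0 hA.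
Qed.

End net_error.

Lemma expr_up_log_le {R : realType} (b k : nat) : (1 < b)%N ->
  b%:R ^+ up_log b (2 ^ k) <= b%:R * 2 ^+ k :> R.
Proof.
move=> b1; have [->|k1] := posnP k.
  by rewrite expn0 up_log1 !expr0 mulr1 ler1n ltnW.
have k2 : (1 < 2 ^ k)%N by rewrite -[1%N](expn0 2) ltn_exp2l.
have /ltnW kk := up_log_gtn b1 k2.
have kp : (0 < up_log b (2 ^ k))%N by rewrite up_log_gt0 b1.
by rewrite -(prednK kp) exprS ler_wpM2l// -!natrX ler_nat.
Qed.

Lemma omk_near {R : realType} k (x w w' : R) : 2 ^+ k * `|w - w'| <= 1 ->
  omk k (x - w) <= 3 * omk k (x - w').
Proof.
move=> h; rewrite /omk [leRHS]mulrDr; apply: lerD; apply: om_near.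
  rewrite -mulrBr (_ : x - w - (x - w') = w' - w); last by ring.
  by rewrite normrM distrC ger0_norm ?exprn_ge0.
rewrite -mulrBr (_ : x - w - 1 - (x - w' - 1) = w' - w); last by ring.
by rewrite normrM distrC ger0_norm ?exprn_ge0.
Qed.

Lemma omk_mean {R : realType} k (x : R) (m : nat) : (2 ^ k <= m)%N ->
  m%:R^-1 * \sum_(l < m) omk k (x - l%:R / m%:R) <= 6 * pi * 2 ^- k.
Proof.
move=> km; have := omk_sum x km; rewrite -mulr_sumr.
rewrite -mulrA -ler_pdivlMl ?exprn_gt0// => h; apply: le_trans h _.
by rewrite mulrC.
Qed.

(** * Increments in one coordinate *)

Section one_coordinate.
Context {R : realType}.
Variable phi0 : R -> R[i].
Hypothesis seed : resolution_seed phi0.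
Local Notation alpha := (alpha phi0).
Local Notation beta := (beta phi0).

Lemma normc_grid_mean (b : nat) (a : R -> R[i]) m :
  @grid_mean R b a m = ((b ^ m)%:R^-1)%:C * \sum_(l < b ^ m) a (l%:R / (b ^ m)%:R).
Proof.
rewrite /grid_mean fmorphV/= rmorph_nat; congr (_ * _); apply: eq_bigr => l _.
by rewrite natrX.
Qed.

Lemma grid_mean_approx : exists2 C : R, 0 <= C & forall (b : nat) k x m, (2 ^ k <= b ^ m)%N ->
  normc (beta k x - @grid_mean R b (fun w => alpha k (x - w)) m) <= C / b%:R ^+ m * om x ^+ 2.
Proof.
have [C C0 h] := beta_approx seed; exists C => // b k x m km.
by rewrite normc_grid_mean -natrX; exact: h.
Qed.

Lemma grid_mean_le : exists2 C : R, 0 <= C & forall (b : nat) k x m, (2 ^ k <= b ^ m)%N ->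
  normc (@grid_mean R b (fun w => alpha k (x - w)) m) <= C * 2 ^- k * om x ^+ 2.
Proof.
have [C C0 [h _]] := alpha_estimates seed; exists (C * (6 * pi)).
  by rewrite !mulr_ge0// pi_ge0.
move=> b k x m km; rewrite normc_grid_mean normcM normc_real ger0_norm ?invr_ge0//.
have m0 : (0 < (b ^ m)%:R :> R) by rewrite ltr0n (leq_trans _ km)// expn_gt0.
apply: (@le_trans _ _ ((b ^ m)%:R^-1 * \sum_(l < b ^ m) C * om x ^+ 2 * omk k (x - l%:R / (b ^ m)%:R))).
  rewrite ler_wpM2l ?invr_ge0//; apply: le_trans (normc_sum _ _ _) _.
  apply: ler_sum => l _; apply: h.
  by rewrite divr_ge0//= ler_pdivrMr// mul1r ler_nat ltnW.
rewrite -mulr_sumr mulrCA [leRHS](_ : _ = C * om x ^+ 2 * (6 * pi * 2 ^- k)); last by ring.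
apply: ler_wpM2l; first by rewrite mulr_ge0 ?exprn_ge0 ?om_ge0.
exact: omk_mean.
Qed.

Lemma beta_le : exists2 C : R, 0 <= C & forall k x,
  normc (beta k x) <= C * 2 ^- k * om x ^+ 2.
Proof.
have [C1 C10 h1] := grid_mean_approx; have [C2 C20 h2] := grid_mean_le.
exists (C1 + C2); first exact: addr_ge0.
move=> k x; have := h1 2%N k x k (leqnn _); have := h2 2%N k x k (leqnn _).
move: (grid_mean _ _) => g hg hbg.
rewrite (_ : beta k x = (beta k x - g) + g); last by rewrite subrK.
by apply: le_trans (normcD _ _) _; rewrite !mulrDl lerD.
Qed.

(** At the first level the mean itself has size [2 ^- k], and [b ^ kappa <= b * 2 ^ k]. At later
    levels both means are within [O(b ^- j)] of [beta]. The factors [2 ^+ k] and [2 ^- k] are kept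
    apart to fit the form [L i / b ^ j * E i] of [net_error_le]. *)
Lemma net_mean_increment_le (b : nat) : (1 < b)%N ->
  exists2 C : R, 0 <= C & forall n k x j, let kappa := up_log b (2 ^ k) in
  (kappa <= n)%N -> (kappa <= j <= n.+1)%N ->
  normc (increment (@net_mean R b n (fun w => alpha k (x - w)) (beta k x)) kappa j) <=
  C * 2 ^+ k * om x ^+ 2 / b%:R ^+ j * 2 ^- k.
Proof.
move=> b1; have [C1 C10 h1] := grid_mean_approx; have [C2 C20 h2] := grid_mean_le.
have b0 : (0 < b)%N := ltnW b1.
have bR : 1 <= b%:R :> R by rewrite ler1n.
have b0R : 0 < b%:R :> R by rewrite ltr0n.
exists ((C1 + C1) * b%:R + C2 * b%:R); first by rewrite addr_ge0// !mulr_ge0// addr_ge0.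
move=> n k x j kappa kn /andP[kj jn].
have e0 : 0 <= om x ^+ 2 :> R by rewrite exprn_ge0// om_ge0.
have k0 : 2 ^+ k != 0 :> R by rewrite expf_neq0// pnatr_eq0.
rewrite [leRHS](_ : _ = ((C1 + C1) * b%:R + C2 * b%:R) / b%:R ^+ j * om x ^+ 2); last by field; rewrite k0 expf_neq0// gt_eqF.
have kap m : (kappa <= m)%N -> (2 ^ k <= b ^ m)%N.
  by move=> h; apply: leq_trans (up_logP _ b1) _; rewrite leq_pexp2l.
rewrite /increment; case: eqP => [->|/eqP jk].
  rewrite /net_mean kn; apply: le_trans (h2 b k x _ (kap _ (leqnn _))) _.
  rewrite ler_wpM2r// -[leLHS]add0r mulrDl; apply: lerD; first by rewrite divr_ge0 ?exprn_ge0// !mulr_ge0// addr_ge0.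
  rewrite -mulrA ler_wpM2l// -invf_div lef_pV2 ?posrE ?exprn_gt0 ?divr_gt0 ?exprn_gt0//.
  by rewrite ler_pdivrMr// mulrC; exact: expr_up_log_le.
have {jk}kj : (kappa < j)%N by rewrite ltn_neqAle eq_sym jk.
have jp : j = j.-1.+1 by rewrite prednK// (leq_ltn_trans _ kj).
have jn1 : (j.-1 <= n)%N by rewrite -ltnS -jp.
have kj1 : (kappa <= j.-1)%N by rewrite -ltnS -jp.
have a1 := h1 b k x _ (kap _ kj1).
have a2 : normc (@net_mean R b n (fun w => alpha k (x - w)) (beta k x) j - beta k x) <= C1 / b%:R ^+ j * om x ^+ 2.
  rewrite /net_mean; case: ifP => _; last by rewrite subrr normc0 mulr_ge0// divr_ge0// exprn_ge0.
  by rewrite normcBC; apply: h1; apply: kap; apply: ltnW.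
rewrite [X in _ - X]/net_mean jn1.
move: a1 a2; move: (grid_mean _ _) (net_mean _ _ _) => g u a1 a2.
rewrite (_ : u - g = (u - beta k x) + (beta k x - g)); last by rewrite addrA subrK.
apply: le_trans (normcD _ _) _; apply: (@le_trans _ _ (C1 / b%:R ^+ j * om x ^+ 2 + C1 / b%:R ^+ j.-1 * om x ^+ 2)).
  exact: lerD.
rewrite -mulrDl ler_wpM2r// mulrDl -[leLHS]addr0 lerD//; last by rewrite divr_ge0 ?exprn_ge0// mulr_ge0.
have -> : b%:R ^+ j = b%:R * b%:R ^+ j.-1 :> R by rewrite {1}jp exprS.
have y0 : 0 < b%:R ^+ j.-1 :> R by rewrite exprn_gt0.
rewrite invfM mulrA (_ : (C1 + C1) * b%:R * _ = C1 / b%:R ^+ j.-1 + C1 / b%:R ^+ j.-1); last first.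
  by field; rewrite !gt_eqF.
by rewrite lerD2r ler_wpM2r ?invr_ge0 ?(ltW y0)// ler_pdivrMr// ler_peMr.
Qed.

End one_coordinate.

Section net_coordinate.
Context {R : realType} {d b s n v : nat}.
Variable M : 'I_d -> 'M['F_b]_(s, n).
Hypothesis bP : prime b.
Hypothesis netM : order_digital_net 1 v M.
Local Notation z := (@digital_net R d b s n M).

Let b0R : 0 < b%:R :> R. Proof. by rewrite ltr0n prime_gt0. Qed.

Lemma net_point_approx j nu i : (j <= n.+1)%N ->
  0 <= z nu 0 i - @net_point R d b s n M j nu i <= b%:R ^- j.
Proof.
move=> jn; rewrite /net_point; case: ifP => [{}jn|_]; last first.
  by rewrite subrr lexx invr_ge0 exprn_ge0// ltW.
have /andP[h1 h2] := digital_net_index (R := R) bP netM nu i jn.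
rewrite subr_ge0 h1/= lerBlDr; apply: (le_trans (ltW h2)).
by rewrite -addn1 natrD mulrDl div1r addrC.
Qed.

Lemma net_point_mono j nu i : (0 < j <= n.+1)%N ->
  @net_point R d b s n M j.-1 nu i <= @net_point R d b s n M j nu i.
Proof.
case: j => //= j jn; have jn' : (j <= n)%N by [].
rewrite /net_point jn'; case: ifP => _.
  by have [] := base_value_mono (R := R) bP netM (fun k => net_digit_lt M bP nu i k) (leqnSn j).
by have /andP[] := digital_net_index (R := R) bP netM nu i jn'.
Qed.

Lemma net_point01 j nu i : (j <= n.+1)%N -> 0 <= @net_point R d b s n M j nu i <= 1.
Proof.
move=> jn; have /andP[h1 _] := net_point_approx nu i jn.
have /andP[_ /ltW h2] := @digital_net01 _ _ _ _ _ M bP netM R nu i.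
apply/andP; split; last by apply: le_trans h2; rewrite -subr_ge0.
rewrite /net_point; case: ifP => _; first by rewrite divr_ge0// exprn_ge0// ltW.
by have /andP[] := @digital_net01 _ _ _ _ _ M bP netM R nu i.
Qed.

End net_coordinate.

Section net_increments.
Context {R : realType}.
Variable phi0 : R -> R[i].
Hypothesis seed : resolution_seed phi0.
Local Notation alpha := (alpha phi0).
Local Notation beta := (beta phi0).
Variable b : nat.
Hypothesis bP : prime b.

(** From level [kappa] on, truncation moves the point by at most [2 ^- k], so [omk_near] recentres
    the kernel at the exact point at the cost of 3. This makes the factor [A i nu] of [net_error_le]
    independent of the level. The factor [b] pays for rounding in [kappa], or for [b ^- j.-1] in
    place of [b ^- j]. *)
Lemma net_increment_le : exists2 C : R, 0 <= C &
  forall d s n v (M : 'I_d -> 'M['F_b]_(s, n)), order_digital_net 1 v M ->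
  forall k x nu i j, let kappa := up_log b (2 ^ k) in
  (kappa <= n)%N -> (kappa <= j <= n.+1)%N ->
  normc (increment (fun j => alpha k (x - net_point M j nu i)) kappa j) <=
  C * 2 ^+ k * om x ^+ 2 / b%:R ^+ j * omk k (x - @digital_net R d b s n M nu 0 i).
Proof.
have [C C0 [h1 h2]] := alpha_estimates seed.
have b1 : (1 < b)%N := prime_gt1 bP.
have b0 : (0 < b)%N := ltnW b1.
have bR : 1 <= b%:R :> R by rewrite ler1n.
have b0R : 0 < b%:R :> R by rewrite ltr0n.
exists (3 * C * b%:R); first by rewrite !mulr_ge0.
move=> d s n v M netM k x nu i j kappa kn /andP[kj jn].
have kap m : (kappa <= m)%N -> 2 ^+ k / b%:R ^+ m <= 1 :> R.
  move=> h; rewrite ler_pdivrMr ?exprn_gt0// mul1r -!natrX ler_nat.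
  by apply: leq_trans (up_logP _ b1) _; rewrite leq_pexp2l.
have o0 w : 0 <= om x ^+ 2 * omk k w by rewrite mulr_ge0 ?omk_ge0// exprn_ge0// om_ge0.
have near m : (kappa <= m)%N -> (m <= n.+1)%N ->
    omk k (x - net_point M m nu i) <= 3 * omk k (x - @digital_net R d b s n M nu 0 i).
  move=> km mn; apply: omk_near; rewrite distrC.
  have /andP[p1 p2] := net_point_approx (R := R) bP netM nu i mn.
  by rewrite ger0_norm//; apply: le_trans (kap m km); rewrite ler_wpM2l ?exprn_ge0.
set zz := digital_net M nu 0 i in near *.
rewrite [leRHS](_ : _ = C * (2 ^+ k * b%:R / b%:R ^+ j) * (om x ^+ 2 * (3 * omk k (x - zz)))); last by ring.
rewrite /increment; case: eqP => [jk|/eqP jk].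
  apply: le_trans (h1 k x _ (net_point01 bP netM nu i jn)) _.
  rewrite -mulrA; apply: ler_pM => //.
    rewrite -[leLHS]mulr1 ler_wpM2l// ler_pdivlMr ?exprn_gt0// mul1r jk.
    by rewrite mulrC; exact: expr_up_log_le.
  by rewrite ler_wpM2l ?exprn_ge0 ?om_ge0//; apply: near => //; rewrite jk.
have {jk}kj : (kappa < j)%N by rewrite ltn_neqAle eq_sym jk.
have jp : j = j.-1.+1 by rewrite prednK// (leq_ltn_trans _ kj).
have jn1 : (j.-1 <= n.+1)%N by rewrite (leq_trans (leq_pred _) jn).
have kj1 : (kappa <= j.-1)%N by rewrite -ltnS -jp.
have mono : net_point M j.-1 nu i <= net_point M j nu i :> R.
  by apply: (net_point_mono bP netM); rewrite jn andbT jp.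
have /andP[_ p2] := net_point_approx (R := R) bP netM nu i jn1.
have /andP[p3 _] := net_point_approx (R := R) bP netM nu i jn.
have dist : `|net_point M j.-1 nu i - net_point M j nu i| <= b%:R ^- j.-1 :> R.
  rewrite distrC ger0_norm ?subr_ge0//; apply: le_trans p2.
  by rewrite lerD2r -subr_ge0.
have k0 : 0 <= 2 ^+ k :> R by rewrite exprn_ge0.
have dist1 : 2 ^+ k * `|net_point M j.-1 nu i - net_point M j nu i| <= 2 ^+ k / b%:R ^+ j.-1 :> R.
  by rewrite ler_wpM2l.
rewrite normcBC; apply: le_trans (h2 k x _ _ (net_point01 bP netM nu i jn1) (le_trans dist1 (kap _ kj1))) _.
rewrite -mulrA; apply: ler_pM => //; first by rewrite !mulr_ge0.
  rewrite ler_wpM2l//; apply: le_trans dist1 _.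
  rewrite -mulrA ler_wpM2l// {2}jp exprS invfM mulrA divff ?gt_eqF// mul1r//.
by rewrite ler_wpM2l ?exprn_ge0 ?om_ge0//; exact: near.
Qed.

End net_increments.

(** * Pointwise bounds of the blocks *)

Section geometric_sums.
Context {R : realType}.

Lemma powR_exprn (x r : R) n : 0 <= x -> (x ^+ n) `^ r = (x `^ r) ^+ n.
Proof.
move=> x0; elim: n => [|n ih]; first by rewrite !expr0 powR1.
by rewrite !exprS powRM ?exprn_ge0// ih.
Qed.

Lemma sum_geo_tail (q : R) j0 m : 0 <= q < 1 ->
  \sum_(j < m | (j0 <= j)%N) q ^+ j <= q ^+ j0 / (1 - q).
Proof.
move=> /andP[q0 q1]; have p0 : 0 < 1 - q by rewrite subr_gt0.
rewrite ler_pdivlMr//.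
suff -> : (\sum_(j < m | (j0 <= j)%N) q ^+ j) * (1 - q) = q ^+ j0 - q ^+ maxn j0 m.
  by rewrite gerBl exprn_ge0.
elim: m => [|m ih]; first by rewrite big_ord0 mul0r maxn0 subrr.
rewrite big_mkcond big_ord_recr/= -big_mkcond/= mulrDl ih.
case: ifP => [jm|/negbT]; last first.
  by rewrite -ltnNge => jm; rewrite mul0r addr0 !(maxn_idPl _)// ltnW.
by rewrite !(maxn_idPr _)//; [rewrite exprS; ring|rewrite leqW].
Qed.

(** Write [b^-1 = p q] with [q = b ^ (- eps)]. The constraint on [|J|] is spent on the powers of
    [p], which give [p ^ n] up to [p ^- v]; the powers of [q] are then summed without it, as
    geometric series from the starting levels on. With [eps = 0] the number of [J] of a given sum
    would cost powers of [n]. *)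
Lemma level_sum_le (d b v : nat) (eps : R) : (1 < b)%N -> 0 < eps < 1 ->
  exists2 C : R, 0 <= C & forall n (k : {ffun 'I_d -> nat}),
  \sum_(J : {ffun 'I_d -> 'I_n.+2} | [forall i, (up_log b (2 ^ k i) <= J i)%N] &&
      (n - v < \sum_i J i)%N) \prod_i b%:R ^- J i <=
  C * (b%:R `^ (- (1 - eps))) ^+ n * (2 ^+ (\sum_i k i)%N) `^ (- eps).
Proof.
move=> b1 /andP[e0 e1].
have b0R : 0 < b%:R :> R by rewrite ltr0n ltnW.
have bR : 1 < b%:R :> R by rewrite ltr1n.
set q := b%:R `^ (- eps); set p := b%:R `^ (- (1 - eps)).
have pq : b%:R^-1 = p * q :> R.
  rewrite -[LHS]powR_inv1 ?ltW// /p /q -powRD; last by rewrite (gt_eqF b0R) implybT.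
  by congr (_ `^ _); ring.
have q0 : 0 < q by rewrite powR_gt0.
have p0 : 0 < p by rewrite powR_gt0.
have q1 : q < 1.
  rewrite /q powRN invf_lt1 ?powR_gt0// /powR gt_eqF// expR_gt1 mulr_gt0//.
  exact: ln_gt0.
have p1 : p <= 1.
  by rewrite /p powRN invf_le1 ?powR_gt0// -[X in X <= _](powRr0 b%:R) ler_powR ?ltW// subr_gt0.
exists (p ^- v * (1 - q)^-1 ^+ d).
  by rewrite mulr_ge0 ?invr_ge0 ?exprn_ge0 ?invr_ge0 ?subr_ge0 ?ltW.
move=> n k.
apply: (@le_trans _ _ (\sum_(J : {ffun 'I_d -> 'I_n.+2} | [forall i, (up_log b (2 ^ k i) <= J i)%N])
    p ^- v * p ^+ n * \prod_i q ^+ J i)).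
  rewrite big_mkcondr/=; apply: ler_sum => J _; case: ifP => Jn; last first.
    by rewrite !mulr_ge0 ?invr_ge0 ?exprn_ge0 ?prodr_ge0 ?ltW// => i _; rewrite exprn_ge0 ?ltW.
  rewrite (eq_bigr (fun i => p ^+ J i * q ^+ J i)); last first.
    by move=> i _; rewrite -exprVn pq exprMn.
  rewrite big_split/= ler_wpM2r//; first by rewrite prodr_ge0// => i _; rewrite exprn_ge0 ?ltW.
  rewrite -expr_sum ler_pdivlMl ?exprn_gt0// -exprD.
  by apply: ler_wiXn2l => //; [exact: ltW|lia].
rewrite -mulr_sumr.
have -> : \sum_(J : {ffun 'I_d -> 'I_n.+2} | [forall i, (up_log b (2 ^ k i) <= J i)%N]) \prod_i q ^+ J i =
    \prod_i \sum_(j < n.+2 | (up_log b (2 ^ k i) <= j)%N) q ^+ j.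
  rewrite bigA_distr_big_dep; apply: eq_bigl => J.
  by apply/idP/idP => [/forallP h|/familyP h]; [apply/familyP|apply/forallP].
have pp : 0 <= p ^- v * p ^+ n by rewrite mulr_ge0 ?invr_ge0 ?exprn_ge0 ?ltW.
rewrite [leRHS](_ : _ = p ^- v * p ^+ n *
  ((1 - q)^-1 ^+ d * (2 ^+ (\sum_i k i)%N) `^ (- eps))); last by ring.
apply: ler_wpM2l => //.
have -> : (1 - q)^-1 ^+ d * (2 ^+ (\sum_i k i)%N) `^ (- eps) =
    \prod_i ((1 - q)^-1 * (2 ^+ k i) `^ (- eps)).
  rewrite big_split/= prodr_const card_ord; congr (_ * _).
  rewrite powR_exprn// expr_sum; apply: eq_bigr => i _.
  by rewrite powR_exprn.
apply: ler_prod => i _; apply/andP; split.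
  by rewrite sumr_ge0// => j _; rewrite exprn_ge0 ?ltW.
apply: le_trans (sum_geo_tail _ _ _) _; first by rewrite ltW.
rewrite mulrC ler_wpM2l ?invr_ge0 ?subr_ge0 ?(ltW q1)//.
rewrite /q -powR_exprn ?(ltW b0R)// !powRN lef_pV2 ?posrE ?powR_gt0 ?exprn_gt0//.
apply: ge0_ler_powR; rewrite ?nnegrE ?exprn_ge0 ?(ltW e0) ?(ltW b0R)//.
by rewrite -!natrX ler_nat; exact: up_logP.
Qed.

End geometric_sums.

(** Raising one entry at a time reaches every total up to that of [kap]. *)
Lemma sub_family (I : finType) (kap : I -> nat) m : (m <= \sum_i kap i)%N ->
  exists2 l : I -> nat, (forall i, (l i <= kap i)%N) & (\sum_i l i = m)%N.
Proof.
elim: m => [_|m ih mk]; first by exists (fun=> 0%N) => //; rewrite big1.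
have [l lk lm] := ih (ltnW mk).
have /existsP[i li] : [exists i, (l i < kap i)%N].
  rewrite -[X in is_true X]negbK; apply/negP; rewrite negb_exists => /forallP h.
  move: mk; rewrite -lm ltnNge => /negP; apply; apply: leq_sum => i _.
  by rewrite leqNgt h.
exists (fun j => (l j + (j == i))%N) => [j|].
  by case: eqP => [->|_]; rewrite ?addn1 ?addn0.
rewrite big_split/= lm (bigD1 i)//= eqxx big1 ?addn0 ?addn1// => j /negbTE ->.
by [].
Qed.

(** * The local counting function of the net *)

Section net_kernel.
Context {R : realType} {d b s n v : nat}.
Variable M : 'I_d -> 'M['F_b]_(s, n).
Hypothesis bP : prime b.
Hypothesis netM : order_digital_net 1 v M.
Local Notation z := (@digital_net R d b s n M).
Local Notation Rd := 'rV[R]_d.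
Local Notation mu := (lebesgue_tuple R d).

Let b1 : (1 < b)%N. Proof. exact: prime_gt1. Qed.
Let b0R : 0 < b%:R :> R. Proof. by rewrite ltr0n prime_gt0. Qed.
Let bR : 1 <= b%:R :> R. Proof. by rewrite ler1n prime_gt0. Qed.

Definition netS (k : {ffun 'I_d -> nat}) (x : Rd) : R :=
  (b ^ n)%:R^-1 * \sum_nu \prod_i omk (k i) (x 0 i - z nu 0 i).

Lemma netS_ge0 k x : 0 <= netS k x.
Proof.
by rewrite mulr_ge0 ?invr_ge0// sumr_ge0// => nu _; rewrite prodr_ge0// => i _; exact: omk_ge0.
Qed.

(** Since [b ^ l <= b * 2 ^ k], the left side is at most [om (b ^ l u / b)]. Removing the division
    costs [b ^ 2], and moving to [w] costs 3. *)
Let om_coarse k l (u w : R) : (l <= up_log b (2 ^ k))%N -> `|b%:R ^+ l * u - w| <= 1 ->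
  om (2 ^+ k * u) <= 3 * b%:R ^+ 2 * om w.
Proof.
move=> lk uw; apply: (@le_trans _ _ (om (b%:R ^+ l * u / b%:R))).
  apply: om_mono; rewrite mulrAC !normrM ler_wpM2r// -normrM.
  rewrite !ger0_norm ?divr_ge0 ?exprn_ge0 ?(ltW b0R)// ler_pdivrMr// mulrC.
  apply: le_trans (expr_up_log_le k b1).
  by rewrite -!natrX ler_nat leq_pexp2l// ltnW.
apply: (le_trans (om_div _ bR)).
rewrite [leRHS](_ : _ = b%:R ^+ 2 * (3 * om w)); last by ring.
by apply: ler_wpM2l; [rewrite exprn_ge0// ltW|exact: om_near].
Qed.

(** Each factor is dominated by a kernel that sees the coordinate only through its index at the
    coarser level [l i]. Then [net_average] turns the mean over the net into a product of grid sums,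
    which [om_sum] bounds. *)
Let netS_level (k : {ffun 'I_d -> nat}) (l : 'I_d -> nat) x :
  (forall i, (l i <= up_log b (2 ^ k i))%N) -> (\sum_i l i <= n - v)%N ->
  netS k x <= (3 * b%:R ^+ 2 * (6 * pi)) ^+ d / b%:R ^+ (\sum_i l i)%N.
Proof.
move=> lk ln.
pose g i m : R := 3 * b%:R ^+ 2 * (om (b%:R ^+ l i * x 0 i - m%:R) + om (b%:R ^+ l i * (x 0 i - 1) - m%:R)).
have lin i : (l i <= n)%N.
  by apply: leq_trans (leq_trans ln (leq_subr _ _)); rewrite (bigD1 i)//= leq_addr.
apply: (@le_trans _ _ ((b ^ n)%:R^-1 * \sum_nu \prod_i g i (net_index M (l i) nu i))).
  rewrite ler_wpM2l ?invr_ge0//; apply: ler_sum => nu _; apply: ler_prod => i _.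
  rewrite omk_ge0/= /omk /g [leRHS]mulrDr.
  have /andP[h1 h2] := digital_net_index (R := R) bP netM nu i (lin i).
  have bl0 : 0 < b%:R ^+ l i :> R by rewrite exprn_gt0.
  move: h1 h2; rewrite ler_pdivrMr// ltr_pdivlMr// => h1 h2.
  have h3 : `|(net_index M (l i) nu i)%:R - z nu 0 i * b%:R ^+ l i| <= 1.
    rewrite distrC ger0_norm ?subr_ge0// lerBlDr -[X in X + _]/(1%:R) -natrD add1n; exact: ltW.
  apply: lerD; apply: om_coarse (lk i) _.
    by rewrite (_ : _ - _ = (net_index M (l i) nu i)%:R - z nu 0 i * b%:R ^+ l i)//; ring.
  by rewrite (_ : _ - _ = (net_index M (l i) nu i)%:R - z nu 0 i * b%:R ^+ l i)//; ring.
rewrite (net_average bP netM g ln).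
have -> : (3 * b%:R ^+ 2 * (6 * pi)) ^+ d / b%:R ^+ (\sum_i l i)%N =
    \prod_i (3 * b%:R ^+ 2 * (6 * pi) / b%:R ^+ l i) :> R.
  by rewrite big_split/= prodr_const card_ord prodfV expr_sum.
apply: ler_prod => i _; apply/andP; split.
  rewrite mulr_ge0 ?invr_ge0// sumr_ge0// => m _.
  by rewrite !mulr_ge0 ?exprn_ge0 ?(ltW b0R)// addr_ge0 ?om_ge0.
rewrite natrX mulrC ler_wpM2r ?invr_ge0 ?exprn_ge0 ?(ltW b0R)//.
rewrite /g -mulr_sumr ler_wpM2l ?mulr_ge0 ?exprn_ge0 ?(ltW b0R)// big_split/=.
have h01 : (0 <= (1 : R)) && ((1 : R) <= 1) by apply/andP; split; [exact: ler01|exact: lexx].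
have h (y : R) : \sum_(m < b ^ l i) om (y - m%:R) <= 3 * pi.
  by have := om_sum y (b ^ l i) h01; under eq_bigr do rewrite mul1r mulr1.
by rewrite (_ : 6 * pi = 3 * pi + 3 * pi :> R); [exact: lerD|ring].
Qed.

(** Let [kap i] be the level of [2 ^ k i]. If [|kap| <= n - v], the choice [l = kap] gives
    [2 ^- |k|]. Otherwise [kap] is lowered to a family of sum exactly [n - v], the finest total
    level at which equidistribution is available; this gives [b ^- n] and explains the constant
    [b ^ v]. *)
Lemma netS_le (k : {ffun 'I_d -> nat}) x :
  netS k x <= (3 * b%:R ^+ 2 * (6 * pi)) ^+ d * b%:R ^+ v *
    Num.max (2 ^- (\sum_i k i)%N) (b%:R ^- n).
Proof.
set D := (_ ^+ d); have D0 : 0 <= D.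
  by rewrite exprn_ge0// !mulr_ge0 ?exprn_ge0 ?(ltW b0R)// pi_ge0.
have bv : 1 <= b%:R ^+ v :> R by rewrite exprn_ege1.
rewrite -mulrA; pose kap i := up_log b (2 ^ k i).
have [h|/ltnW h] := leqP (\sum_i kap i)%N (n - v)%N.
  apply: (le_trans (@netS_level k kap x (fun=> leqnn _) h)); rewrite ler_wpM2l//.
  apply: (@le_trans _ _ (2 ^- (\sum_i k i)%N)).
    rewrite lef_pV2 ?posrE ?exprn_gt0// !expr_sum; apply: ler_prod => i _.
    by rewrite exprn_ge0//= -!natrX ler_nat; exact: up_logP.
  apply: (@le_trans _ _ (Num.max (2 ^- (\sum_i k i)%N) (b%:R ^- n))).
    by rewrite le_max lexx.
  by rewrite ler_peMl// le_max invr_ge0 exprn_ge0.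
have [l lk lm] := sub_family h.
apply: (le_trans (@netS_level k l x lk _)); rewrite lm//.
rewrite ler_wpM2l//; apply: (@le_trans _ _ (b%:R ^+ v / b%:R ^+ n)).
  rewrite ler_pdivlMr ?exprn_gt0// ler_pdivrMl ?exprn_gt0// -exprD.
  by rewrite ler_weXn2l//; lia.
by rewrite ler_wpM2l ?exprn_ge0 ?(ltW b0R)// le_max lexx orbT.
Qed.

Lemma netS_integral (k : {ffun 'I_d -> nat}) :
  mu.-integrable setT (fun t => (netS k (vec_of t))%:E) /\
  Rintegral mu setT (fun t => netS k (vec_of t)) = (2 * pi) ^+ d / 2 ^+ (\sum_i k i)%N.
Proof.
have i1 j (w : R) : (@lebesgue_measure R).-integrable setT (EFin \o (fun x => omk j (x - w))) /\
    Rintegral (@lebesgue_measure R) setT (fun x => omk j (x - w)) = 2 * pi / 2 ^+ j.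
  have j0 : 0 < 2 ^+ j :> R by rewrite exprn_gt0.
  have [I1 E1] := integral_om_scale w j0; have [I2 E2] := integral_om_scale (w + 1) j0.
  have e x : omk j (x - w) = om (2 ^+ j * (x - w)) + om (2 ^+ j * (x - (w + 1))).
    by rewrite /omk opprD addrA.
  split.
    rewrite [X in _.-integrable _ X](_ : _ = ((fun x => (om (2 ^+ j * (x - w)))%:E) \+ (fun x => (om (2 ^+ j * (x - (w + 1))))%:E))%E).
      exact: integrableD.
    by apply/funext => x /=; rewrite e.
  under eq_Rintegral do rewrite e.
  by rewrite RintegralD//= E1 E2; ring.
have i2 nu := tensor_Rintegral (fun i => proj1 (i1 (k i) (z nu 0 i))).
have e t : netS k (vec_of t) = (b ^ n)%:R^-1 * \sum_nu \prod_i omk (k i) (tnth t i - z nu 0 i).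
  congr (_ * _); apply: eq_bigr => nu _; apply: eq_bigr => i _.
  by rewrite vec_ofE.
pose F nu (t : d.-tuple (measurableTypeR R)) : R[i] :=
  (\prod_i omk (k i) (tnth t i - z nu 0 i))%:C.
have iF nu : cintble mu (F nu) by apply: cintble_real; exact: (proj1 (i2 nu)).
have iS : cintble mu (fun t => \sum_nu F nu t) by exact: cintble_sum.
have eF t : (netS k (vec_of t))%:C = ((b ^ n)%:R^-1)%:C * \sum_nu F nu t.
  by rewrite e rmorphM rmorph_sum.
have eF' : (fun t => (netS k (vec_of t))%:C) = (fun t => ((b ^ n)%:R^-1)%:C * \sum_nu F nu t).
  by apply/funext.
split.
  by have := cintbleZ (((b ^ n)%:R^-1)%:C : R[i]) iS; rewrite -eF' => -[].
suff : (Rintegral mu setT (fun t => netS k (vec_of t)))%:C =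
    ((2 * pi) ^+ d / 2 ^+ (\sum_i k i)%N)%:C :> R[i] by move=> /(congr1 (@complex.Re R)).
rewrite -cint_real eF' cintZ// cint_sum//.
rewrite (eq_bigr (fun=> ((2 * pi) ^+ d / 2 ^+ (\sum_i k i)%N)%:C)) => [|nu _]; last first.
  rewrite cint_real (proj2 (i2 nu)); congr (_%:C).
  rewrite (eq_bigr _ (fun i _ => proj2 (i1 (k i) (z nu 0 i)))).
  by rewrite big_split/= prodr_const card_ord prodfV expr_sum.
rewrite sumr_const card_ord -rmorphMn -rmorphM; congr (_%:C) => /=.
rewrite -[X in _ * X]mulr_natl mulrA mulVf ?mul1r//.
by rewrite pnatr_eq0 expn_eq0 negb_and -lt0n (ltnW b1).
Qed.

End net_kernel.

(** * Bounds of the blocks with and without cancellation *)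

Section block_bound.
Context {R : realType} {d : nat}.
Variable phi0 : R -> R[i].
Hypothesis seed : resolution_seed phi0.
Variables b v : nat.
Hypothesis bP : prime b.
Local Notation Rd := 'rV[R]_d.
Variable eps : R.
Hypothesis eps01 : 0 < eps < 1.

Let b1 : (1 < b)%N. Proof. exact: prime_gt1. Qed.
Let b0R : 0 < b%:R :> R. Proof. by rewrite ltr0n prime_gt0. Qed.

Let block_le1 : exists2 C : R, 0 <= C & forall n s (M : 'I_d -> 'M['F_b]_(s, n)),
  order_digital_net 1 v M -> forall k (x : Rd),
  normc (net_block phi0 (@digital_net R d b s n M) k x) <=
  C * (om_prod x ^+ 2 * (netS M k x + 2 ^- (\sum_i k i)%N)).
Proof.
have [C1 C10 [h1 _]] := alpha_estimates seed; have [C2 C20 h2] := beta_le seed.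
exists (C1 ^+ d + C2 ^+ d); first by rewrite addr_ge0// exprn_ge0.
move=> n s M netM k x; apply: le_trans (normcB _ _) _.
have W0 : 0 <= om_prod x ^+ 2 by rewrite exprn_ge0// om_prod_ge0.
have S0 := netS_ge0 M k x.
have p0 : 0 <= 2 ^- (\sum_i k i)%N :> R by rewrite invr_ge0 exprn_ge0.
apply: (@le_trans _ _ (C1 ^+ d * (om_prod x ^+ 2 * netS M k x) +
    C2 ^+ d * (om_prod x ^+ 2 * 2 ^- (\sum_i k i)%N))); last first.
  rewrite -subr_ge0 (_ : _ - _ = C1 ^+ d * (om_prod x ^+ 2 * 2 ^- (\sum_i k i)%N) +
      C2 ^+ d * (om_prod x ^+ 2 * netS M k x)); last by ring.
  by apply: addr_ge0; (apply: mulr_ge0; [exact: exprn_ge0|exact: mulr_ge0]).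
have e (C : R) (F : 'I_d -> R) : \prod_i (C * om (x 0 i) ^+ 2 * F i) =
    C ^+ d * (om_prod x ^+ 2 * \prod_i F i).
  by rewrite big_split/= big_split/= prodr_const card_ord prodrXl mulrA.
apply: lerD; last first.
  have -> : 2 ^- (\sum_i k i)%N = \prod_i 2 ^- k i :> R by rewrite prodfV expr_sum.
  rewrite -e normc_prod; apply: ler_prod => i _; rewrite normc_ge0/=.
  by apply: (le_trans (h2 (k i) (x 0 i))); rewrite mulrAC.
rewrite normcM normc_real ger0_norm ?invr_ge0// /netS [leRHS](_ : _ = (b ^ n)%:R^-1 *
  \sum_nu C1 ^+ d * (om_prod x ^+ 2 * \prod_i omk (k i) (x 0 i - @digital_net R d b s n M nu 0 i))); last first.
  rewrite -mulr_sumr -mulr_sumr; ring.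
rewrite ler_wpM2l ?invr_ge0//; apply: le_trans (normc_sum _ _ _) _; apply: ler_sum => nu _.
rewrite -e normc_prod; apply: ler_prod => i _; rewrite normc_ge0/=.
by apply: h1; have /andP[-> /ltW ->] := digital_net01 (R := R) bP netM nu i.
Qed.

(** [net_error_le] with the starting levels [up_log b (2 ^ k i)], which therefore have to be at most
    [n]. The factors [L i] contribute [2 ^ |k|], the level sum contributes [b ^ (- (1 - eps) n)] and
    [2 ^ (- eps |k|)], and together they are a power of [2 ^ |k| / b ^ n]. *)
Let block_le2 : exists2 C : R, 0 <= C & forall n s (M : 'I_d -> 'M['F_b]_(s, n)),
  order_digital_net 1 v M -> forall (k : {ffun 'I_d -> nat}) (x : Rd),
  (forall i, (up_log b (2 ^ k i) <= n)%N) ->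
  normc (net_block phi0 (@digital_net R d b s n M) k x) <=
  C * ((2 ^+ (\sum_i k i)%N / b%:R ^+ n) `^ (1 - eps)) *
  (om_prod x ^+ 2 * (netS M k x + 2 ^- (\sum_i k i)%N)).
Proof.
have [C1 C10 h1] := net_increment_le seed bP.
have [C2 C20 h2] := net_mean_increment_le seed b1.
have [C3 C30 h3] := level_sum_le d v b1 eps01.
exists ((C1 + C2) ^+ d * C3); first by rewrite mulr_ge0 ?exprn_ge0 ?addr_ge0.
move=> n s M netM k x kn.
pose L i := (C1 + C2) * 2 ^+ k i * om (x 0 i) ^+ 2.
pose A i nu := omk (k i) (x 0 i - @digital_net R d b s n M nu 0 i).
pose E (i : 'I_d) : R := 2 ^- k i.
have Lge i j (C : R) : C <= C1 + C2 ->
    C * 2 ^+ k i * om (x 0 i) ^+ 2 / b%:R ^+ j <= L i / b%:R ^+ j.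
  move=> h; rewrite ler_wpM2r ?invr_ge0 ?exprn_ge0 ?(ltW b0R)// ler_wpM2r ?exprn_ge0 ?om_ge0//.
  by rewrite ler_wpM2r ?exprn_ge0.
have hA i nu j : (up_log b (2 ^ k i) <= j <= n.+1)%N ->
    normc (increment (fun j => alpha phi0 (k i) (x 0 i - net_point M j nu i)) (up_log b (2 ^ k i)) j) <=
    L i / b%:R ^+ j * A i nu.
  move=> hj; apply: (le_trans (h1 d s n v M netM (k i) (x 0 i) nu i j (kn i) hj)).
  by rewrite ler_wpM2r ?omk_ge0// Lge// lerDl.
have hE i j : (up_log b (2 ^ k i) <= j <= n.+1)%N ->
    normc (increment (@net_mean R b n (fun w => alpha phi0 (k i) (x 0 i - w)) (beta phi0 (k i) (x 0 i))) (up_log b (2 ^ k i)) j) <=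
    L i / b%:R ^+ j * E i.
  move=> hj; apply: (le_trans (h2 n (k i) (x 0 i) j (kn i) hj)).
  by rewrite ler_wpM2r ?invr_ge0 ?exprn_ge0// Lge// lerDr.
have := net_error_le bP netM kn hA hE.
have -> : (b ^ n)%:R^-1 * \sum_nu \prod_i alpha phi0 (k i) (x 0 i - @digital_net R d b s n M nu 0 i) -
    \prod_i beta phi0 (k i) (x 0 i) = net_block phi0 (@digital_net R d b s n M) k x.
  by rewrite /net_block fmorphV/= rmorph_nat.
move=> h; apply: (le_trans h).
have -> : \prod_i L i = (C1 + C2) ^+ d * 2 ^+ (\sum_i k i)%N * om_prod x ^+ 2.
  by rewrite big_split/= big_split/= prodr_const card_ord prodrXl expr_sum.
have -> : (b ^ n)%:R^-1 * \sum_nu \prod_i A i nu + \prod_i E i =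
    netS M k x + 2 ^- (\sum_i k i)%N.
  by rewrite prodfV expr_sum.
have X0 : 0 <= om_prod x ^+ 2 * (netS M k x + 2 ^- (\sum_i k i)%N).
  by rewrite mulr_ge0 ?exprn_ge0 ?om_prod_ge0// addr_ge0 ?netS_ge0// invr_ge0 exprn_ge0.
move: X0; set S := netS M k x + _; set W := om_prod x ^+ 2; move=> X0.
rewrite [leLHS](_ : _ = (C1 + C2) ^+ d * (W * S) * (2 ^+ (\sum_i k i)%N *
  (\sum_(J : {ffun 'I_d -> 'I_n.+2} | [forall i, (up_log b (2 ^ k i) <= J i)%N] &&
      (n - v < \sum_i J i)%N) \prod_i b%:R ^- J i))); last by ring.
rewrite [leRHS](_ : _ = (C1 + C2) ^+ d * (W * S) *
  (C3 * (2 ^+ (\sum_i k i)%N / b%:R ^+ n) `^ (1 - eps))); last by ring.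
apply: ler_wpM2l; first by rewrite mulr_ge0// exprn_ge0// addr_ge0.
apply: le_trans (ler_wpM2l _ (h3 n k)) _; first by rewrite exprn_ge0.
rewrite le_eqVlt; apply/orP; left; apply/eqP.
have y0 : 0 < 2 ^+ (\sum_i k i)%N :> R by rewrite exprn_gt0.
have -> : (2 ^+ (\sum_i k i)%N / b%:R ^+ n) `^ (1 - eps) =
    2 ^+ (\sum_i k i)%N * (2 ^+ (\sum_i k i)%N) `^ (- eps) * (b%:R `^ (- (1 - eps))) ^+ n.
  rewrite powRM ?invr_ge0 ?exprn_ge0 ?(ltW b0R)//; congr (_ * _).
    rewrite powRD; last by rewrite (gt_eqF y0) implybT.
    by rewrite powRr1// ltW.
  rewrite -exprVn powR_exprn ?invr_ge0 ?(ltW b0R)//; congr (_ ^+ _).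
  by rewrite -[in LHS]powR_inv1 ?(ltW b0R)// -powRrM mulN1r.
ring.
Qed.

(** If the minimum is 1, the bound without cancellation suffices; if all starting levels are at most
    [n], the quadrature bound applies. Otherwise a single [2 ^ k j] is already at least [b ^ n / b],
    so the minimum is at least [1 / b], and the first bound is used again at the cost of [b]. *)
Lemma block_le : exists2 C : R, 0 <= C & forall n s (M : 'I_d -> 'M['F_b]_(s, n)),
  order_digital_net 1 v M -> forall (k : {ffun 'I_d -> nat}) (x : Rd),
  normc (net_block phi0 (@digital_net R d b s n M) k x) <=
  C * Num.min 1 ((2 ^+ (\sum_i k i)%N / b%:R ^+ n) `^ (1 - eps)) *
  (om_prod x ^+ 2 * (netS M k x + 2 ^- (\sum_i k i)%N)).
Proof.
have [C1 C10 h1] := block_le1; have [C2 C20 h2] := block_le2.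
have [e0 e1] := andP eps01.
have bR : 1 <= b%:R :> R by rewrite ler1n prime_gt0.
exists (C1 * b%:R + C2); first by rewrite addr_ge0// mulr_ge0.
move=> n s M netM k x.
have X0 : 0 <= om_prod x ^+ 2 * (netS M k x + 2 ^- (\sum_i k i)%N).
  by rewrite mulr_ge0 ?exprn_ge0 ?om_prod_ge0// addr_ge0 ?netS_ge0// invr_ge0 exprn_ge0.
have {}h1 := h1 n s M netM k x; have {}h2 := h2 n s M netM k x.
set y := 2 ^+ _ / _ in h2 *; set X := om_prod x ^+ 2 * _ in X0 h1 h2 *.
have y0 : 0 <= y by rewrite divr_ge0 ?exprn_ge0// ltW.
have [y1|y1] := leP 1 (y `^ (1 - eps)).
  apply: (le_trans h1); rewrite ler_wpM2r// mulr1 -[leLHS]addr0 lerD//.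
  by rewrite ler_peMr.
have [kn|] := boolP [forall i, (up_log b (2 ^ k i) <= n)%N].
  apply: le_trans (h2 (fun i => forallP kn i)) _; rewrite ler_wpM2r// ler_wpM2r ?powR_ge0// lerDr.
  by rewrite mulr_ge0.
move=> /forallPn[j]; rewrite -ltnNge => kn.
have yb : b%:R^-1 <= y.
  rewrite /y ler_pdivlMr ?exprn_gt0// mulrC ler_pdivrMr// mulrC.
  apply: (@le_trans _ _ (b%:R ^+ up_log b (2 ^ k j))).
    by rewrite -!natrX ler_nat leq_pexp2l// ?prime_gt0// ltnW.
  apply: le_trans (expr_up_log_le (k j) b1) _.
  rewrite ler_wpM2l// ler_weXn2l ?ler1n//.
  by rewrite (bigD1 j)//= leq_addr.
have yb' : b%:R^-1 <= y `^ (1 - eps).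
  apply: (@le_trans _ _ (b%:R^-1 `^ (1 - eps))); last first.
    by apply: ge0_ler_powR; rewrite ?nnegrE ?invr_ge0 ?subr_ge0 ?(ltW e1).
  rewrite -[X in X <= _]powRr1 ?invr_ge0// -!powR_inv1// -!powRrM.
  by rewrite ler_powR// !mulN1r lerN2; lra.
apply: (le_trans h1); rewrite ler_wpM2r// mulrDl -[leLHS]addr0 lerD ?mulr_ge0 ?powR_ge0//.
by rewrite -mulrA ler_peMr// mulrC -ler_pdivrMr// mul1r.
Qed.

End block_bound.

(** * Summation over the blocks *)

Section sums_over_levels.
Context {R : realType} {d : nat}.
Local Notation K := {ffun 'I_d -> nat}.

(** A finite set of multi-indices lies in a box, over which the sum of products is a product of
    sums. *)
Lemma sum_box_le (F : 'I_d -> nat -> R) (c : 'I_d -> R) (s : seq K) :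
  (forall i j, 0 <= F i j) -> (forall i m, \sum_(j < m) F i j <= c i) ->
  uniq s -> \sum_(k <- s) \prod_i F i (k i) <= \prod_i c i.
Proof.
move=> F0 Fc us.
have [m hm] : exists m, forall k, k \in s -> forall i, (k i < m.+1)%N.
  exists (\max_(k <- s) \max_i k i)%N => k ks i; rewrite ltnS.
  apply: leq_trans (leq_bigmax i) _.
  by rewrite (big_rem k)//= leq_maxl.
pose h (k : K) : {ffun 'I_d -> 'I_m.+1} := [ffun i => inord (k i)].
have hK k i : k \in s -> h k i = k i :> nat by move=> ks; rewrite ffunE inordK// hm.
have hinj : {in s &, injective h}.
  by move=> k k' ks k's e; apply/ffunP => i; rewrite -(hK k i ks) e hK.
rewrite (eq_big_seq (fun k => \prod_i F i (h k i))); last first.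
  by move=> k ks; apply: eq_bigr => i _; rewrite hK.
rewrite -(big_map h xpredT (fun f => \prod_i F i (f i))).
rewrite big_uniq ?map_inj_in_uniq//=.
apply: (@le_trans _ _ (\sum_(f : {ffun 'I_d -> 'I_m.+1}) \prod_i F i (f i))).
  rewrite big_mkcond; apply: ler_sum => f _; case: ifP => // _.
  by rewrite prodr_ge0.
rewrite -(bigA_distr_bigA (fun i (j : 'I_m.+1) => F i j)); apply: ler_prod => i _.
by rewrite Fc sumr_ge0.
Qed.

Lemma sum_geo_le (q : R) m : 0 <= q < 1 -> \sum_(j < m) q ^+ j <= (1 - q)^-1.
Proof.
move=> q01; have := sum_geo_tail 0 m q01; rewrite expr0 mul1r.
by congr (_ <= _); apply: eq_bigl.
Qed.

Lemma sum_dist_le (q : R) L m : 0 <= q < 1 ->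
  \sum_(j < m) q ^+ ((j - L) + (L - j))%N <= 2 * (1 - q)^-1.
Proof.
move=> q01; have /andP[q0 q1] := q01.
apply: (@le_trans _ _ (\sum_(j < L + m) q ^+ ((j - L) + (L - j))%N)).
  by rewrite addnC big_split_ord/= lerDl sumr_ge0// => j _; rewrite exprn_ge0.
rewrite big_split_ord/= mulr_natl mulr2n; apply: lerD.
  apply: le_trans (sum_geo_le L q01); rewrite (reindex_inj rev_ord_inj)/=.
  apply: ler_sum => j _; apply: ler_wiXn2l => //; first exact: ltW.
  by have := ltn_ord j; lia.
apply: le_trans (sum_geo_le m q01); apply: ler_sum => j _.
by apply: ler_wiXn2l => //; [exact: ltW|lia].
Qed.

Lemma sum_indicator_le L m : \sum_(j < m) ((j <= L)%N%:R : R) <= L.+1%:R.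
Proof.
apply: (@le_trans _ _ (\sum_(j < m + L.+1) ((j <= L)%N%:R : R))).
  by rewrite big_split_ord/= lerDl sumr_ge0.
rewrite addnC big_split_ord/= [X in _ + X]big1 => [|j _]; last first.
  by rewrite leqNgt ltnS leq_addr.
rewrite addr0 (eq_bigr (fun=> 1)) => [|j _]; last by rewrite -ltnS ltn_ord.
by rewrite sumr_const card_ord.
Qed.

(** Replacing one coordinate of [k] by [|k|] is injective. For [|k| <= 2 L] the distance of this new
    coordinate to [L] is summed geometrically, and each of the other [d - 1] coordinates has at most
    [2 L + 1 <= 3 L] values. For [|k| > 2 L] the doubled exponent is at least [|k|], which leaves a
    convergent product of geometric series. *)
Lemma sum_peak (q : R) : (0 < d)%N -> 0 < q < 1 -> exists2 C : R, 0 <= C &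
  forall L (s : seq K), (0 < L)%N -> uniq s ->
  \sum_(k <- s) q ^+ (2 * ((\sum_i k i - L) + (L - \sum_i k i)))%N <= C * L%:R ^+ d.-1.
Proof.
have c_ge0 (u : R) e : 0 <= u -> 0 <= 2 * u * 3 ^+ e + u ^+ d.
  move=> u0; apply: addr_ge0; last by apply: exprn_ge0.
  by apply: mulr_ge0; [apply: mulr_ge0|apply: exprn_ge0].
move=> d0 /andP[q0 q1]; have q01 : 0 <= q < 1 by rewrite ltW.
pose i0 : 'I_d := Ordinal d0.
have p0 : 0 <= (1 - q)^-1 by rewrite invr_ge0 subr_ge0 ltW.
exists (2 * (1 - q)^-1 * 3 ^+ d.-1 + (1 - q)^-1 ^+ d).
  exact: c_ge0.
move=> L s L0 us.
pose G (i : 'I_d) (j : nat) : R := if i == i0 then q ^+ ((j - L) + (L - j))%N else (j <= 2 * L)%N%:R.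
have G_ge0 i j : 0 <= G i j.
  by rewrite /G; case: ifP => _; [apply: exprn_ge0; exact: ltW|exact: ler0n].
pose h (k : K) : K := [ffun i => if i == i0 then (\sum_i k i)%N else k i].
have hinj : injective h.
  move=> k k' e; have e1 i : i != i0 -> k i = k' i.
    by move=> ii0; have := congr1 (fun f : K => f i) e; rewrite !ffunE (negbTE ii0).
  have e2 : (\sum_i k i = \sum_i k' i)%N.
    by have := congr1 (fun f : K => f i0) e; rewrite !ffunE eqxx.
  apply/ffunP => i; have [->|] := eqVneq i i0; last exact: e1.
  have e3 : (\sum_(i | i != i0) k i = \sum_(i | i != i0) k' i)%N by apply: eq_bigr => j; exact: e1.
  move: e2; rewrite (bigD1 i0)//= e3 [in RHS](bigD1 i0)//=; exact: addIn.
have term (k : K) : q ^+ (2 * ((\sum_i k i - L) + (L - \sum_i k i)))%N <=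
    \prod_i G i (h k i) + \prod_i q ^+ (k i).
  have [k2|k2] := leqP (\sum_i k i)%N (2 * L)%N.
    rewrite -[leLHS]addr0; apply: lerD; last by rewrite prodr_ge0// => i _; rewrite exprn_ge0 ?ltW.
    have G0 : G i0 (h k i0) = q ^+ ((\sum_i k i - L) + (L - \sum_i k i))%N.
      by rewrite /G eqxx ffunE eqxx.
    have G1 i : i != i0 -> G i (h k i) = 1.
      move=> ii0; rewrite /G (negbTE ii0) ffunE (negbTE ii0).
      by rewrite (leq_trans _ k2)// (bigD1 i)//= leq_addr.
    have -> : \prod_i G i (h k i) = G i0 (h k i0) by rewrite (bigD1 i0)//= [X in _ * X]big1 ?mulr1.
    rewrite G0.
    by apply: ler_wiXn2l; [exact: ltW|exact: ltW|lia].
  rewrite -[leLHS]add0r; apply: lerD.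
    by rewrite prodr_ge0// => i _; exact: G_ge0.
  by rewrite -expr_sum; apply: ler_wiXn2l; [exact: ltW|exact: ltW|lia].
apply: le_trans (ler_sum _ (fun k _ => term k)) _.
have LR : 1 <= L%:R :> R by rewrite ler1n.
rewrite big_split/= mulrDl; apply: lerD.
  rewrite -(big_map h xpredT (fun f => \prod_i G i (f i))).
  pose c i : R := if i == i0 then 2 * (1 - q)^-1 else 3 * L%:R.
  apply: le_trans (@sum_box_le G c _ _ _ _) _.
  - exact: G_ge0.
  - move=> i m; rewrite /G /c; case: ifP => _; first exact: sum_dist_le.
    apply: le_trans (sum_indicator_le _ _) _.
    by rewrite -natrM ler_nat; lia.
  - by rewrite map_inj_uniq.
  rewrite (bigD1 i0)//= {1}/c eqxx (eq_bigr (fun=> 3 * L%:R)); last first.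
    by move=> i ii0; rewrite /c (negbTE ii0).
  by rewrite prodr_const cardC1 card_ord exprMn mulrA.
apply: le_trans (@sum_box_le (fun _ j => q ^+ j) (fun=> (1 - q)^-1) s _ _ us) _.
- by move=> i j; rewrite exprn_ge0// ltW.
- by move=> i m; exact: sum_geo_le.
rewrite prodr_const card_ord ler_peMr ?exprn_ge0//.
by rewrite exprn_ege1.
Qed.

Lemma sum_tau_le (b : nat) (delta : R) : (0 < d)%N -> (1 < b)%N -> 0 < delta ->
  exists2 C : R, 0 < C & forall n (s : seq K), (0 < n)%N -> uniq s ->
  \sum_(k <- s) (Num.min (2 ^+ (\sum_i k i)%N / b%:R ^+ n)
                         (b%:R ^+ n / 2 ^+ (\sum_i k i)%N)) `^ delta <=
  C * n%:R ^+ d.-1.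
Proof.
move=> d0 b1 delta0.
have b0R : 0 < b%:R :> R by rewrite ltr0n ltnW.
(* Half of [delta], because [sum_peak] doubles the exponent. *)
pose q : R := 2^-1 `^ (delta / 2).
have q01 : 0 < q < 1.
  rewrite powR_gt0 ?invr_gt0//=.
  rewrite /q /powR gt_eqF ?invr_gt0// expR_lt1 pmulr_rlt0 ?divr_gt0// lnV ?posrE// oppr_lt0.
  by apply: ln_gt0; rewrite ltr1n.
have [C C0 h] := sum_peak d0 q01.
exists ((2 `^ delta * C + 1) * b%:R ^+ d.-1).
  by rewrite mulr_gt0 ?exprn_gt0// ltr_wpDl// mulr_ge0// powR_ge0.
(* Rounding the binary logarithm of [b ^ n] up to [L] costs the factor [2 ^ delta]. From
   [b ^ n <= 2 ^ (b n)] follows [L <= b n], hence the constant [b ^ (d - 1)]. *)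
move=> n s n0 us; pose L := up_log 2 (b ^ n).
have bn1 : (1 < b ^ n)%N by rewrite -[1%N](expn0 b) ltn_exp2l.
have L0 : (0 < L)%N by rewrite up_log_gt0.
have Lb : (L <= b * n)%N.
  by apply: up_log_min => //; rewrite expnM leq_exp2r// ltnW// ltn_expl.
have /andP[L1 L2] := up_log_bounds (isT : (1 < 2)%N) bn1.
rewrite -/L in L1 L2.
have term (k : K) : (Num.min (2 ^+ (\sum_(i < d) k i)%N / b%:R ^+ n)
    (b%:R ^+ n / 2 ^+ (\sum_(i < d) k i)%N)) `^ delta <=
    2 `^ delta * q ^+ (2 * ((\sum_i k i - L) + (L - \sum_i k i)))%N.
  rewrite exprM -[q ^+ 2]powR_mulrn ?powR_ge0// -powRrM divfK// -powR_exprn ?invr_ge0// -powRM ?exprn_ge0 ?invr_ge0//.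
  apply: ge0_ler_powR; rewrite ?nnegrE ?(ltW delta0)//.
  move: (\sum_i k i)%N => t; rewrite ge_min.
  have b2 : 2 ^+ L <= 2 * b%:R ^+ n :> R.
    by rewrite -(prednK L0) exprS ler_wpM2l// -!natrX ler_nat ltnW.
  have b3 : b%:R ^+ n <= 2 ^+ L :> R by rewrite -!natrX ler_nat.
  have [tL|/ltnW tL] := leqP t L.
    apply/orP; left; rewrite (_ : t - L + (L - t) = L - t)%N; last by lia.
    rewrite ler_pdivrMr ?exprn_gt0// exprVn.
    rewrite -(ler_pM2r (_ : 0 < 2 ^+ (L - t)))//.
    rewrite -exprD subnKC// mulrAC divfK// gt_eqF//.
  apply/orP; right; rewrite (_ : t - L + (L - t) = t - L)%N; last by lia.
  rewrite ler_pdivrMr ?exprn_gt0// exprVn.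
  have -> : 2 ^+ t = 2 ^+ (t - L) * 2 ^+ L :> R by rewrite -exprD subnK.
  rewrite mulrA divfK ?gt_eqF//.
  by rewrite (le_trans b3)// ler_peMl// ler1n.
apply: le_trans (ler_sum _ (fun k _ => term k)) _.
rewrite -mulr_sumr; apply: le_trans (ler_wpM2l (powR_ge0 _ _) (h L s L0 us)) _.
rewrite -mulrA -exprMn mulrA; apply: ler_pM.
- by rewrite mulr_ge0// powR_ge0.
- by rewrite exprn_ge0.
- by rewrite lerDl.
- by apply: lerXn2r; rewrite ?nnegrE -?natrM ?ler0n// ler_nat.
Qed.

End sums_over_levels.

(** * Balancing the scales, and Jensen's inequality *)

Section power_inequalities.
Context {R : realType}.

Let powE (x r : R) : 0 < x -> x `^ r = expR (r * ln x).
Proof. by move=> x0; rewrite /powR gt_eqF. Qed.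

(** Here [Y] is [2 ^ |k|] and [N] is [b ^ n]. In logarithms the right side exceeds the left by
    [(ln N - ln Y) ((r - eps) P - delta)] if [Y <= N], and by [(ln Y - ln N) (1 - r P - delta)]
    otherwise; the hypotheses on [delta] are the signs of the two slopes. *)
Lemma scale_le (Y N r P eps delta : R) : 0 < Y -> 0 < N -> 1 <= P -> eps < 1 ->
  delta <= (r - eps) * P -> delta <= 1 - r * P ->
  (Y `^ r * Num.min 1 ((Y / N) `^ (1 - eps))) `^ P *
    (Num.max Y^-1 N^-1) `^ (P - 1) * Y^-1 <=
  (N `^ (r - 1)) `^ P * (Num.min (Y / N) (N / Y)) `^ delta.
Proof.
move=> Y0 N0 P1 e1 d1 d2.
have YN : 0 < Y / N by rewrite divr_gt0.
have NY : 0 < N / Y by rewrite divr_gt0.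
have lYN : ln (Y / N) = ln Y - ln N by rewrite lnM ?posrE ?invr_gt0// lnV.
have lNY : ln (N / Y) = ln N - ln Y by rewrite lnM ?posrE ?invr_gt0// lnV.
have YE : Y^-1 = expR (- ln Y) by rewrite expRN lnK.
have [h|h] := leP Y N.
  have hl : ln Y <= ln N by rewrite ler_ln.
  have y1 : Y / N <= 1 by rewrite ler_pdivrMr// mul1r.
  have y2 : 1 <= N / Y by rewrite ler_pdivlMr// mul1r.
  rewrite (min_idPl (le_trans y1 y2)) (_ : Num.max _ _ = Y^-1); last first.
    by apply/max_idPl; rewrite lef_pV2.
  apply: (@le_trans _ _ ((Y `^ r * (Y / N) `^ (1 - eps)) `^ P * Y^-1 `^ (P - 1) * Y^-1)).
    rewrite ler_wpM2r ?invr_ge0 ?(ltW Y0)// ler_wpM2r ?powR_ge0//.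
    apply: ge0_ler_powR; rewrite ?nnegrE ?(le_trans _ P1)//.
    - by rewrite mulr_ge0 ?powR_ge0// le_min ler01 powR_ge0.
    - by rewrite mulr_ge0 ?powR_ge0.
    - by rewrite ler_wpM2l ?powR_ge0// ge_min lexx orbT.
  rewrite !(powE _ Y0) (powE _ N0) !(powE _ YN) -expRD !powE ?expR_gt0 ?invr_gt0//.
  rewrite !expRK lnV// [X in _ * X]YE -!expRD ler_expR lYN.
  rewrite -subr_ge0 [leRHS](_ : _ = (ln N - ln Y) * ((r - eps) * P - delta)); last by ring.
  by rewrite mulr_ge0// subr_ge0.
have hl : ln N <= ln Y by rewrite ler_ln// ltW.
have y1 : 1 <= Y / N by rewrite ler_pdivlMr// mul1r ltW.
have y2 : N / Y <= 1 by rewrite ler_pdivrMr// mul1r ltW.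
rewrite (min_idPr (le_trans y2 y1)) (_ : Num.max _ _ = N^-1); last first.
  by apply/max_idPr; rewrite lef_pV2// ltW.
apply: (@le_trans _ _ ((Y `^ r) `^ P * N^-1 `^ (P - 1) * Y^-1)).
  rewrite ler_wpM2r ?invr_ge0 ?(ltW Y0)// ler_wpM2r ?powR_ge0//.
  apply: ge0_ler_powR; rewrite ?nnegrE ?(le_trans _ P1)//.
  - by rewrite mulr_ge0 ?powR_ge0// le_min ler01 powR_ge0.
  - by rewrite powR_ge0.
  - by rewrite -[leRHS]mulr1 ler_wpM2l ?powR_ge0// ge_min lexx.
rewrite !(powE _ Y0) !(powE _ N0) (powE _ NY) !powE ?expR_gt0 ?invr_gt0//.
rewrite !expRK lnV// [X in _ * X <= _]YE -!expRD ler_expR lNY.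
rewrite -subr_ge0 [leRHS](_ : _ = (ln Y - ln N) * (1 - r * P - delta)); last by ring.
by rewrite mulr_ge0// subr_ge0.
Qed.

Lemma le_1powR (x theta : R) : 0 <= x -> 1 <= theta -> x <= 1 + x `^ theta.
Proof.
move=> x0 t1; have [x1|/ltW x1] := leP x 1.
  by rewrite (le_trans x1)// lerDl powR_ge0.
rewrite -[leLHS](powRr1 x0) (le_trans (ler_powR x1 t1))//.
by rewrite lerDr ler01.
Qed.

(* Jensen's inequality up to a factor 2: sum [x <= 1 + x `^ theta] for
   [x = a k ^ 2 / (l * tau k)], with the best [l]. *)
Lemma sum_sqr_le (K : eqType) (s : seq K) (a tau : K -> R) (T B gam theta : R) :
  0 < B -> 0 <= gam -> 1 <= theta -> 0 < T ->
  (forall k, 0 < tau k) -> (forall k, 0 <= a k) ->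
  \sum_(k <- s) tau k <= T ->
  \sum_(k <- s) (tau k) `^ (1 - theta) * (a k) `^ (2 * theta) / (B `^ (2 * theta) * T) <= gam ->
  \sum_(k <- s) (a k) ^+ 2 <= 2 * B ^+ 2 * T * (1 + gam) `^ theta^-1.
Proof.
move=> B0 g0 t1 T0 tau0 a0 sT sg.
have g1 : 0 < 1 + gam by rewrite ltr_wpDr.
have th0 : 0 < theta by rewrite (lt_le_trans ltr01).
pose l := B ^+ 2 * (1 + gam) `^ theta^-1.
have l0 : 0 < l by rewrite mulr_gt0 ?exprn_gt0 ?powR_gt0.
have D0 : 0 < B `^ (2 * theta) * T by rewrite mulr_gt0 ?powR_gt0.
have term k : (a k) ^+ 2 <= l * tau k + l `^ (1 - theta) * ((tau k) `^ (1 - theta) * (a k) `^ (2 * theta)).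
  have lt0 : 0 < l * tau k by rewrite mulr_gt0.
  have x0 : 0 <= a k ^+ 2 / (l * tau k) by rewrite divr_ge0 ?exprn_ge0// ltW.
  have := le_1powR x0 t1; rewrite ler_pdivrMr// mulrDl mul1r => h.
  apply: (le_trans h); rewrite lerD2l le_eqVlt; apply/orP; left; apply/eqP.
  rewrite powRM ?invr_ge0 ?exprn_ge0 ?(ltW lt0)// -powR_mulrn// -powRrM.
  rewrite -[(l * tau k)^-1]powR_inv1 ?(ltW lt0)// -powRrM mulN1r.
  rewrite -mulrA -{2}[l * tau k]powRr1 ?(ltW lt0)// -powRD; last by rewrite (gt_eqF lt0) implybT.
  rewrite addrC powRM ?(ltW l0) ?(ltW (tau0 k))//; ring.
apply: le_trans (ler_sum _ (fun k _ => term k)) _.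
rewrite big_split/= -!mulr_sumr.
have e1 : \sum_(k <- s) (tau k) `^ (1 - theta) * (a k) `^ (2 * theta) <= gam * (B `^ (2 * theta) * T).
  by rewrite -ler_pdivrMr// mulr_suml.
apply: (@le_trans _ _ (l * T + l `^ (1 - theta) * (gam * (B `^ (2 * theta) * T)))).
  by apply: lerD; apply: ler_wpM2l; rewrite ?powR_ge0 ?(ltW l0).
have -> : l `^ (1 - theta) = (B ^+ 2) `^ (1 - theta) * ((1 + gam) `^ theta^-1 * (1 + gam)^-1).
  rewrite powRM ?exprn_ge0 ?(ltW B0) ?powR_ge0//; congr (_ * _).
  rewrite -powRrM -(powR_inv1 (ltW g1)) -powRD; last by rewrite (gt_eqF g1) implybT.
  by congr (_ `^ _); rewrite mulrBr mulr1 mulVf ?gt_eqF.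
have -> : B `^ (2 * theta) = (B ^+ 2) `^ theta by rewrite -powR_mulrn ?(ltW B0)// -powRrM.
have eB : (B ^+ 2) `^ (1 - theta) * (B ^+ 2) `^ theta = B ^+ 2.
  by rewrite -powRD ?subrK ?powRr1 ?exprn_ge0 ?(ltW B0)// (gt_eqF (exprn_gt0 2 B0)) implybT.
rewrite [leLHS](_ : _ = l * T + (B ^+ 2) `^ (1 - theta) * (B ^+ 2) `^ theta *
  (T * (1 + gam) `^ theta^-1 * (gam / (1 + gam)))); last by ring.
rewrite eB [leRHS](_ : _ = l * T + B ^+ 2 * (T * (1 + gam) `^ theta^-1 * 1)); last by rewrite /l; ring.
rewrite lerD2l ler_wpM2l ?exprn_ge0 ?(ltW B0)// ler_wpM2l ?mulr_ge0 ?powR_ge0 ?(ltW T0)//.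
by rewrite ler_pdivrMr// mul1r lerDr ler01.
Qed.

End power_inequalities.

Section integral_monotonicity.
Context {dX} {X : measurableType dX} {R : realType} (m : {measure set X -> \bar R}).

(* Unlike [ge0_le_integral], no measurability is needed. *)
Lemma integral_le_setT (f g : X -> \bar R) : (forall x, 0 <= f x)%E ->
  (forall x, f x <= g x)%E -> (\int[m]_x f x <= \int[m]_x g x)%E.
Proof.
move=> f0 fg; have g0 x : (0 <= g x)%E := le_trans (f0 x) (fg x).
rewrite !ge0_integralTE//; apply: ge_ereal_sup => _ [h hf <-].
by apply: ereal_sup_ubound; exists h => // x; exact: le_trans (hf x) (fg x).
Qed.

End integral_monotonicity.

(** * From moments of the blocks to the norm of the square function *)

Section lp_assembly.
Context {R : realType} {d : nat}.
Local Notation K := {ffun 'I_d -> nat}.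
Local Notation T := (d.-tuple (measurableTypeR R)).
Local Notation mu := (lebesgue_tuple R d).
Local Notation Rd := 'rV[R]_d.

(** The multi-indices of code below [N]. They present a sum over all multi-indices as an increasing
    sequence of finite sums, a series that can be integrated term by term. *)
Definition level_prefix (N : nat) : seq K := pmap (@pickle_inv K) (iota 0 N).

Lemma level_prefix_uniq N : uniq (level_prefix N).
Proof.
by apply: (@pmap_uniq _ _ _ (@pickle K)); [exact: pickle_invK|exact: iota_uniq].
Qed.

Lemma sum_level_prefix (F : K -> R) N :
  \sum_(i < N) (if @pickle_inv K i is Some k then F k else 0) =
  \sum_(k <- level_prefix N) F k.
Proof.
rewrite -(big_mkord xpredT (fun i => if @pickle_inv K i is Some k then F k else 0)).
rewrite /index_iota subn0 /level_prefix.
elim: (iota 0 N) => [|i l ih]; first by rewrite !big_nil.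
by rewrite big_cons ih /=; case: pickle_inv => [k|] /=; rewrite ?big_cons ?add0r.
Qed.

Lemma sum_le_level_prefix (F : K -> R) (s : seq K) : (forall k, 0 <= F k) -> uniq s ->
  exists N, \sum_(k <- s) F k <= \sum_(k <- level_prefix N) F k.
Proof.
move=> F0 us; exists (\max_(k <- s) @pickle K k).+1; set l := level_prefix _.
have sl k : k \in s -> k \in l.
  move=> ks; rewrite mem_pmap -(pickleK_inv k); apply: map_f.
  by rewrite mem_iota/= add0n ltnS (big_rem k)//= leq_maxl.
have perm_s : perm_eq [seq k <- l | k \in s] s.
  apply: uniq_perm; rewrite ?filter_uniq ?level_prefix_uniq// => k.
  by rewrite mem_filter; apply/andP/idP => [[]//|ks]; split=> //; exact: sl.
have : perm_eq l ([seq k <- l | k \in s] ++ [seq k <- l | k \notin s]).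
  by rewrite perm_sym; exact/permPl/perm_filterC.
move=> hp; rewrite [leRHS](perm_big _ hp)/= big_cat/= (perm_big _ perm_s)/= lerDl.
by rewrite sumr_ge0.
Qed.

Lemma esum_le_real (F : K -> R) (C : R) :
  (forall s : seq K, uniq s -> \sum_(k <- s) F k <= C) ->
  (\esum_(k in [set: K]) (F k)%:E <= C%:E)%E.
Proof.
move=> FC; apply: ge_ereal_sup => _ [A [finA _] <-].
rewrite fsbig_finite//= sumEFin lee_fin; apply: FC; exact: finmap.fset_uniq.
Qed.

(** Every [f k] carries a factor [W] outside its majorant [a k]. It makes the constant 1 that
    Jensen's inequality leaves behind integrable, and so lets moments of order [P] control an [L_p]
    norm. *)
Lemma Lnorm_square_function_le (p P : R) (f a : K -> T -> R) (W : T -> R)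
    (c B S CW CA : R) (tau : K -> R) :
  1 <= p -> p <= P -> 2 <= P -> 0 < c -> 0 < B -> 0 < S -> 0 <= CA ->
  (forall k t, 0 <= f k t <= c * W t * a k t) ->
  (forall t, 0 < W t <= 1) -> (forall k t, 0 <= a k t) ->
  measurable_fun setT W -> (forall k, measurable_fun setT (a k)) ->
  (\int[mu]_t (W t)%:E <= CW%:E)%E ->
  (forall k, 0 < tau k) -> (forall s : seq K, uniq s -> \sum_(k <- s) tau k <= S) ->
  (forall k, (\int[mu]_t (a k t `^ P)%:E <= (CA * B `^ P * tau k `^ (P / 2))%:E)%E) ->
  (Lnorm mu p%:E (fun t => (\esum_(k in [set: K]) (f k t ^+ 2)%:E) `^ 2^-1)%E <=
   ((2 * c ^+ 2 * B ^+ 2 * S) `^ 2^-1 * (CW + CA) `^ p^-1)%:E)%E.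
Proof.
move=> p1 pP P2 c0 B0 S0 CA0 fa W01 a0 mW ma iW tau0 sumtau ia.
have p0 : 0 < p by rewrite (lt_le_trans ltr01).
have P0 : 0 < P by rewrite (lt_le_trans p0).
have th1 : 1 <= P / 2 by rewrite ler_pdivlMr// mul1r.
have twice : 2 * (P / 2) = P by rewrite mulrC divfK.
have D0 : 0 < B `^ P * S by rewrite mulr_gt0 ?powR_gt0.
(* The terms of Jensen's inequality, normalised so that by [ia] the integral of [g k] is at most
   [CA / S * tau k], and the sum over [k] at most [CA]. *)
pose g k t := tau k `^ (1 - P / 2) * a k t `^ P / (B `^ P * S).
have g_ge0 k t : 0 <= g k t.
  by apply: divr_ge0 (ltW D0); apply: mulr_ge0; exact: powR_ge0.
pose gi i t : \bar R := (if @pickle_inv K i is Some k then g k t else 0)%:E.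
have gi_ge0 i t : (0 <= gi i t)%E by rewrite lee_fin; case: pickle_inv.
pose G t : \bar R := (\sum_(i <oo) gi i t)%E.
have G0 t : (0 <= G t)%E by apply: nneseries_ge0 => i _ _; exact: gi_ge0.
pose A := 2 * c ^+ 2 * B ^+ 2 * S.
have A0 : 0 < A.
  by apply: mulr_gt0 => //; apply: mulr_gt0 (exprn_gt0 _ B0); apply: mulr_gt0 (exprn_gt0 _ c0).
pose D := A `^ (p / 2).
have D_gt0 : 0 < D by exact: powR_gt0.
pose F t : \bar R := ((\esum_(k in [set: K]) (f k t ^+ 2)%:E) `^ 2^-1)%E.
have F0 t : (0 <= F t)%E by exact: poweR_ge0.
have e0 t : (0 <= \esum_(k in [set: K]) (f k t ^+ 2)%:E)%E.
  by apply: esum_ge0 => k _; rewrite lee_fin exprn_ge0//; have /andP[] := fa k t.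
(* Where [G] is finite, [sum_sqr_le] bounds the square function by [A ^ (1/2) W (1 + G) ^ (1/P)]. As
   [W <= 1 <= p] and [p <= P], its power of order [p] is at most [D W (1 + G)], and [W G <= G]. *)
have point t : (`|F t| `^ p <= D%:E * ((W t)%:E + G t))%E.
  have /andP[W0 W1] := W01 t.
  case EG : (G t) => [gam| |]; last by have := G0 t; rewrite EG.
    have gam0 : 0 <= gam by rewrite -lee_fin -EG.
    have sg (s : seq K) : uniq s -> \sum_(k <- s) g k t <= gam.
      move=> us; have [N hN] := sum_le_level_prefix (fun k => g_ge0 k t) us.
      apply: (le_trans hN); rewrite -lee_fin -EG -sum_level_prefix -sumEFin.
      rewrite -(big_mkord xpredT (fun i => gi i t)).
      by apply: nneseries_lim_ge => i _ _; exact: gi_ge0.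
    pose X := A * (W t ^+ 2 * (1 + gam) `^ (P / 2)^-1).
    have g1 : 1 <= 1 + gam by rewrite lerDl.
    have X0 : 0 <= X.
      by apply: mulr_ge0 (ltW A0) _; apply: mulr_ge0; [exact: exprn_ge0 (ltW W0)|exact: powR_ge0].
    have FX : (F t <= (X `^ 2^-1)%:E)%E.
      rewrite -poweR_EFin; apply: gt0_ler_poweR => //.
      - by rewrite in_itv/= e0 leey.
      - by rewrite in_itv/= lee_fin X0 leey.
      apply: esum_le_real => s us.
      have := @sum_sqr_le R K s (fun k => a k t) tau S B gam (P / 2) B0 gam0 th1 S0 tau0 (fun k => a0 k t) (sumtau s us).
      rewrite twice => /(_ (sg s us)) h.
      apply: (@le_trans _ _ (\sum_(k <- s) (c * W t) ^+ 2 * a k t ^+ 2)).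
        apply: ler_sum => k _; rewrite -exprMn; have /andP[f0 fk] := fa k t.
        by apply: lerXn2r; rewrite ?nnegrE ?(le_trans f0 fk).
      rewrite -mulr_sumr; apply: le_trans (ler_wpM2l (sqr_ge0 _) h) _.
      by rewrite le_eqVlt; apply/orP; left; apply/eqP; rewrite /X /A; ring.
    rewrite gee0_abs//; apply: (@le_trans _ _ ((X `^ 2^-1) `^ p)%:E).
      rewrite -poweR_EFin; apply: gt0_ler_poweR FX; first exact: ltW.
      - by rewrite in_itv/= F0 leey.
      - by rewrite in_itv/= lee_fin powR_ge0 leey.
    rewrite -EFinD -EFinM lee_fin -powRrM [2^-1 * p]mulrC.
    rewrite /X powRM ?(ltW A0)//; last by apply: mulr_ge0; [exact: exprn_ge0 (ltW W0)|exact: powR_ge0].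
    apply: ler_wpM2l; first exact: ltW.
    rewrite powRM ?powR_ge0 ?sqr_ge0// -powR_mulrn ?(ltW W0)// -!powRrM.
    rewrite [2%:R * _](_ : _ = p); last by field.
    apply: (@le_trans _ _ (W t * (1 + gam))).
      apply: ler_pM; rewrite ?powR_ge0//.
        rewrite -[leRHS](powRr1 (ltW W0)); exact: ger_powR (W01 t) _ _ p1.
      apply: ler1_powR => //; rewrite (_ : _ * _ = p / P); last by field; rewrite gt_eqF.
      by rewrite ler_pdivrMr// mul1r.
    by rewrite mulrDr mulr1 lerD2l -[leRHS]mul1r ler_wpM2r.
  by rewrite addey// mulry gtr0_sg// mul1e leey.
have mgi i : measurable_fun setT (gi i).
  apply/measurable_EFinP; case: (pickle_inv i) => [k|]; last exact: measurable_cst.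
  apply: measurable_funM; last exact: measurable_cst.
  apply: measurable_funM; first exact: measurable_cst.
  exact: (measurableT_comp (measurable_powR P) (ma k)).
have mG : measurable_fun setT G by apply: ge0_emeasurable_sum => // i t _ _; exact: gi_ge0.
have mWE : measurable_fun setT (fun t => (W t)%:E) by exact/measurable_EFinP.
have W0 t : (0 <= (W t)%:E)%E by rewrite lee_fin; have /andP[/ltW] := W01 t.
have iG : (\int[mu]_t G t <= CA%:E)%E.
  rewrite integral_nneseries//.
  have igi i : (\int[mu]_t gi i t <= (if @pickle_inv K i is Some k then CA / S * tau k else 0)%:E)%E.
    rewrite /gi; case: (pickle_inv i) => [k|]; last by rewrite integral0.
    have e t : (g k t)%:E = ((tau k `^ (1 - P / 2) / (B `^ P * S))%:E * (a k t `^ P)%:E)%E.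
      by rewrite -EFinM; congr (_%:E); rewrite /g; ring.
    under eq_integral do rewrite e.
    have u0 : 0 <= tau k `^ (1 - P / 2) / (B `^ P * S).
      by apply: divr_ge0 (ltW D0); exact: powR_ge0.
    have mak : measurable_fun setT (fun t => (a k t `^ P)%:E).
      by apply/measurable_EFinP; exact: (measurableT_comp (measurable_powR P) (ma k)).
    rewrite ge0_integralZl//=; last by move=> t _; rewrite lee_fin powR_ge0.
    apply: (le_trans (lee_wpmul2l _ (ia k))); first by rewrite lee_fin.
    rewrite -EFinM lee_fin le_eqVlt; apply/orP; left; apply/eqP.
    have e1 : tau k `^ (1 - P / 2) * tau k `^ (P / 2) = tau k.
      by rewrite -powRD ?subrK ?powRr1 ?(ltW (tau0 k))// (gt_eqF (tau0 k)) implybT.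
    rewrite -[in RHS]e1; field; rewrite (gt_eqF S0) gt_eqF ?powR_gt0//.
  apply: lime_le; first by apply: is_cvg_nneseries => i _ _; apply: integral_ge0 => t _; exact: gi_ge0.
  apply: nearW => N; rewrite big_mkord.
  apply: (@le_trans _ _ (\sum_(i < N) (if @pickle_inv K i is Some k then CA / S * tau k else 0)%:E)%E).
    by apply: lee_sum => i _; exact: igi.
  rewrite sumEFin lee_fin (sum_level_prefix (fun k => CA / S * tau k)) -mulr_sumr.
  apply: le_trans (ler_wpM2l _ (sumtau _ (level_prefix_uniq N))) _.
    by apply: divr_ge0 => //; exact: ltW.
  by rewrite divfK// gt_eqF.
have CW0 : 0 <= CW.
  by rewrite -lee_fin; apply: le_trans iW; apply: integral_ge0.
rewrite unlock -/F.
apply: (@le_trans _ _ ((D * (CW + CA)) `^ p^-1)%:E).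
  rewrite -poweR_EFin; apply: gt0_ler_poweR; first by rewrite invr_ge0 ltW.
  - by rewrite in_itv/= leey andbT; apply: integral_ge0 => t _; exact: poweR_ge0.
  - by rewrite in_itv/= leey andbT lee_fin; apply: mulr_ge0 (ltW D_gt0) _; exact: addr_ge0.
  apply: le_trans (integral_le_setT _ _ point) _; first by move=> t; exact: poweR_ge0.
  have mWG : measurable_fun setT (fun t => (W t)%:E + G t)%E by exact: emeasurable_funD.
  have WG0 t : setT t -> (0 <= (W t)%:E + G t)%E by move=> _; exact: adde_ge0.
  rewrite ge0_integralZl ?lee_fin ?(ltW D_gt0)//=.
  rewrite EFinM; apply: lee_wpmul2l; first by rewrite lee_fin ltW.
  rewrite ge0_integralD//.
  by rewrite EFinD; exact: leeD.
rewrite lee_fin powRM ?(ltW D_gt0) ?addr_ge0// /D -powRrM.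
by rewrite [p / 2 / p](_ : _ = 2^-1); last by field; rewrite gt_eqF.
Qed.

End lp_assembly.

(** * Moments of the blocks *)

Section block_integral.
Context {R : realType} {d b s n v : nat}.
Variable M : 'I_d -> 'M['F_b]_(s, n).
Hypothesis bP : prime b.
Hypothesis netM : order_digital_net 1 v M.
Local Notation T := (d.-tuple (measurableTypeR R)).
Local Notation mu := (lebesgue_tuple R d).
Local Notation K := {ffun 'I_d -> nat}.
Local Notation W := (fun t : T => om_prod (vec_of t)).

(** [2 ^ (r |k|)] times the bound of [block_le], without its constant and with one of its two
    factors [om_prod] left out; that factor is the [W] of [Lnorm_square_function_le]. *)
Definition block_majorant (r eps : R) (k : K) (t : T) : R :=
  (2 ^+ (\sum_i k i)%N) `^ r *
    Num.min 1 ((2 ^+ (\sum_i k i)%N / b%:R ^+ n) `^ (1 - eps)) *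
    (om_prod (vec_of t) * (netS M k (vec_of t) + 2 ^- (\sum_i k i)%N)).

Let integral_real (f : T -> R) : mu.-integrable setT (fun t => (f t)%:E) ->
  (\int[mu]_t (f t)%:E = (Rintegral mu setT f)%:E)%E.
Proof. by move=> If; rewrite /Rintegral fineK// integral_fune_fin_num. Qed.

Lemma om_prod_measurable : measurable_fun setT W.
Proof.
have [I _] := @om_prod_integral R d.
by apply/measurable_EFinP; exact: (measurable_int mu I).
Qed.

Lemma netS_measurable (k : K) : measurable_fun setT (fun t : T => netS M k (vec_of t) : R).
Proof.
have [I _] := netS_integral (R := R) M bP k.
by apply/measurable_EFinP; exact: (measurable_int mu I).
Qed.

Lemma block_majorant_measurable r eps (k : K) : measurable_fun setT (block_majorant r eps k).
Proof.
apply: measurable_funM; first exact: measurable_cst.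
apply: measurable_funM; first exact: om_prod_measurable.
by apply: measurable_funD; [exact: netS_measurable|exact: measurable_cst].
Qed.

Lemma block_majorant_ge0 r eps (k : K) t : 0 <= block_majorant r eps k t.
Proof.
apply: mulr_ge0; first by apply: mulr_ge0; [exact: powR_ge0|rewrite le_min ler01 powR_ge0].
apply: mulr_ge0; first exact: om_prod_ge0.
by apply: addr_ge0; [exact: netS_ge0|rewrite invr_ge0 exprn_ge0].
Qed.

(** Interpolation between supremum and integral: [P - 1] of the powers are bounded by [netS_le] and
    the last one is integrated, [netS] having mass [(2 pi) ^ d / 2 ^ |k|] and the weight mass
    [pi ^ d]. Then [scale_le] collects the powers of [2 ^ |k|] and [b ^ n]. *)
Lemma block_majorant_integral (r eps P delta : R) (k : K) : 1 <= P -> eps < 1 ->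
  delta <= (r - eps) * P -> delta <= 1 - r * P ->
  (\int[mu]_t (block_majorant r eps k t `^ P)%:E <=
   (((3 * b%:R ^+ 2 * (6 * pi)) ^+ d * b%:R ^+ v + 1) `^ (P - 1) * ((2 * pi) ^+ d + pi ^+ d) *
    ((b%:R ^+ n) `^ (r - 1)) `^ P *
    (Num.min (2 ^+ (\sum_i k i)%N / b%:R ^+ n)
             (b%:R ^+ n / 2 ^+ (\sum_i k i)%N)) `^ delta)%:E)%E.
Proof.
move=> P1 e1 d1 d2.
have P0 : 0 < P by rewrite (lt_le_trans ltr01).
have b0R : 0 < b%:R :> R by rewrite ltr0n prime_gt0.
set Y := 2 ^+ (\sum_i k i)%N; set N := b%:R ^+ n.
have Y0 : 0 < Y :> R by rewrite exprn_gt0.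
have N0 : 0 < N by rewrite exprn_gt0.
(* The constant of [netS_le], plus 1 for the term [2 ^- |k|] next to [netS]. *)
set C := _ * _ ^+ v + 1.
have C1 : 1 <= C.
  by rewrite lerDr mulr_ge0 ?exprn_ge0 ?mulr_ge0 ?pi_ge0 ?exprn_ge0 ?(ltW b0R).
have C0 : 0 <= C by rewrite (le_trans ler01).
pose m := Y `^ r * Num.min 1 ((Y / N) `^ (1 - eps)).
have m0 : 0 <= m by rewrite mulr_ge0 ?powR_ge0// le_min ler01 powR_ge0.
pose X := Num.max Y^-1 N^-1.
have X0 : 0 <= X by rewrite le_max invr_ge0 (ltW Y0).
pose A := m `^ P * (C * X) `^ (P - 1).
have A0 : 0 <= A by rewrite mulr_ge0 ?powR_ge0.
have [Iw Ew] := @om_prod_integral R d.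
have [Is Es] := netS_integral (R := R) M bP k.
have S0 t : 0 <= netS M k (vec_of t) :> R by exact: netS_ge0.
have W0 t : 0 <= om_prod (vec_of t) :> R by exact: om_prod_ge0.
have point t : block_majorant r eps k t `^ P <=
    A * (netS M k (vec_of t) + Y^-1 * om_prod (vec_of t)).
  rewrite /block_majorant -/Y -/N -/m.
  have := netS_le (R := R) bP netM k (vec_of t); rewrite -/Y -/N -/X.
  have := om_prod_le1 (vec_of t); move: (S0 t) (W0 _ t).
  move: (netS M k _) (om_prod _) => S w Sge0 w0 w1 SX.
  have u0 : 0 <= Y^-1 by rewrite invr_ge0 ltW.
  have SuX : S + Y^-1 <= C * X.
    by rewrite /C mulrDl mul1r lerD// le_max lexx.
  have wS0 : 0 <= w * (S + Y^-1) by rewrite mulr_ge0// addr_ge0.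
  rewrite powRM// /A -mulrA ler_wpM2l ?powR_ge0//.
  have e (y : R) : 0 <= y -> y `^ P = y `^ (P - 1) * y.
    by move=> y0; rewrite -{3}(powRr1 y0) -powRD ?subrK// (gt_eqF P0).
  rewrite e//; apply: ler_pM; rewrite ?powR_ge0//.
    apply: ge0_ler_powR; rewrite ?nnegrE ?subr_ge0//; first exact: mulr_ge0.
    by apply: le_trans SuX; rewrite ler_piMl// addr_ge0.
  by rewrite mulrDr lerD// ?ler_piMl// mulrC.
apply: (@le_trans _ _ (\int[mu]_t (A * (netS M k (vec_of t) + Y^-1 * om_prod (vec_of t)))%:E)%E).
  by apply: integral_le_setT => t; rewrite lee_fin ?powR_ge0.
have mS : measurable_fun setT (fun t : T => (netS M k (vec_of t) : R)%:E) by exact: (measurable_int mu Is).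
have mW : measurable_fun setT (fun t : T => (om_prod (vec_of t) : R)%:E) by exact: (measurable_int mu Iw).
have IW' : mu.-integrable setT (fun t => (Y^-1 * om_prod (vec_of t))%:E) by exact: (integrableZl measurableT _ Iw).
have IS' : mu.-integrable setT (fun t => (netS M k (vec_of t) + Y^-1 * om_prod (vec_of t))%:E).
  exact: (integrableD measurableT Is IW').
rewrite integral_real; last exact: (integrableZl measurableT _ IS').
rewrite RintegralZl// RintegralD// Es RintegralZl// Ew lee_fin.
have := scale_le Y0 N0 P1 e1 d1 d2; rewrite -/m -/X => h.
rewrite [leLHS](_ : _ = C `^ (P - 1) * ((2 * pi) ^+ d + pi ^+ d) * (m `^ P * X `^ (P - 1) * Y^-1)); last first.
  by rewrite /A powRM//; ring.
rewrite -[leRHS]mulrA; apply: ler_wpM2l h.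
by apply: mulr_ge0; [exact: powR_ge0|rewrite addr_ge0 ?exprn_ge0 ?mulr_ge0 ?pi_ge0].
Qed.

End block_integral.

(** * Choice of the parameters and conclusion *)

Unset Implicit Arguments.
Set Strict Implicit.
Set Printing Implicit Defensive.

Theorem corollary1p6 (R : realType) (d b v : nat) (p r : R)
    (phi0 : R -> R[i]) :
  (1 <= d)%N -> prime b -> 1 <= p -> 0 < r -> r < 1 / Num.max p 2 ->
  resolution_seed phi0 ->
  exists2 C : R, 0 < C &
    forall (n s : nat) (M : 'I_d -> 'M['F_b]_(s, n)),
      (0 < n)%N -> order_digital_net 1 v M ->
      (SH_cube_norm phi0 p r
         (cube_distribution (discrepancy (@digital_net R d b s n M)))
       <= (C * b%:R `^ (n%:R * (r - 1)) * n%:R `^ ((d%:R - 1) / 2))%:E)%E.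
Proof.
move=> d1 bP p1 r0 rp seed.
set P := Num.max p 2 in rp *.
have P2 : 2 <= P by rewrite le_max lexx orbT.
have pP : p <= P by rewrite le_max lexx.
have P1 : 1 <= P by rewrite (le_trans _ P2)// ler1n.
have P0 : 0 < P by rewrite (lt_le_trans ltr01).
have b1 := prime_gt1 bP.
have b0R : 0 < b%:R :> R by rewrite ltr0n prime_gt0.
have rP : r * P < 1 by rewrite -ltr_pdivlMr.
have r1 : r < 1 by rewrite (le_lt_trans _ rP)// ler_peMr// ltW.
(* Any [eps] strictly between 0 and [r] keeps the rate [(r - eps) P] below the critical level
   positive. *)
pose eps := r / 2.
have eps01 : 0 < eps < 1 by rewrite /eps; lra.
(* The smaller of the decay rates on the two sides of the critical level [2 ^ |k| = b ^ n]; the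
   second one is positive because [r < 1 / P]. *)
pose delta := Num.min (r / 2 * P) (1 - r * P).
have delta0 : 0 < delta by rewrite lt_min mulr_gt0 ?divr_gt0//= subr_gt0.
have delta1 : delta <= (r - eps) * P.
  by rewrite ge_min (_ : r - eps = r / 2) ?lexx//; rewrite /eps; field.
have delta2 : delta <= 1 - r * P by rewrite ge_min lexx orbT.
have P20 : 0 < P / 2 by rewrite divr_gt0.
(* The exponent of the weights [tau], chosen so that [tau ^ (P / 2)] is the factor of exponent
   [delta] in [block_majorant_integral]. *)
have delta'0 : 0 < delta / (P / 2) by rewrite divr_gt0.
have [CT CT0 sum_tau] := @sum_tau_le R d b _ d1 b1 delta'0.
have [C1 C10 blk] := @block_le R d phi0 seed b v bP eps eps01.
pose CA : R := ((3 * b%:R ^+ 2 * (6 * pi)) ^+ d * b%:R ^+ v + 1) `^ (P - 1) * ((2 * pi) ^+ d + pi ^+ d).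
have pid0 : 0 < pi ^+ d :> R by rewrite exprn_gt0// pi_gt0.
have CA0 : 0 <= CA.
  by apply: mulr_ge0; [exact: powR_ge0|rewrite addr_ge0 ?exprn_ge0 ?mulr_ge0 ?pi_ge0].
pose c := C1 + 1.
have c0 : 0 < c by rewrite ltr_wpDl.
have A0 : 0 < 2 * c ^+ 2 * CT by apply: mulr_gt0 CT0; apply: mulr_gt0 (exprn_gt0 _ c0).
exists ((2 * c ^+ 2 * CT) `^ 2^-1 * (pi ^+ d + CA) `^ p^-1).
  by apply: mulr_gt0; apply: powR_gt0 => //; exact: ltr_pwDl.
move=> n s M n0 netM.
pose z := @digital_net R d b s n M.
pose g := function_distribution (extension z).
have z01 nu i : 0 <= z nu 0 i < 1 by exact: (digital_net01 bP netM).
have N0 : 0 < b%:R ^+ n :> R by rewrite exprn_gt0.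
pose B := (b%:R ^+ n) `^ (r - 1) : R.
have B0 : 0 < B by exact: powR_gt0.
have nd0 : 0 < n%:R ^+ d.-1 :> R by rewrite exprn_gt0// ltr0n.
have S0 : 0 < CT * n%:R ^+ d.-1 by exact: mulr_gt0.
pose f (k : {ffun 'I_d -> nat}) (t : d.-tuple (measurableTypeR R)) : R :=
  (2 ^+ (\sum_i k i)%N) `^ r * normc (net_block phi0 z k (vec_of t)).
have SFE : SF_norm phi0 p 2 r g = Lnorm (lebesgue_tuple R d) p%:E
    (fun t => (\esum_(k in [set: {ffun 'I_d -> nat}]) (f k t ^+ 2)%:E) `^ 2^-1)%E.
  rewrite /SF_norm; congr (Lnorm _ _ _); apply/funext => t; congr (_ `^ _)%E.
  apply: eq_esum => k _; congr (_%:E).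
  rewrite /f exprMn block_extension// -!powR_mulrn ?normc_ge0 ?powR_ge0//; congr (_ * _).
  by rewrite -!powRrM; congr (_ `^ _); ring.
have bound : (SF_norm phi0 p 2 r g <=
    ((2 * c ^+ 2 * B ^+ 2 * (CT * n%:R ^+ d.-1)) `^ 2^-1 * (pi ^+ d + CA) `^ p^-1)%:E)%E.
  rewrite SFE.
  apply: (@Lnorm_square_function_le _ _ p P f (block_majorant M r eps) (fun t => om_prod (vec_of t))
    c B _ _ CA (fun k => (Num.min (2 ^+ (\sum_i k i)%N / b%:R ^+ n)
                         (b%:R ^+ n / 2 ^+ (\sum_i k i)%N)) `^ (delta / (P / 2)))) => //.
  - move=> k t; rewrite mulr_ge0 ?powR_ge0 ?normc_ge0//=.
    have := blk n s M netM k (vec_of t).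
    have Z0 : 0 <= om_prod (vec_of t) * block_majorant M r eps k t.
      by apply: mulr_ge0; [exact: om_prod_ge0|exact: block_majorant_ge0].
    rewrite /f -/z => h; apply: (le_trans (ler_wpM2l (powR_ge0 _ _) h)).
    rewrite [leLHS](_ : _ = C1 * (om_prod (vec_of t) * block_majorant M r eps k t)); last first.
      by rewrite /block_majorant; ring.
    by rewrite -[leRHS]mulrA ler_wpM2r// lerDl.
  - by move=> t; rewrite om_prod_gt0 om_prod_le1.
  - by move=> k t; exact: block_majorant_ge0.
  - exact: om_prod_measurable.
  - by move=> k; exact: block_majorant_measurable.
  - have [I E] := @om_prod_integral R d.
    by rewrite -E /Rintegral fineK// integral_fune_fin_num.
  - by move=> k; rewrite powR_gt0// lt_min !divr_gt0 ?exprn_gt0.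
  - by move=> l ul; exact: sum_tau.
  - move=> k; rewrite -powRrM divfK ?gt_eqF//.
    by apply: block_majorant_integral => //; have /andP[] := eps01.
have fin : (SF_norm phi0 p 2 r g < +oo)%E by exact: le_lt_trans bound (ltry _).
(* [g] is admissible in the infimum: it is tempered, its norm is finite by [bound], and it agrees
   with the discrepancy function on test functions. *)
apply: le_trans (le_trans bound _).
  apply: ereal_inf_lbound; exists g => //; split; last first.
    by move=> psi; exact: extension_cube_distribution.
  split=> //; apply: tempered_function_distribution.
  exact: extension_cintble.
(* Both sides are equal: the square root of [B ^ 2] is [b ^ (n (r - 1))], and that of the total
   weight of the levels, of order [n ^ (d - 1)], is the remaining power of [n]. *)
rewrite lee_fin le_eqVlt; apply/orP; left; apply/eqP.
have dE : d%:R - 1 = d.-1%:R :> R by rewrite -subn1 natrB.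
rewrite (_ : 2 * c ^+ 2 * B ^+ 2 * (CT * n%:R ^+ d.-1) = 2 * c ^+ 2 * CT * (B ^+ 2 * n%:R ^+ d.-1)); last by ring.
have B20 : 0 <= B ^+ 2 := sqr_ge0 B.
rewrite (powRM _ (ltW A0) (mulr_ge0 B20 (ltW nd0))) (powRM _ B20 (ltW nd0)).
have -> : (B ^+ 2) `^ 2^-1 = b%:R `^ (n%:R * (r - 1)).
  rewrite -powR_mulrn ?(ltW B0)// -powRrM mulfV// powRr1 ?(ltW B0)//.
  by rewrite /B -powR_mulrn ?(ltW b0R)// -powRrM.
have -> : (n%:R ^+ d.-1) `^ 2^-1 = n%:R `^ ((d%:R - 1) / 2) :> R.
  by rewrite dE -powR_mulrn// -powRrM.
ring.
Qed.
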